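(* Let $(G,K)$ be a Gelfand pair with $L^2(G//K)$ separable, and let $\alpha$ be a topological automorphism of $G$. Let $\theta\in L^2(G//K)$ be such that $\|\theta\|_{L^2(G//K)}=1$. If $u\in L^1(G\times\mathcal{S}^+)$, then the localization operator $\mathcal{L}_{\theta,\alpha}^{u}:L^2(G//K)\to L^2(G//K)$ is in the trace class $S_1(L^2(G//K))$ and $$\|\mathcal{L}_{\theta,\alpha}^{u}\|_{S_1(L^2(G//K))}\leq\|u\|_{L^1(G\times\mathcal{S}^+)}.$$
   Context: $G$ is a locally compact Hausdorff group with left Haar measure $dx$, and $K$ is a compact subgroup. A function $f$ on $G$ is $K$-bi-invariant if $f(kxk')=f(x)$ for all $x\in G$, $k,k'\in K$. $\mathcal{C}_c(G//K)$ is the space of continuous compactly supported $K$-bi-invariant complex functions, and $L^p(G//K)$ is the space of $K$-bi-invariant elements of $L^p(G)$, with the norm of $L^p(G)$; the inner product $\langle f,g\rangle_{L^2(G//K)}$ means $\int_G f\overline{g}\,dx$. $(G,K)$ is a Gelfand pair if $\mathcal{C}_c(G//K)$ is commutative under convolution $(f\ast g)(x)=\int_G f(y)g(y^{-1}x)dy$ (then $G$ is unimodular). A spherical function is a continuous $K$-bi-invariant function $\varphi$ on $G$ such that $f\mapsto\int_G f(x)\varphi(x)dx$ is a nontrivial character of the convolution algebra $\mathcal{C}_c(G//K)$. $\mathcal{S}_b(G,K)$ is the set of bounded spherical functions, and $\mathcal{S}^+\subset\mathcal{S}_b(G,K)$ is the set of positive-definite spherical functions. The spherical Fourier transform of $f\in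 L^1(G//K)$ is $\widehat f(\varphi)=\int_G f(x)\varphi(x^{-1})dx$. $\mathcal{S}_b(G,K)$ has the weak topology generated by the maps $\widehat f$, $f\in L^1(G//K)$. $\mathcal{S}^+$ carries the Plancherel measure, denoted $d\varphi$: the positive Radon measure such that, whenever $f\in L^1(G//K)$ is a linear combination of positive-definite $K$-bi-invariant functions, $\widehat f\in L^1(\mathcal{S}^+)$ and $f(x)=\int_{\mathcal{S}^+}\widehat f(\varphi)\varphi(x)\,d\varphi$; the map $f\mapsto \widehat f$ on $L^1(G//K)\cap L^2(G//K)$ extends to an isometry of $L^2(G//K)$ onto $L^2(\mathcal{S}^+)$. $L^p(G\times\mathcal{S}^+)$ is taken with respect to $dt\,d\varphi$. For a topological automorphism $\alpha$ of $G$, $\delta_\alpha>0$ is the constant with $d(\alpha(x))=\delta_\alpha dx$, i.e. $\int_G f(\alpha(x))dx=\delta_\alpha^{-1}\int_G f(x)dx$. For $\theta\in L^2(G//K)$, $t\in G$, $\varphi\in\mathcal{S}_b(G,K)$, put $\theta_{\alpha,\varphi,t}(x)=\delta_\alpha^{1/2}\varphi(x)\theta(\alpha(t^{-1}x))$. The Stockwell transform is $S_{\theta,\alpha}f(t,\varphi)=\langle f,\theta_{\alpha,\varphi,t}\rangle_{L^2(G//K)}=\delta_\alpha^{1/2}\int_G f(x)\overline{\varphi(x)\theta(\alpha(t^{-1}x))}\,dx$ for $f\in L^2(G//K)$. For a measurable $u:G\times\mathcal{S}^+\to\mathbb{C}$, the localization operator is defined for $f\in L^2(G//K)$ by $$\mathcal{L}_{\theta,\alpha}^{u}f(x)=\int_{\mathcal{S}^+}\int_G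 u(t,\varphi)\,S_{\theta,\alpha}f(t,\varphi)\,\theta_{\alpha,\varphi,t}(x)\,dt\,d\varphi,\quad x\in G.$$ Schatten-von Neumann classes: for a separable complex Hilbert space $H$ and a compact operator $T$ on $H$, the singular values $s_k(T)$, $k=1,2,\dots$, are the eigenvalues of $|T|=\sqrt{T^*T}$ (counted with multiplicity). For $1\le p<\infty$, $S_p(H)$ is the set of compact $T$ with $\|T\|_{S_p(H)}=\left(\sum_{k}s_k(T)^p\right)^{1/p}<\infty$; $S_1(H)$ is the trace class.
   Formalization: The pointwise L f lies in L²(G) but need not be K-bi-invariant, so the localization operator is read as the operator on L²(G//K) whose value at f has the same inner products with all g in L²(G//K) as L f (its orthogonal projection). *)

(* Defs.v *)
From HB Require Import structures.
From mathcomp Require Import all_boot all_order all_algebra.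
From mathcomp Require Import all_classical all_reals all_analysis measurable_realfun.
From mathcomp Require Export complex.

Set Implicit Arguments.
Unset Strict Implicit.
Unset Printing Implicit Defensive.

Import Order.TTheory GRing.Theory Num.Theory.
Import numFieldNormedType.Exports.

Local Open Scope classical_set_scope.
Local Open Scope ring_scope.
Local Open Scope complex_scope.

(* The built-in `Pointed` structure is only there because `measurableType`    *)
(* requires it; a group is inhabited anyway.                                  *)
HB.mixin Record isTopologicalGroup G of Topological G & Group G := {
  mulg_continuous : continuous (fun p : G * G => (p.1 * p.2)%g) ;
  invg_continuous : continuous (fun x : G => (x^-1)%g) }.

#[short(type="topGroupType")]
HB.structure Definition TopologicalGroup :=
  {G of Pointed G & Topological G & Group G & isTopologicalGroup G}.

Notation borel T := (g_sigma_algebraType (@open T)).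

Section ComplexIntegration.
Context d (T : measurableType d) (R : realType).
Implicit Types (D : set T) (f : T -> R[i]).

Definition cmeasurable_fun D f :=
  measurable_fun D (fun x => complex.Re (f x)) /\
  measurable_fun D (fun x => complex.Im (f x)).

(* Real and imaginary parts are integrated separately. `Rintegral` is a       *)
(* total function, so this is only meaningful for integrable f.               *)
Definition cintegral (m : {measure set T -> \bar R}) D f : R[i] :=
  (\int[m]_(x in D) complex.Re (f x)) +i* (\int[m]_(x in D) complex.Im (f x)).

Definition L1norm (m : set T -> \bar R) D f : \bar R :=
  (\int[m]_(x in D) (Normc.normc (f x))%:E)%E.

Definition L2norm_sq (m : set T -> \bar R) D f : \bar R :=
  (\int[m]_(x in D) (Normc.normc (f x) ^+ 2)%:E)%E.

Definition inL1 m D f := cmeasurable_fun D f /\ (L1norm m D f < +oo)%E.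

Definition inL2 m D f := cmeasurable_fun D f /\ (L2norm_sq m D f < +oo)%E.

Definition inner (m : {measure set T -> \bar R}) (f g : T -> R[i]) : R[i] :=
  cintegral m setT (fun x => f x * (g x)^*).

End ComplexIntegration.

Definition radon_measure (R : realType) (T : ptopologicalType)
    (m : set (borel T) -> \bar R) : Prop :=
  [/\ forall C : set T, compact C -> (m C < +oo)%E,
      forall A : set (borel T), measurable A ->
        m A = ereal_inf [set m U | U in [set U : set T | open U /\ A `<=` U]] &
      forall U : set T, open U ->
        m U = ereal_sup [set m C | C in [set C : set T | compact C /\ C `<=` U]] ].

(* Operators on a complex Hilbert space. The space is given by a set H of     *)
(* vectors of V together with a positive semidefinite form ip on H; it stands *)
(* for the quotient of H by the null vectors of ip. This is how L^2 spaces    *)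
(* are handled below: vectors are functions, null vectors are the functions   *)
(* vanishing almost everywhere.                                               *)
Section Hilbert.
Context (R : realType) (V : lmodType R[i]).
Variables (H : set V) (ip : V -> V -> R[i]).
Implicit Types (T A : V -> V).

Definition hnorm (x : V) : R := Num.sqrt (complex.Re (ip x x)).

Definition heq (x y : V) : Prop := hnorm (x - y) = 0.

Definition hseparable : Prop :=
  exists d : nat -> V, (forall n, H (d n)) /\
    forall x, H x -> forall e : R, 0 < e -> exists n, hnorm (x - d n) < e.

Definition linear_operator T : Prop :=
  (forall x, H x -> H (T x)) /\
  forall (a : R[i]) x y, H x -> H y -> heq (T (a *: x + y)) (a *: T x + T y).

Definition compact_operator T : Prop :=
  linear_operator T /\
  forall x : nat -> V, (forall n, H (x n)) ->
    (exists M : R, forall n, hnorm (x n) <= M) ->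
    exists (k : nat -> nat) (y : V),
      [/\ {homo k : m n / (m < n)%N}, H y &
          (fun n => hnorm (T (x (k n)) - y)) @ \oo --> (0 : R)].

Definition is_adjoint T A : Prop :=
  linear_operator A /\ forall x y, H x -> H y -> ip (T x) y = ip x (A y).

(* A = |T|: the positive operator with A^2 = T^* T.                           *)
Definition is_abs_operator T A : Prop :=
  [/\ linear_operator A, forall x, H x -> 0 <= ip (A x) x &
      exists2 Tadj, is_adjoint T Tadj &
        forall x, H x -> heq (A (A x)) (Tadj (T x))].

(* |T|, which exists and is unique up to null vectors for bounded T.          *)
Definition abs_operator T : V -> V := xget (fun=> 0) [set A | is_abs_operator T A].

(* Dimension of the eigenspace of A for the eigenvalue l, as the supremum of  *)
(* the sizes of its orthonormal families.                                     *)
Definition eigen_mult A (l : R) : \bar R :=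
  ereal_sup [set (n%:R)%:E | n in [set n : nat | exists e : 'I_n -> V,
    (forall i, H (e i) /\ heq (A (e i)) (l%:C *: e i)) /\
    forall i j, ip (e i) (e j) = (i == j)%:R]].

(* (sum_k s_k(T)^p)^(1/p): the eigenvalues l > 0 of |T| are grouped, each one *)
(* contributing l^p as many times as its multiplicity (the eigenvalue 0       *)
(* contributes nothing).                                                      *)
Definition schatten_norm (p : R) T : \bar R :=
  poweR (\esum_(l in [set l : R | 0 < l])
           (eigen_mult (abs_operator T) l * (powR l p)%:E)%E) (p^-1).

Definition schatten_class (p : R) T : Prop :=
  compact_operator T /\ (schatten_norm p T < +oo)%E.

End Hilbert.

Section Group.
Context (R : realType) (G : topGroupType).
Implicit Types (K : set G) (f g phi : G -> R[i]).

Definition compact_subgroup K : Prop :=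
  [/\ compact K, K 1%g, forall x y, K x -> K y -> K (x * y)%g &
      forall x, K x -> K (x^-1)%g].

Definition left_haar (mu : set (borel G) -> \bar R) : Prop :=
  [/\ radon_measure mu, mu setT != 0%E &
      forall (a : G) (A : set (borel G)), measurable A ->
        mu [set x : G | A (a * x)%g] = mu A].

Definition topological_automorphism (alpha : G -> G) : Prop :=
  [/\ {morph alpha : x y / (x * y)%g}, continuous alpha &
      exists beta : G -> G,
        [/\ cancel alpha beta, cancel beta alpha & continuous beta]].

(* delta is the constant with d(alpha(x)) = delta dx.                         *)
Definition modulus_of (mu : set (borel G) -> \bar R) (alpha : G -> G)
    (delta : R) : Prop :=
  0 < delta /\
  forall f : borel G -> \bar R,
    measurable_fun setT f -> (forall x, 0 <= f x)%E ->
    (\int[mu]_x f (alpha x) = (delta^-1)%:E * \int[mu]_x f x)%E.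

Definition biinvariant K f : Prop :=
  forall k k' x, K k -> K k' -> f (k * x * k')%g = f x.

Definition positive_definite f : Prop :=
  forall (n : nat) (x : 'I_n -> G) (c : 'I_n -> R[i]),
    0 <= \sum_(i < n) \sum_(j < n) c i * (c j)^* * f ((x i)^-1 * x j)%g.

Variables (mu : {measure set (borel G) -> \bar R}) (K : set G).

(* Bi-invariance of (classes of) functions in L^p.                            *)
Definition ae_biinvariant f : Prop :=
  forall k k', K k -> K k' -> {ae mu, forall x : G, f (k * x * k')%g = f x}.

Definition L1K f : Prop := inL1 mu setT (f : borel G -> R[i]) /\ ae_biinvariant f.

Definition L2K f : Prop := inL2 mu setT (f : borel G -> R[i]) /\ ae_biinvariant f.

Definition CcK f : Prop :=
  [/\ continuous (f : G -> R[i]^o), compact (closure [set x | f x != 0]) &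
      biinvariant K f].

Definition convolution f g : G -> R[i] := fun x =>
  cintegral mu setT (fun y : G => f y * g (y^-1 * x)%g).

Definition gelfand_pair : Prop :=
  forall f g, CcK f -> CcK g -> convolution f g = convolution g f.

Definition pairing f phi : R[i] := cintegral mu setT (fun x : G => f x * phi x).

Definition spherical phi : Prop :=
  [/\ continuous (phi : G -> R[i]^o), biinvariant K phi,
      forall f g, CcK f -> CcK g ->
        pairing (convolution f g) phi = pairing f phi * pairing g phi &
      exists2 f, CcK f & pairing f phi != 0].

Definition bounded_spherical phi : Prop :=
  spherical phi /\ exists M : R, forall x, Normc.normc (phi x) <= M.

Definition Splus : set (G -> R[i]^o) :=
  [set phi | bounded_spherical phi /\ positive_definite phi].

Definition sphericalF f (phi : G -> R[i]^o) : R[i]^o :=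
  cintegral mu setT (fun x : G => f x * phi (x^-1)%g).

(* All functions on G, with the topology generated by the maps                *)
(* phi |-> sphericalF f phi for f in L^1(G//K).                               *)
Definition weak_space : ptopologicalType :=
  sup_topology (fun f : {f : G -> R[i] | L1K f} =>
    Topological.class (initial_topology (sphericalF (projT1 f)))).

(* `subspace` gives Splus its relative topology and makes its complement open *)
(* and discrete; the measures considered below do not charge the complement.  *)
Definition Splus_space : ptopologicalType :=
  subspace (Splus : set weak_space).

Variable nu : {measure set (borel Splus_space) -> \bar R}.

(* Continuity of the positive-definite functions is essential here: an        *)
(* inversion formula valid at every point fails without it.                   *)
Definition positive_definite_span f : Prop :=
  exists (n : nat) (c : 'I_n -> R[i]) (psi : 'I_n -> G -> R[i]),
    (forall i, [/\ continuous (psi i : G -> R[i]^o), positive_definite (psi i) &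
                   biinvariant K (psi i)]) /\
    forall x, f x = \sum_(i < n) c i * psi i x.

Definition inversion_formula : Prop :=
  forall f, L1K f -> positive_definite_span f ->
    inL1 nu (Splus : set Splus_space) (sphericalF f : Splus_space -> R[i]) /\
    forall x, f x = cintegral nu (Splus : set Splus_space)
                      (fun phi : G -> R[i]^o => sphericalF f phi * phi x).

Definition plancherel_theorem : Prop :=
  exists F : (G -> R[i]) -> (Splus_space -> R[i]),
  [/\ forall f, L2K f -> inL2 nu (Splus : set Splus_space) (F f),
      forall f, L1K f -> L2K f ->
        {ae nu, forall phi : Splus_space, Splus phi -> F f phi = sphericalF f phi},
      forall f g, L2K f -> L2K g ->
        L2norm_sq nu (Splus : set Splus_space) (fun phi => F f phi - F g phi) =
        L2norm_sq mu setT (fun x : borel G => f x - g x) &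
      forall h, inL2 nu (Splus : set Splus_space) h ->
        exists2 f, L2K f &
          {ae nu, forall phi : Splus_space, Splus phi -> F f phi = h phi}].

Definition plancherel_measure : Prop :=
  [/\ radon_measure nu, nu (~` (Splus : set Splus_space)) = 0%E,
      inversion_formula & plancherel_theorem].

Variables (alpha : G -> G) (delta : R) (theta : G -> R[i]).

(* theta_{alpha, phi, t}                                                      *)
Definition atom (phi : G -> R[i]) (t : G) : G -> R[i] := fun x =>
  (Num.sqrt delta)%:C * phi x * theta (alpha (t^-1 * x)%g).

Definition L2inner : (G -> R[i]) -> (G -> R[i]) -> R[i] :=
  @inner _ (borel G) R mu.

Definition stockwell f (t : G) (phi : G -> R[i]) : R[i] :=
  L2inner f (atom phi t).

Variable u : G * (G -> R[i]^o) -> R[i].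

Definition inL1_symbol : Prop :=
  @inL1 _ (borel G * borel Splus_space)%type R (mu \x nu)%E
    (setT `*` (Splus : set Splus_space)) u.

Definition symbol_norm : \bar R :=
  @L1norm _ (borel G * borel Splus_space)%type R (mu \x nu)%E
    (setT `*` (Splus : set Splus_space)) u.

Definition localization f : G -> R[i] := fun x =>
  cintegral nu (Splus : set Splus_space) (fun phi : G -> R[i]^o =>
    cintegral mu setT (fun t : G =>
      u (t, phi) * stockwell f t phi * atom phi t x)).

(* T is the localization operator on L^2(G//K). The functions                 *)
(* theta_{alpha, phi, t} are in general not bi-invariant, and neither is      *)
(* `localization f`; it defines an element of L^2(G//K) through its inner     *)
(* products with the elements of L^2(G//K).                                   *)
Definition is_localization_operator (T : (G -> R[i]) -> (G -> R[i])) : Prop :=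
  (forall f, L2K f -> L2K (T f)) /\
  forall f g, L2K f -> L2K g -> L2inner (T f) g = L2inner (localization f) g.

(* When `localization` does preserve L^2(G//K), it is that operator.          *)
Lemma is_localization_operator_localization :
  (forall f, L2K f -> L2K (localization f)) ->
  is_localization_operator localization.
Proof. by []. Qed.

End Group.

(* Main.v *)
Require Import Defs.
From HB Require Import structures.
From mathcomp Require Import all_boot all_order all_algebra.
From mathcomp Require Import all_classical all_reals all_analysis.
From mathcomp Require Import measurable_realfun complex.
From mathcomp Require Import ring lra.

(** For f, g in L^2(G//K), Fubini's theorem gives
      <L f, g> = int u(t, phi) <f, b_{t, phi}> <b_{t, phi}, g> dt dphi,
    where b_{t, phi} is the orthogonal projection of theta_{alpha, phi, t} onto
    L^2(G//K). A positive-definite spherical function satisfies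
    |phi| <= phi(1) = 1, and the factor delta^(1/2) makes theta o alpha and its
    translates unit vectors; hence |b_{t, phi}| <= 1.

    An operator T with such a representation is compact (weak_compact): along a
    weakly convergent sequence the coefficients <f, b_{t, phi}> converge
    pointwise, and dominated convergence yields norm convergence of T f. If e_i
    is an orthonormal family with |T| e_i = l_i e_i and l_i > 0, then
    v_i = T e_i / l_i is orthonormal too, l_i = <T e_i, v_i>, and Bessel's
    inequality for the two families gives
      sum l_i <= int |u| sum_i |<e_i, b_{t, phi}>| |<b_{t, phi}, v_i>| <= int |u|,
    which bounds the trace norm (schatten_norm_le).

    What remains is to justify Fubini's theorem. Separability of L^2(G//K) makes
    G sigma-compact (separable_sigma_compact), but G need not be second
    countable, so product measurability is never automatic: it is derived from
    continuity in one variable that is uniform in the other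
    (equicontinuous_measurable). The pair (G, K) being a Gelfand pair, G is
    unimodular (haar_inv). The functional equation of spherical functions
    (spherical_equation) then shows that phi(x) is jointly measurable in x and
    phi (Splus_eval_cmeas), and Plancherel's theorem applied to countably many
    functions of Cc(G//K) shows that the Plancherel measure is sigma-finite
    (plancherel_sigma_finite). The function theta o alpha is changed on a null
    set in order to make (t, x) |-> theta (alpha (t^-1 x)) product measurable
    (quotient_cmeasurable_version). Square integrability of L f is a
    Cauchy-Schwarz inequality with weight |u| (superposition_inL2). *)

Set Implicit Arguments.
Unset Strict Implicit.
Unset Printing Implicit Defensive.

Import Order.TTheory GRing.Theory Num.Theory.
Import numFieldNormedType.Exports.

Local Open Scope classical_set_scope.
Local Open Scope ring_scope.
Local Open Scope complex_scope.

Local Notation "x ^*" := (conjc x) : ring_scope.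

(** * Complex numbers and positive semidefinite forms *)

Notation normc := Normc.normc.
Notation Re := complex.Re.
Notation Im := complex.Im.

Section ComplexModulus.
Context (R : realType).
Implicit Types z w : R[i].

Lemma normc_ge0 z : 0 <= normc z.
Proof. by case: z => a b; exact: sqrtr_ge0. Qed.

Lemma normc_sqr z : normc z ^+ 2 = Re z ^+ 2 + Im z ^+ 2.
Proof. by case: z => a b /=; rewrite sqr_sqrtr// addr_ge0// sqr_ge0. Qed.

Lemma normc_conj z : normc z^* = normc z.
Proof. by case: z => a b /=; rewrite sqrrN. Qed.

Lemma mul_conjc z : z * z^* = (normc z ^+ 2)%:C.
Proof.
rewrite normc_sqr; case: z => a b /=; apply/eqP; rewrite eq_complex /=.
by apply/andP; split; apply/eqP; ring.
Qed.

Lemma conjcM z w : (z * w)^* = z^* * w^*.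
Proof. exact: (rmorphM (@conjc R)). Qed.

Lemma ReM z w : Re (z * w) = Re z * Re w - Im z * Im w.
Proof. by case: z => a b; case: w. Qed.

Lemma ImM z w : Im (z * w) = Re z * Im w + Im z * Re w.
Proof. by case: z => a b; case: w. Qed.

Lemma Re_conj z : Re z^* = Re z. Proof. by case: z. Qed.
Lemma Im_conj z : Im z^* = - Im z. Proof. by case: z. Qed.

Lemma normc_real (r : R) : normc r%:C = `|r|.
Proof. by rewrite /= expr0n/= addr0 sqrtr_sqr. Qed.

Lemma normr_Re_le z : `|Re z| <= normc z.
Proof.
rewrite -(ler_pXn2r (n := 2)) ?nnegrE ?normc_ge0//.
by rewrite normc_sqr real_normK ?num_real// lerDl sqr_ge0.
Qed.

Lemma normr_Im_le z : `|Im z| <= normc z.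
Proof.
rewrite -(ler_pXn2r (n := 2)) ?nnegrE ?normc_ge0//.
by rewrite normc_sqr real_normK ?num_real// lerDr sqr_ge0.
Qed.

Lemma Re_le_normc z : Re z <= normc z.
Proof. exact: le_trans (ler_norm _) (normr_Re_le z). Qed.

Lemma normc_le_ReIm z : normc z <= `|Re z| + `|Im z|.
Proof.
rewrite -(ler_pXn2r (n := 2)) ?nnegrE ?normc_ge0 ?addr_ge0//.
rewrite normc_sqr -[Re z ^+ 2]real_normK ?num_real//.
rewrite -[Im z ^+ 2]real_normK ?num_real// sqrrD.
by rewrite addrAC lerDl mulrn_wge0 ?mulr_ge0.
Qed.

Lemma normc_eq0 z : (normc z == 0) = (z == 0).
Proof.
apply/eqP/eqP => [/Normc.eq0_normc//|->]; exact: Normc.normc0.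
Qed.

Lemma complex_eqP z w : Re z = Re w -> Im z = Im w -> z = w.
Proof. by case: z; case: w => a b c d /= -> ->. Qed.

Lemma ReD z w : Re (z + w) = Re z + Re w. Proof. by case: z; case: w. Qed.
Lemma ImD z w : Im (z + w) = Im z + Im w. Proof. by case: z; case: w. Qed.
Lemma ReN z : Re (- z) = - Re z. Proof. by case: z. Qed.
Lemma ImN z : Im (- z) = - Im z. Proof. by case: z. Qed.
Lemma ReB z w : Re (z - w) = Re z - Re w. Proof. by rewrite ReD ReN. Qed.
Lemma ImB z w : Im (z - w) = Im z - Im w. Proof. by rewrite ImD ImN. Qed.

Lemma ge0_complexP z : 0 <= z -> z = (Re z)%:C /\ 0 <= Re z.
Proof.
rewrite lecE => /andP[/eqP/= h0 h1]; split=> //.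
by apply: complex_eqP.
Qed.

End ComplexModulus.

Section SemiHilbert.
Context (R : realType) (V : lmodType R[i]).
Implicit Types (H : set V) (ip : V -> V -> R[i]).

(** A positive semidefinite Hermitian form on a subspace. Null vectors are
    allowed, so that functions need not be replaced by their classes. *)
Definition sesqui_form H ip :=
  [/\ H 0, forall a x y, H x -> H y -> H (a *: x + y),
      forall a x y z, H x -> H y -> H z ->
        ip (a *: x + y) z = a * ip x z + ip y z,
      forall x y, H x -> H y -> ip y x = (ip x y)^* &
      forall x, H x -> 0 <= ip x x].

Definition hcomplete H ip := forall f : nat -> V, (forall n, H (f n)) ->
  (forall e : R, 0 < e -> exists N, forall m n, (N <= m)%N -> (N <= n)%N ->
     hnorm ip (f m - f n) < e) ->
  exists2 y, H y & (fun n => hnorm ip (f n - y)) @ \oo --> (0 : R).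

Variables (H : set V) (ip : V -> V -> R[i]).
Hypothesis Hip : sesqui_form H ip.
Local Notation nrm := (hnorm ip).
Let nrm2 x : R := Re (ip x x).

Lemma sf0 : H 0. Proof. by case: Hip. Qed.
Lemma sfZD a x y : H x -> H y -> H (a *: x + y).
Proof. by case: Hip => _ h _ _ _; exact: h. Qed.
Lemma sfZ a x : H x -> H (a *: x).
Proof. by move=> hx; rewrite -[_ *: _]addr0; apply: sfZD => //; exact: sf0. Qed.
Lemma sfD x y : H x -> H y -> H (x + y).
Proof. by move=> hx hy; rewrite -[x]scale1r; exact: sfZD. Qed.
Lemma sfN x : H x -> H (- x).
Proof. by move=> hx; rewrite -scaleN1r; exact: sfZ. Qed.
Lemma sfB x y : H x -> H y -> H (x - y).
Proof. by move=> hx hy; apply: sfD => //; exact: sfN. Qed.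
Lemma sf_sum (I : Type) (s : seq I) (P : pred I) (F : I -> V) :
  (forall i, P i -> H (F i)) -> H (\sum_(i <- s | P i) F i).
Proof. by move=> h; apply: big_ind => //; [exact: sf0|exact: sfD]. Qed.

Lemma ipZDl a x y z : H x -> H y -> H z ->
  ip (a *: x + y) z = a * ip x z + ip y z.
Proof. by case: Hip => _ _ h _ _; exact: h. Qed.
Lemma ip_conj x y : H x -> H y -> ip y x = (ip x y)^*.
Proof. by case: Hip => _ _ _ h _; exact: h. Qed.
Lemma ip_ge0 x : H x -> 0 <= ip x x.
Proof. by case: Hip => _ _ _ _ h; exact: h. Qed.

Lemma ipDl x y z : H x -> H y -> H z -> ip (x + y) z = ip x z + ip y z.
Proof. by move=> hx hy hz; rewrite -[x in LHS]scale1r ipZDl// mul1r. Qed.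
Lemma ip0l z : H z -> ip 0 z = 0.
Proof.
move=> hz; have h0 := sf0.
by apply: (addrI (ip 0 z)); rewrite -ipDl// !addr0.
Qed.
Lemma ipZl a x z : H x -> H z -> ip (a *: x) z = a * ip x z.
Proof.
move=> hx hz; have h0 := sf0.
by rewrite -[_ *: _]addr0 ipZDl// ip0l// addr0.
Qed.
Lemma ipNl x z : H x -> H z -> ip (- x) z = - ip x z.
Proof. by move=> hx hz; rewrite -scaleN1r ipZl// mulN1r. Qed.
Lemma ipBl x y z : H x -> H y -> H z -> ip (x - y) z = ip x z - ip y z.
Proof. by move=> hx hy hz; rewrite ipDl ?ipNl//; exact: sfN. Qed.
Lemma ipDr x y z : H x -> H y -> H z -> ip z (x + y) = ip z x + ip z y.
Proof.
move=> hx hy hz; have hxy : H (x + y) by exact: sfD.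
by rewrite ip_conj// ipDl// rmorphD/= -!ip_conj.
Qed.
Lemma ipZr a x z : H x -> H z -> ip z (a *: x) = a^* * ip z x.
Proof.
move=> hx hz; have hax : H (a *: x) by exact: sfZ.
by rewrite ip_conj// ipZl// rmorphM/= -ip_conj.
Qed.
Lemma ipNr x z : H x -> H z -> ip z (- x) = - ip z x.
Proof.
by move=> hx hz; rewrite -scaleN1r ipZr// rmorphN1 mulN1r.
Qed.
Lemma ipBr x y z : H x -> H y -> H z -> ip z (x - y) = ip z x - ip z y.
Proof. by move=> hx hy hz; rewrite ipDr ?ipNr//; exact: sfN. Qed.
Lemma ip_suml (I : Type) (s : seq I) (P : pred I) (F : I -> V) z :
  (forall i, P i -> H (F i)) -> H z ->
  ip (\sum_(i <- s | P i) F i) z = \sum_(i <- s | P i) ip (F i) z.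
Proof.
move=> hF hz.
suff [] : H (\sum_(i <- s | P i) F i) /\
  ip (\sum_(i <- s | P i) F i) z = \sum_(i <- s | P i) ip (F i) z by [].
elim/big_rec2 : _ => [|i x y /hF Pi [hy <-]]; first by split; [exact: sf0|exact: ip0l].
by split; [exact: sfD|rewrite ipDl].
Qed.
Lemma ip_sumr (I : Type) (s : seq I) (P : pred I) (F : I -> V) z :
  (forall i, P i -> H (F i)) -> H z ->
  ip z (\sum_(i <- s | P i) F i) = \sum_(i <- s | P i) ip z (F i).
Proof.
move=> hF hz; rewrite ip_conj//; last exact: sf_sum.
rewrite ip_suml// rmorph_sum; apply: eq_bigr => i Pi.
by apply/esym/ip_conj => //; exact: hF.
Qed.

Lemma nrm2_ge0 x : H x -> 0 <= nrm2 x.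
Proof. by move=> /ip_ge0/ge0_complexP[]. Qed.

Lemma ip_nrm2 x : H x -> ip x x = (nrm2 x)%:C.
Proof. by move=> /ip_ge0/ge0_complexP[]. Qed.

Lemma hnorm_ge0 x : 0 <= nrm x. Proof. exact: sqrtr_ge0. Qed.

Lemma hnorm_sqr x : H x -> nrm x ^+ 2 = nrm2 x.
Proof. by move=> hx; rewrite sqr_sqrtr// nrm2_ge0. Qed.

Lemma ip_hnorm x : H x -> ip x x = (nrm x ^+ 2)%:C.
Proof. by move=> hx; rewrite ip_nrm2// hnorm_sqr. Qed.

Lemma nrm2B x y : H x -> H y ->
  nrm2 (x - y) = nrm2 x - 2 * Re (ip x y) + nrm2 y.
Proof.
move=> hx hy; rewrite /nrm2 ipBl ?ipBr//; last exact: sfB.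
rewrite !ReB (ip_conj hx hy) Re_conj; ring.
Qed.

Lemma nrm2D x y : H x -> H y ->
  nrm2 (x + y) = nrm2 x + 2 * Re (ip x y) + nrm2 y.
Proof.
move=> hx hy; rewrite /nrm2 ipDl ?ipDr//; last exact: sfD.
rewrite !ReD (ip_conj hx hy) Re_conj; ring.
Qed.

Lemma nrm2Z a x : H x -> nrm2 (a *: x) = normc a ^+ 2 * nrm2 x.
Proof.
move=> hx; rewrite /nrm2 ipZl ?ipZr//; last exact: sfZ.
by rewrite mulrA mul_conjc ReM/= mul0r subr0.
Qed.

Lemma hnormZ a x : H x -> nrm (a *: x) = normc a * nrm x.
Proof.
move=> hx; rewrite /hnorm -/(nrm2 _) nrm2Z// sqrtrM ?sqr_ge0//.
by rewrite sqrtr_sqr ger0_norm// normc_ge0.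
Qed.

Lemma hnormN x : H x -> nrm (- x) = nrm x.
Proof.
by move=> hx; rewrite -scaleN1r hnormZ// normcN Normc.normc1 mul1r.
Qed.

Lemma hnormBC x y : H x -> H y -> nrm (x - y) = nrm (y - x).
Proof. by move=> hx hy; rewrite -hnormN ?opprB//; exact: sfB. Qed.

(** Positivity of the form on x - t <x, y> y for a well-chosen real t; when y
    is a null vector every t is allowed, which forces <x, y> = 0. *)
Lemma cauchy_schwarz x y : H x -> H y -> normc (ip x y) <= nrm x * nrm y.
Proof.
move=> hx hy; set a := ip x y.
have key (t : R) :
    0 <= nrm2 x - 2 * t * normc a ^+ 2 + t ^+ 2 * normc a ^+ 2 * nrm2 y.
  have hz : H (((t%:C) * a) *: y) by exact: sfZ.
  have := nrm2_ge0 (sfB hx hz); rewrite nrm2B// nrm2Z// ipZr//.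
  rewrite conjcM conjc_real -/a -mulrA [a^* * a]mulrC mul_conjc Normc.normcM.
  rewrite (_ : Re _ = t * normc a ^+ 2); last first.
    by rewrite /= mulr0 subr0.
  rewrite normc_real exprMn real_normK ?num_real//.
  by rewrite mulrA.
have nx := nrm2_ge0 hx; have ny := nrm2_ge0 hy.
rewrite -(ler_pXn2r (n := 2)) ?nnegrE ?normc_ge0 ?mulr_ge0 ?hnorm_ge0//.
rewrite exprMn !hnorm_sqr//.
have A0 : 0 <= normc a ^+ 2 by exact: sqr_ge0.
set A := normc a ^+ 2 in key A0 *; set Y := nrm2 y in key ny *.
set X := nrm2 x in key nx *.
have [Y0|Y0] := eqVneq Y 0.
  rewrite Y0 mulr0 leNgt; apply/negP => Apos.
  have := key ((X + 1) / A); rewrite Y0 mulr0 addr0.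
  rewrite -mulrA -[_ / A * A]mulrA mulVf ?gt_eqF// mulr1; lra.
have Yp : 0 < Y by rewrite lt_neqAle eq_sym Y0.
have := key (Y^-1); set i := Y^-1; have iY : i * Y = 1 by rewrite mulVf.
have -> : X - 2 * i * A + i ^+ 2 * A * Y = X - 2 * i * A + i * A * (i * Y) by ring.
rewrite iY mulr1 => h.
have h' : i * A <= X by lra.
have -> : A = (i * A) * Y by rewrite mulrAC iY mul1r.
by rewrite ler_pM2r.
Qed.

Lemma hnormD_le x y : H x -> H y -> nrm (x + y) <= nrm x + nrm y.
Proof.
move=> hx hy; rewrite -(ler_pXn2r (n := 2)) ?nnegrE ?addr_ge0 ?hnorm_ge0//.
rewrite sqrrD !hnorm_sqr ?nrm2D//; last exact: sfD.
rewrite lerD2r lerD2l mulrC mulr_natr ler_wMn2r//.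
exact: le_trans (Re_le_normc _) (cauchy_schwarz hx hy).
Qed.

Lemma hnorm_dist x y z : H x -> H y -> H z ->
  nrm (x - z) <= nrm (x - y) + nrm (y - z).
Proof.
move=> hx hy hz; rewrite -[x - z](subrKA y); apply: hnormD_le; exact: sfB.
Qed.

Lemma hnorm0_ip x y : H x -> H y -> nrm x = 0 -> ip x y = 0.
Proof.
move=> hx hy x0; apply/eqP; rewrite -normc_eq0 eq_le normc_ge0 andbT.
by have := cauchy_schwarz hx hy; rewrite x0 mul0r.
Qed.

Lemma bessel (I : finType) (e : I -> V) x : H x -> (forall i, H (e i)) ->
  (forall i j, ip (e i) (e j) = (i == j)%:R) ->
  \sum_i normc (ip x (e i)) ^+ 2 <= nrm x ^+ 2.
Proof.
move=> hx he eo; pose p := \sum_i ip x (e i) *: e i.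
have hei i : H (ip x (e i) *: e i) by exact: sfZ.
have hp : H p by apply: sf_sum.
have ipxp : ip x p = (\sum_i normc (ip x (e i)) ^+ 2)%:C.
  rewrite ip_sumr// rmorph_sum; apply: eq_bigr => i _.
  by rewrite ipZr// mulrC mul_conjc.
have ippp : ip p p = (\sum_i normc (ip x (e i)) ^+ 2)%:C.
  rewrite {1}/p ip_suml// rmorph_sum; apply: eq_bigr => i _.
  rewrite ipZl// ip_sumr// (bigD1 i)//= big1 => [|j ji].
    by rewrite ipZr// eo eqxx mulr1 addr0 mul_conjc.
  by rewrite ipZr// eo eq_sym (negbTE ji) mulr0.
have := nrm2_ge0 (sfB hx hp); rewrite nrm2B// hnorm_sqr// /nrm2 ipxp ippp /=.
lra.
Qed.

End SemiHilbert.

Section Projection.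
Context (R : realType) (V : lmodType R[i]) (H0 H : set V) (ip : V -> V -> R[i]).
Hypotheses (H0ip : sesqui_form H0 ip) (Hip : sesqui_form H ip).
Hypotheses (HH0 : H `<=` H0) (Hc : hcomplete H ip).
Local Notation nrm := (hnorm ip).

(** A minimizing sequence for the distance from x to H is Cauchy by the
    parallelogram identity. *)
Lemma hprojection x : H0 x ->
  exists2 p, H p & forall h, H h -> ip x h = ip p h.
Proof.
move=> hx.
pose D := [set Re (ip (x - h) (x - h)) | h in H].
have D0 : has_inf D.
  split; first by exists (Re (ip (x - 0) (x - 0))), 0 => //; exact: sf0 Hip.
  by exists 0 => _ [h /HH0 hh <-]; exact: nrm2_ge0 H0ip _ (sfB H0ip hx hh).
pose d := inf D.
have dle h : H h -> d <= Re (ip (x - h) (x - h)).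
  by move=> hh; apply: ge_inf; [case: D0|exists h].
have /choice[f fP] (n : nat) : exists h, H h /\
    Re (ip (x - h) (x - h)) < d + (n.+1%:R)^-1.
  have : 0 < (n.+1%:R : R)^-1 by rewrite invr_gt0.
  move=> /(inf_adherent)/(_ D0)[_ [h hh <-] hlt].
  by exists h.
have Hf n : H (f n) by case: (fP n).
have par m n : Re (ip (f m - f n) (f m - f n)) <=
    2 * (m.+1%:R)^-1 + 2 * (n.+1%:R)^-1.
  have hm := HH0 (Hf m); have hn := HH0 (Hf n).
  have mid : H ((2^-1)%:C *: (f m + f n)) by apply: (sfZ Hip); exact: sfD Hip _ _ _ _.
  have h1 := dle _ mid; have [_ h2] := fP m; have [_ h3] := fP n.
  have am := sfB H0ip hx hm; have an := sfB H0ip hx hn.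
  have E1 := nrm2D H0ip am an; have E2 := nrm2B H0ip am an.
  have E3 : (x - f m) + (x - f n) = 2%:C *: (x - (2^-1)%:C *: (f m + f n)).
    rewrite scalerBr scalerA -rmorphM/= divff// scale1r.
    rewrite (_ : (2%:C : R[i]) = 1 + 1); last by rewrite -natr1 rmorphD.
    by rewrite scalerDl scale1r opprD addrACA.
  have E4 : (x - f m) - (x - f n) = - (f m - f n).
    by rewrite (opprB x) (opprB (f m)) addrC addrA subrK.
  move: E1; rewrite E3 (nrm2Z H0ip); last exact: (sfB H0ip hx (HH0 mid)).
  move: E2; rewrite E4.
  have -> : Re (ip (- (f m - f n)) (- (f m - f n))) =
      Re (ip (f m - f n) (f m - f n)).
    have hmn := sfB H0ip hm hn.
    rewrite (ipNl H0ip)//; last exact: sfN H0ip _ _.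
    by rewrite (ipNr H0ip)// opprK.
  rewrite normc_real ger0_norm//.
  move: h1 h2 h3; set im := (m.+1%:R)^-1; set jn := (n.+1%:R)^-1.
  move=> h1 h2 h3 E2 E1; rewrite E2; move: E1.
  rewrite (_ : 2 ^+ 2 = 4 :> R); first lra.
  by ring.
have [|p Hp cp] := Hc Hf.
  move=> e e0.
  have [N hN] : exists N : nat, 4 * (N.+1%:R)^-1 < e ^+ 2.
    have e20 : 0 < e ^+ 2 / 4 by rewrite divr_gt0// exprn_gt0.
    have [N _ /(_ N (leqnn _)) hN] := near_infty_natSinv_lt (PosNum e20).
    by exists N; move: hN => /=; set i := (N.+1%:R)^-1; lra.
  exists N => m n Nm Nn.
  rewrite -(ltr_pXn2r (n := 2)) ?nnegrE ?hnorm_ge0 ?(ltW e0)//.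
  rewrite (hnorm_sqr H0ip); last by apply: (sfB H0ip); exact: HH0.
  apply: le_lt_trans (par m n) _.
  apply: le_lt_trans hN.
  have i1 : (m.+1%:R : R)^-1 <= (N.+1%:R)^-1.
    by rewrite lef_pV2 ?posrE ?ltr0n// ler_nat.
  have i2 : (n.+1%:R : R)^-1 <= (N.+1%:R)^-1.
    by rewrite lef_pV2 ?posrE ?ltr0n// ler_nat.
  by move: i1 i2; move: (N.+1%:R^-1) (m.+1%:R^-1) (n.+1%:R^-1) => a b c; lra.
have hp0 := HH0 Hp.
have minp h : H h -> Re (ip (x - p) (x - p)) <= Re (ip (x - h) (x - h)).
  move=> hh; apply: le_trans (dle _ hh).
  apply/ler_addgt0Pr => e e0.
  pose a := nrm (x - p).
  (* a <= |x - f n| + |f n - p| for every n, and both terms are controlled *)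
  have cvd : (fun n : nat => (Num.sqrt (d + (n.+1%:R)^-1) + nrm (f n - p)) ^+ 2)
      @ \oo --> (Num.sqrt (d + 0) + 0 : R) ^+ 2.
    apply: (cvg_comp _ (fun t : R => t ^+ 2)); last exact: exprn_continuous.
    apply: cvgD => //.
    apply: (cvg_comp _ Num.sqrt); last exact: sqrt_continuous.
    by apply: cvgD; [exact: cvg_cst|exact: cvg_harmonic].
  have dge0 : 0 <= d.
    by apply: lb_le_inf; [case: D0|move=> _ [h' /HH0 hh' <-]; exact: nrm2_ge0 H0ip _ (sfB H0ip hx hh')].
  rewrite -(hnorm_sqr H0ip (sfB H0ip hx hp0)) -/a.
  have -> : d = (Num.sqrt (d + 0) + 0 : R) ^+ 2 by rewrite !addr0 sqr_sqrtr.
  apply: le_trans (_ : _ <= (Num.sqrt (d + 0) + 0) ^+ 2) _; last by rewrite lerDl ltW.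
  rewrite -(cvg_lim _ cvd)//.
  apply: limr_ge; first by apply/cvg_ex; eexists; exact: cvd.
  apply: nearW => n; rewrite ler_pXn2r ?nnegrE ?hnorm_ge0 ?addr_ge0 ?hnorm_ge0//.
  apply: le_trans (hnorm_dist H0ip hx (HH0 (Hf n)) hp0) _.
  by rewrite lerD2r ler_wsqrtr//; case: (fP n) => _ /ltW.
exists p => // h hh.
have hh0 := HH0 hh.
pose c := ip (x - p) h.
have xp := sfB H0ip hx hp0.
have key (t : R) : 0 <= - 2 * t * normc c ^+ 2 + t ^+ 2 * normc c ^+ 2 * Re (ip h h).
  have hc : H (((t%:C) * c) *: h) by exact: sfZ Hip _ _ _.
  have := minp _ (sfD Hip Hp hc).
  rewrite opprD addrA (nrm2B H0ip xp (HH0 hc)).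
  rewrite (nrm2Z H0ip)// (ipZr H0ip)// conjcM conjc_real -/c -mulrA [c^* * c]mulrC mul_conjc.
  rewrite Normc.normcM normc_real exprMn real_normK ?num_real// /= mulr0 subr0.
  lra.
have c0 : c = 0.
  apply/eqP; rewrite -normc_eq0 -sqrf_eq0 eq_le sqr_ge0 andbT leNgt.
  apply/negP => C0; set C := normc c ^+ 2 in key C0.
  have Hn := nrm2_ge0 H0ip hh0.
  set n2 := Re (ip h h) in key Hn.
  have := key ((n2 + 1)^-1).
  have n21 : 0 < n2 + 1 by lra.
  set i := (n2 + 1)^-1.
  have i0 : 0 < i by rewrite invr_gt0.
  have iE : i * (n2 + 1) = 1 by rewrite mulVf// gt_eqF.
  have -> : -2 * i * C + i ^+ 2 * C * n2 = i * C * (i * n2 - 2) by ring.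
  have -> : i * n2 = 1 - i by rewrite -iE; ring.
  have iC : 0 < i * C by exact: mulr_gt0.
  nra.
by move: c0; rewrite /c (ipBl H0ip)// => /eqP; rewrite subr_eq0 => /eqP.
Qed.

End Projection.

(** * Integration of complex functions *)

Lemma EFin_cvgn (R : realType) (u : nat -> R) (l : R) : u @ \oo --> l ->
  (fun n => (u n)%:E) @ \oo --> l%:E.
Proof. by move=> h; apply: cvg_EFin => //; exact: nearW. Qed.

Definition crestrict (T : Type) (R : realType) (D : set T) (f : T -> R[i]) :
  T -> R[i] := fun x => if x \in D then f x else 0.

Lemma Re_crestrict (T : Type) (R : realType) (D : set T) (f : T -> R[i]) :
  (fun x => Re (crestrict D f x)) = (fun x => Re (f x)) \_ D.
Proof. by apply/funext => x; rewrite /crestrict patchE; case: ifP. Qed.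

Lemma Im_crestrict (T : Type) (R : realType) (D : set T) (f : T -> R[i]) :
  (fun x => Im (crestrict D f x)) = (fun x => Im (f x)) \_ D.
Proof. by apply/funext => x; rewrite /crestrict patchE; case: ifP. Qed.

Section ComplexMeasurability.
Context d (T : measurableType d) (R : realType).
Implicit Types f g : T -> R[i].
Local Notation cmeas := (@cmeasurable_fun _ T R setT).

Lemma cmeas_cst (c : R[i]) : cmeas (fun=> c).
Proof. by split; exact: measurable_cst. Qed.

Lemma cmeasD f g : cmeas f -> cmeas g -> cmeas (fun x => f x + g x).
Proof.
move=> [f1 f2] [g1 g2]; split.
  by under eq_fun do rewrite ReD; exact: measurable_funD.
by under eq_fun do rewrite ImD; exact: measurable_funD.
Qed.

Lemma cmeasM f g : cmeas f -> cmeas g -> cmeas (fun x => f x * g x).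
Proof.
move=> [f1 f2] [g1 g2]; split.
  under eq_fun do rewrite ReM.
  by apply: measurable_funB; exact: measurable_funM.
under eq_fun do rewrite ImM.
by apply: measurable_funD; exact: measurable_funM.
Qed.

Lemma cmeas_conj f : cmeas f -> cmeas (fun x => (f x)^*).
Proof.
move=> [f1 f2]; split.
  by under eq_fun do rewrite Re_conj.
by under eq_fun do rewrite Im_conj; exact: measurableT_comp.
Qed.

Lemma cmeasZ c f : cmeas f -> cmeas (fun x => c * f x).
Proof. by move=> mf; apply: cmeasM => //; exact: cmeas_cst. Qed.

Lemma cmeasB f g : cmeas f -> cmeas g -> cmeas (fun x => f x - g x).
Proof.
move=> mf mg.
have -> : (fun x => f x - g x) = (fun x => f x + (-1) * g x).
  by apply/funext => x; rewrite mulN1r.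
by apply: cmeasD => //; exact: cmeasZ.
Qed.

Lemma cmeas_real (f : T -> R) : measurable_fun setT f ->
  cmeas (fun x => (f x)%:C).
Proof. by move=> mf; split => //=; exact: measurable_cst. Qed.

Lemma cmeas_ReIm (f g : T -> R) : measurable_fun setT f ->
  measurable_fun setT g -> cmeas (fun x => f x +i* g x).
Proof. by []. Qed.

Lemma cmeas_normc f : cmeas f -> measurable_fun setT (fun x => normc (f x)).
Proof.
move=> [f1 f2].
rewrite (_ : (fun _ => _) = Num.sqrt \o (fun x => Re (f x) ^+ 2 + Im (f x) ^+ 2)).
  apply: measurableT_comp.
    by apply: continuous_measurable_fun; exact: sqrt_continuous.
  by apply: measurable_funD; exact: measurable_funX.
by apply/funext => x /=; rewrite -normc_sqr sqrtr_sqr ger0_norm ?normc_ge0.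
Qed.

Lemma cmeas_enormc f : cmeas f ->
  measurable_fun setT (fun x => (normc (f x))%:E).
Proof. by move=> mf; apply/measurable_EFinP; exact: cmeas_normc. Qed.

Lemma cmeas_enormc2 f : cmeas f ->
  measurable_fun setT (fun x => (normc (f x) ^+ 2)%:E).
Proof.
by move=> mf; apply/measurable_EFinP/measurable_funX; exact: cmeas_normc.
Qed.

Lemma cmeas_crestrict (D : set T) f : measurable D ->
  cmeas f -> cmeas (crestrict D f).
Proof.
move=> mD [f1 f2]; split.
  rewrite Re_crestrict; apply/(measurable_restrictT _ mD).
  exact: measurable_funS f1.
rewrite Im_crestrict; apply/(measurable_restrictT _ mD).
exact: measurable_funS f2.
Qed.

End ComplexMeasurability.

Lemma cmeas_comp d1 d2 (T1 : measurableType d1) (T2 : measurableType d2)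
    (R : realType) (f : T2 -> R[i]) (h : T1 -> T2) :
  cmeasurable_fun setT f -> measurable_fun setT h ->
  cmeasurable_fun setT (fun x => f (h x)).
Proof.
by move=> [f1 f2] mh; split; [exact: (measurableT_comp f1 mh)|exact: (measurableT_comp f2 mh)].
Qed.

Section ComplexIntegral.
Context d (T : measurableType d) (R : realType) (m : {measure set T -> \bar R}).
Implicit Types f g : T -> R[i].
Local Notation cmeas := (@cmeasurable_fun _ T R setT).
Local Notation L1 := (inL1 m setT).
Local Notation L2 := (inL2 m setT).
Local Notation cint := (cintegral m setT).

Lemma inL1_Re f : L1 f -> m.-integrable setT (EFin \o (fun x => Re (f x))).
Proof.
move=> [[mr mi] fi]; apply/integrableP; split; first exact/measurable_EFinP.
apply: le_lt_trans fi; apply: ge0_le_integral => //=.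
- by apply/measurable_EFinP/measurableT_comp.
- exact: cmeas_enormc.
- by move=> x _; rewrite lee_fin normr_Re_le.
Qed.

Lemma inL1_Im f : L1 f -> m.-integrable setT (EFin \o (fun x => Im (f x))).
Proof.
move=> [[mr mi] fi]; apply/integrableP; split; first exact/measurable_EFinP.
apply: le_lt_trans fi; apply: ge0_le_integral => //=.
- by apply/measurable_EFinP/measurableT_comp.
- exact: cmeas_enormc.
- by move=> x _; rewrite lee_fin normr_Im_le.
Qed.

Lemma inL1_normc f : L1 f -> m.-integrable setT (EFin \o (fun x => normc (f x))).
Proof.
move=> [mf fi]; apply/integrableP; split; first exact: cmeas_enormc.
apply: le_lt_trans fi; apply: ge0_le_integral => //=.
- by apply/measurable_EFinP/measurableT_comp => //; exact: cmeas_normc.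
- exact: cmeas_enormc.
- by move=> x _; rewrite lee_fin ger0_norm ?normc_ge0.
Qed.

Lemma inL1_le f (g : T -> \bar R) : cmeas f -> measurable_fun setT g ->
  (forall x, (normc (f x))%:E <= g x)%E -> (\int[m]_x g x < +oo)%E -> L1 f.
Proof.
move=> mf mg fg gi; split => //; apply: le_lt_trans gi.
apply: ge0_le_integral => //.
- by move=> x _; rewrite lee_fin normc_ge0.
- exact: cmeas_enormc.
Qed.

Lemma inL1D f g : L1 f -> L1 g -> L1 (fun x => f x + g x).
Proof.
move=> lf lg; have [mf fi] := lf; have [mg gi] := lg.
apply: (inL1_le (g := fun x => (normc (f x))%:E + (normc (g x))%:E)%E).
- exact: cmeasD.
- by apply: emeasurable_funD; exact: cmeas_enormc.
- by move=> x; rewrite -EFinD lee_fin le_normcD.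
- rewrite ge0_integralD//; first exact: lte_add_pinfty.
  + by move=> x _; rewrite lee_fin normc_ge0.
  + exact: cmeas_enormc.
  + by move=> x _; rewrite lee_fin normc_ge0.
  + exact: cmeas_enormc.
Qed.

Lemma L1normZ c f : cmeas f ->
  L1norm m setT (fun x => c * f x) = ((normc c)%:E * L1norm m setT f)%E.
Proof.
move=> mf; rewrite /L1norm -ge0_integralZl_EFin ?normc_ge0//.
- by apply: eq_integral => x _; rewrite Normc.normcM EFinM.
- by move=> x _; rewrite lee_fin normc_ge0.
- exact: cmeas_enormc.
Qed.

Lemma inL1Z c f : L1 f -> L1 (fun x => c * f x).
Proof.
move=> [mf fi]; split; first exact: cmeasZ.
by rewrite L1normZ// lte_mul_pinfty// lee_fin normc_ge0.
Qed.

Lemma inL1B f g : L1 f -> L1 g -> L1 (fun x => f x - g x).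
Proof.
move=> lf lg.
have -> : (fun x => f x - g x) = (fun x => f x + (-1) * g x).
  by apply/funext => x; rewrite mulN1r.
by apply: inL1D => //; exact: inL1Z.
Qed.

Lemma cintegralD f g : L1 f -> L1 g ->
  cint (fun x => f x + g x) = cint f + cint g.
Proof.
move=> lf lg; apply: complex_eqP; rewrite /= ?ReD ?ImD /=.
  under eq_Rintegral do rewrite ReD.
  by rewrite RintegralD//; exact: inL1_Re.
under eq_Rintegral do rewrite ImD.
by rewrite RintegralD//; exact: inL1_Im.
Qed.

Lemma cintegralZ c f : L1 f -> cint (fun x => c * f x) = c * cint f.
Proof.
move=> lf; have r := inL1_Re lf; have i := inL1_Im lf.
have Zr (a : R) (h : T -> R) : m.-integrable setT (EFin \o h) ->
    m.-integrable setT (EFin \o (fun x => a * h x)).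
  by move=> hi; have := integrableZl measurableT a hi.
apply: complex_eqP; rewrite ?ReM ?ImM /=.
  under eq_Rintegral do rewrite ReM.
  by rewrite RintegralB ?RintegralZl//; exact: Zr.
under eq_Rintegral do rewrite ImM.
by rewrite RintegralD ?RintegralZl//; exact: Zr.
Qed.

Lemma cintegralB f g : L1 f -> L1 g ->
  cint (fun x => f x - g x) = cint f - cint g.
Proof.
move=> lf lg.
have -> : (fun x => f x - g x) = (fun x => f x + (-1) * g x).
  by apply/funext => x; rewrite mulN1r.
by rewrite cintegralD ?cintegralZ ?mulN1r//; exact: inL1Z.
Qed.

Lemma cintegral_conj f : L1 f -> cint (fun x => (f x)^*) = (cint f)^*.
Proof.
move=> lf; apply: complex_eqP; rewrite ?Re_conj ?Im_conj/=.
  by apply: eq_Rintegral => x _; rewrite Re_conj.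
rewrite -mulN1r -RintegralZl//; last exact: inL1_Im.
by apply: eq_Rintegral => x _; rewrite Im_conj mulN1r.
Qed.

(** Rotate f so that its integral becomes nonnegative, then compare real
    parts. *)
Lemma normc_cintegral_le f : L1 f -> ((normc (cint f))%:E <= L1norm m setT f)%E.
Proof.
move=> lf; have [z|z0] := eqVneq (cint f) 0.
  rewrite z Normc.normc0; apply: integral_ge0 => x _.
  by rewrite lee_fin normc_ge0.
set n := normc (cint f).
have n0 : n != 0 by rewrite /n normc_eq0.
pose c : R[i] := (n^-1)%:C * (cint f)^*.
have nc : normc c = 1.
  rewrite Normc.normcM normc_conj normc_real ger0_norm ?invr_ge0 ?normc_ge0//.
  by rewrite mulVf.
have lcf := inL1Z c lf.
have E : cint (fun x => c * f x) = n%:C.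
  rewrite cintegralZ// /c -mulrA [_^* * _]mulrC mul_conjc -rmorphM/= -/n.
  by congr (_%:C); rewrite expr2 mulrA mulVf// mul1r.
have -> : n%:E = (\int[m]_x (Re (c * f x))%:E)%E.
  have := congr1 (@complex.Re R) E; rewrite /= /Rintegral => <-.
  by rewrite fineK//; apply: integrable_fin_num => //; exact: inL1_Re.
apply: le_trans (_ : (_ <= \int[m]_x (normc (c * f x))%:E)%E) _.
  apply: le_integral => //; [exact: inL1_Re|exact: inL1_normc|].
  by move=> x _; rewrite lee_fin Re_le_normc.
by rewrite -/(L1norm m setT (fun x => c * f x)) L1normZ ?nc ?mul1e//; case: lf.
Qed.

Lemma ae_eq_cintegral f g : cmeas f -> cmeas g ->
  {ae m, forall x, f x = g x} -> cint f = cint g.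
Proof.
move=> [f1 f2] [g1 g2] fg; rewrite /cintegral /Rintegral; congr (_ +i* _); congr fine.
  apply: ae_eq_integral => //; try exact/measurable_EFinP.
  by apply: filterS fg => x fgx _; rewrite fgx.
apply: ae_eq_integral => //; try exact/measurable_EFinP.
by apply: filterS fg => x fgx _; rewrite fgx.
Qed.

Lemma ae_eq_L2norm f g : cmeas f -> cmeas g ->
  {ae m, forall x, f x = g x} -> L2norm_sq m setT f = L2norm_sq m setT g.
Proof.
move=> mf mg fg; apply: ge0_ae_eq_integral => //; try exact: cmeas_enormc2.
- by move=> x _; rewrite lee_fin sqr_ge0.
- by move=> x _; rewrite lee_fin sqr_ge0.
- by apply: filterS fg => x fgx _; rewrite fgx.
Qed.

Lemma inL2_le f (g : T -> \bar R) : cmeas f -> measurable_fun setT g ->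
  (forall x, (normc (f x) ^+ 2)%:E <= g x)%E -> (\int[m]_x g x < +oo)%E -> L2 f.
Proof.
move=> mf mg fg gi; split => //; apply: le_lt_trans gi.
apply: ge0_le_integral => //.
- by move=> x _; rewrite lee_fin sqr_ge0.
- exact: cmeas_enormc2.
Qed.

Lemma L2normZ c f : cmeas f ->
  L2norm_sq m setT (fun x => c * f x) = ((normc c ^+ 2)%:E * L2norm_sq m setT f)%E.
Proof.
move=> mf; rewrite /L2norm_sq -ge0_integralZl_EFin ?sqr_ge0//.
- by apply: eq_integral => x _; rewrite Normc.normcM exprMn EFinM.
- by move=> x _; rewrite lee_fin sqr_ge0.
- exact: cmeas_enormc2.
Qed.

Lemma inL2Z c f : L2 f -> L2 (fun x => c * f x).
Proof.
move=> [mf fi]; split; first exact: cmeasZ.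
by rewrite L2normZ// lte_mul_pinfty// lee_fin sqr_ge0.
Qed.

Lemma inL2D f g : L2 f -> L2 g -> L2 (fun x => f x + g x).
Proof.
move=> [mf fi] [mg gi].
apply: (inL2_le (g := fun x => 2%:E * (normc (f x) ^+ 2)%:E +
                              2%:E * (normc (g x) ^+ 2)%:E)%E).
- exact: cmeasD.
- by apply: emeasurable_funD; apply: measurable_funeM; exact: cmeas_enormc2.
- move=> x; rewrite -!EFinM -EFinD lee_fin.
  apply: le_trans (_ : (normc (f x) + normc (g x)) ^+ 2 <= _).
    by rewrite ler_pXn2r ?nnegrE ?addr_ge0 ?normc_ge0// le_normcD.
  have := sqr_ge0 (normc (f x) - normc (g x)); nra.
- rewrite ge0_integralD//.
  + rewrite !ge0_integralZl_EFin//; try exact: cmeas_enormc2;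
      try by move=> x _; rewrite lee_fin sqr_ge0.
    by apply: lte_add_pinfty; rewrite lte_mul_pinfty.
  + by move=> x _; rewrite -EFinM lee_fin mulr_ge0// sqr_ge0.
  + by apply: measurable_funeM; exact: cmeas_enormc2.
  + by move=> x _; rewrite -EFinM lee_fin mulr_ge0// sqr_ge0.
  + by apply: measurable_funeM; exact: cmeas_enormc2.
Qed.

Lemma inL2_conj f : L2 f -> L2 (fun x => (f x)^*).
Proof.
move=> [mf fi]; split; first exact: cmeas_conj.
by rewrite /L2norm_sq; under eq_integral do rewrite normc_conj.
Qed.

Lemma inL2M f g : L2 f -> L2 g -> L1 (fun x => f x * g x).
Proof.
move=> [mf fi] [mg gi].
apply: (inL1_le (g := fun x => (normc (f x) ^+ 2)%:E + (normc (g x) ^+ 2)%:E)%E).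
- exact: cmeasM.
- by apply: emeasurable_funD; exact: cmeas_enormc2.
- move=> x; rewrite -EFinD lee_fin Normc.normcM.
  have := sqr_ge0 (normc (f x) - normc (g x)).
  have := sqr_ge0 (normc (f x) + normc (g x)); nra.
- rewrite ge0_integralD//; first exact: lte_add_pinfty.
  + by move=> x _; rewrite lee_fin sqr_ge0.
  + exact: cmeas_enormc2.
  + by move=> x _; rewrite lee_fin sqr_ge0.
  + exact: cmeas_enormc2.
Qed.

Lemma inner_self f : L2 f -> inner m f f = (fine (L2norm_sq m setT f))%:C.
Proof.
move=> lf; rewrite /inner /cintegral; apply: complex_eqP => /=.
  by congr fine; apply: eq_integral => x _; rewrite mul_conjc.
rewrite (_ : (fun x => _) = cst 0) ?Rintegral_cst ?mul0r//.
by apply/funext => x; rewrite mul_conjc.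
Qed.

Lemma L2norm_sqE f : L2 f -> L2norm_sq m setT f = (hnorm (inner m) f ^+ 2)%:E.
Proof.
move=> lf; have n0 : (0 <= L2norm_sq m setT f)%E.
  by apply: integral_ge0 => x _; rewrite lee_fin sqr_ge0.
rewrite /hnorm inner_self//= sqr_sqrtr ?fine_ge0// fineK// ge0_fin_numE//.
by case: lf.
Qed.

Lemma sesqui_inner : sesqui_form (L2 : set (T -> R[i])) (inner m).
Proof.
split.
- split; first exact: cmeas_cst.
  rewrite /L2norm_sq integral0_eq// => x _.
  by rewrite Normc.normc0 expr0n.
- by move=> a x y hx hy; apply: inL2D => //; exact: inL2Z.
- move=> a x y z hx hy hz; rewrite /inner.
  have xz := inL2M hx (inL2_conj hz); have yz := inL2M hy (inL2_conj hz).
  rewrite -cintegralZ// -cintegralD//; last exact: inL1Z.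
  by congr (cintegral _ _); apply/funext => t /=; rewrite mulrA -mulrDl.
- move=> x y hx hy; rewrite /inner -cintegral_conj; last first.
    exact: inL2M hx (inL2_conj hy).
  by congr (cintegral _ _); apply/funext => t /=; rewrite rmorphM/= conjcK mulrC.
- move=> x hx; rewrite inner_self// lecR fine_ge0//.
  by apply: integral_ge0 => t _; rewrite lee_fin sqr_ge0.
Qed.

Lemma ae_eq_inner f f' g : L2 f -> L2 f' -> L2 g ->
  {ae m, forall x, f x = f' x} -> inner m f g = inner m f' g.
Proof.
move=> [f1 _] [f2 _] [g1 _] ff'.
by apply: ae_eq_cintegral; [apply: cmeasM => //; exact: cmeas_conj..|
  apply: filterS ff' => x ->].
Qed.

Lemma cint_mkcond (D : set T) f : cintegral m D f = cint (crestrict D f).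
Proof.
rewrite /cintegral; congr (_ +i* _); rewrite Rintegral_mkcond.
  by rewrite -Re_crestrict.
by rewrite -Im_crestrict.
Qed.

Lemma L1norm_mkcond (D : set T) f : L1norm m D f = L1norm m setT (crestrict D f).
Proof.
rewrite /L1norm integral_mkcond; apply: eq_integral => x _.
by rewrite patchE /crestrict; case: ifP => //; rewrite Normc.normc0.
Qed.

Lemma L2norm_mkcond (D : set T) f :
  L2norm_sq m D f = L2norm_sq m setT (crestrict D f).
Proof.
rewrite /L2norm_sq integral_mkcond; apply: eq_integral => x _.
by rewrite patchE /crestrict; case: ifP => //; rewrite Normc.normc0 expr0n.
Qed.

(** Along a subsequence with |f_{k(j+1)} - f_{k(j)}|_2 < 4^-j the sum of
    4^j |f_{k(j+1)} - f_{k(j)}|^2 is integrable, hence finite almost everywhere,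
    which makes the increments summable pointwise. The limit is the L^2 limit
    by Fatou. *)
Lemma riesz_fischer (f : nat -> T -> R[i]) : (forall n, L2 (f n)) ->
  (forall e : R, 0 < e -> exists N, forall i j, (N <= i)%N -> (N <= j)%N ->
     hnorm (inner m) (f i - f j) < e) ->
  exists (y : T -> R[i]) (k : nat -> nat),
  [/\ L2 y, (fun n => hnorm (inner m) (f n - y)) @ \oo --> (0 : R) &
      {ae m, forall x, (fun j => Re (f (k j) x)) @ \oo --> Re (y x) /\
                       (fun j => Im (f (k j) x)) @ \oo --> Im (y x)}].
Proof.
move=> Lf cf.
have sf := sesqui_inner.
have e4 (j : nat) : 0 < (4^-1 : R) ^+ j by rewrite exprn_gt0// invr_gt0.
have /choice[N hN] (j : nat) := cf _ (e4 j).
pose k j := (\max_(i < j.+1) N i + j)%N.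
have kN j : (N j <= k j)%N.
  exact: leq_trans (leq_bigmax (Ordinal (ltnSn j))) (leq_addr _ _).
have kN1 j : (N j <= k j.+1)%N.
  apply: leq_trans (leq_addr _ _).
  by apply: (leq_bigmax (F := fun i : 'I_(j.+2) => N i) (Ordinal (ltnW (ltnSn j.+1)))).
pose D j := f (k j.+1) - f (k j).
have LD j : L2 (D j) by exact: (sfB sf).
have nD j : (L2norm_sq m setT (D j) <= ((4^-1 : R) ^+ j ^+ 2)%:E)%E.
  rewrite L2norm_sqE// lee_fin ler_pXn2r ?nnegrE ?hnorm_ge0 ?(ltW (e4 j))//.
  by apply/ltW/hN.
pose g j x := ((4 ^+ j) * normc (D j x) ^+ 2)%:E.
have g0 j x : (0 <= g j x)%E.
  by rewrite lee_fin mulr_ge0 ?sqr_ge0// exprn_ge0.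
have mg j : measurable_fun setT (g j).
  apply/measurable_EFinP/measurable_funM; first exact: measurable_cst.
  by apply: measurable_funX; apply: cmeas_normc; case: (LD j).
have ig j : (\int[m]_x g j x <= ((4^-1 : R) ^+ j)%:E)%E.
  rewrite /g; under eq_integral do rewrite EFinM.
  have mD : measurable_fun setT (fun x => (normc (D j x) ^+ 2)%:E).
    by apply: cmeas_enormc2; case: (LD j).
  rewrite ge0_integralZl_EFin ?exprn_ge0//; last first.
    by move=> x _; rewrite lee_fin sqr_ge0.
  apply: le_trans (_ : ((4 ^+ j)%:E * ((4^-1 : R) ^+ j ^+ 2)%:E <= _)%E).
    by apply: lee_wpmul2l; [rewrite lee_fin exprn_ge0|exact: nD].
  by rewrite -EFinM lee_fin expr2 mulrA -exprMn divff// expr1n mul1r.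
have Sfin : {ae m, forall x, (\sum_(j <oo) g j x < +oo)%E}.
  have : m.-integrable setT (fun x => \sum_(j <oo) g j x)%E.
    apply/integrableP; split; first exact: ge0_emeasurable_sum.
    rewrite (_ : (\int[m]_x _)%E = (\int[m]_x (\sum_(j <oo) g j x))%E); last first.
      by apply: eq_integral => x _; rewrite gee0_abs// nneseries_ge0.
    rewrite integral_nneseries//.
    apply: (@le_lt_trans _ _ (\sum_(j <oo) ((2 : R) / (2 ^ j.+1)%:R)%:E)%E).
      apply: lee_nneseries => [j _ _|j _]; first exact: integral_ge0.
      apply: le_trans (ig j) _; rewrite lee_fin natrX exprS invfM mulrA divff// mul1r.
      by rewrite -exprVn lerXn2r ?nnegrE ?invr_ge0// lef_pV2 ?posrE// ler_nat.
    by apply: le_lt_trans (epsilon_trick0 _ _) _; rewrite ?ltry.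
  move/integrable_ae => /(_ measurableT); apply: filterS => x /(_ I).
  by rewrite ge0_fin_numE// nneseries_ge0.
pose y x := fine (limn_esup (fun j => (Re (f (k j) x))%:E)) +i*
            fine (limn_esup (fun j => (Im (f (k j) x))%:E)).
have my : cmeas y.
  apply: cmeas_ReIm; apply: measurableT_comp => //;
  apply: measurable_fun_limn_esup => j; apply/measurable_EFinP.
    by case: (Lf (k j)) => -[].
  by case: (Lf (k j)) => -[].
have cvgx : {ae m, forall x, (fun j => Re (f (k j) x)) @ \oo --> Re (y x) /\
                       (fun j => Im (f (k j) x)) @ \oo --> Im (y x)}.
  apply: filterS Sfin => x Sx.
  pose C := fine (\sum_(j <oo) g j x)%E.
  have bnd j : normc (D j x) <= Num.sqrt C * (2^-1) ^+ j.
    rewrite -(ler_pXn2r (n := 2)) ?nnegrE ?normc_ge0 ?mulr_ge0 ?sqrtr_ge0 ?exprn_ge0//.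
    have C0 : 0 <= C by rewrite fine_ge0// nneseries_ge0.
    rewrite exprMn sqr_sqrtr// -exprM mulnC exprM -(ler_pM2l (exprn_gt0 j (ltr0n R 4))).
    rewrite [leRHS]mulrCA -exprMn (_ : 4 * 2^-1 ^+ 2 = 1 :> R); last first.
      by rewrite expr2; field.
    rewrite expr1n mulr1 -lee_fin /C fineK ?ge0_fin_numE ?nneseries_ge0//.
    apply: le_trans (nneseries_lim_ge (m := 0%N) j.+1 _) => //.
    by rewrite big_nat_recr//= leeDr// sume_ge0.
  have cv (h : R[i] -> R) : (forall a b, h (a - b) = h a - h b) ->
      (forall a, `|h a| <= normc a) ->
      (fun j => h (f (k j) x)) @ \oo --> fine (limn_esup (fun j => (h (f (k j) x))%:E)).
    move=> hB hn.
    have : cvgn (series (telescope (fun j => h (f (k j) x)))).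
      apply: normed_cvg.
      apply: (@series_le_cvg _ _ (geometric (Num.sqrt C) 2^-1)).
      - by move=> n /=; exact: normr_ge0.
      - by move=> n /=; rewrite mulr_ge0 ?sqrtr_ge0// exprn_ge0.
      - move=> n; rewrite /telescope /= -hB; apply: le_trans (hn _) _.
        exact: bnd.
      - by apply: is_cvg_geometric_series; rewrite ger0_norm// invf_lt1// ltr1n.
    rewrite telescopeK => /cvg_ex[l hl].
    have hl' : (fun j => h (f (k j) x)) @ \oo --> l + h (f (k 0%N) x).
      have -> : (fun j => h (f (k j) x)) =
          (fun j => h (f (k j) x) - h (f (k 0%N) x) + h (f (k 0%N) x)).
        by apply/funext => j; rewrite subrK.
      by apply: cvgD => //; exact: cvg_cst.
    have -> : limn_esup (fun j => (h (f (k j) x))%:E) = (l + h (f (k 0%N) x))%:E.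
      by have [_ ->] := cvg_limn_einf_sup (EFin_cvgn hl').
    exact: hl'.
  split; first by apply: (cv (@complex.Re R)); [exact: ReB|exact: normr_Re_le].
  by apply: (cv (@complex.Im R)); [exact: ImB|exact: normr_Im_le].
have fat (e : R) : 0 < e -> exists N, forall n, (N <= n)%N ->
    (L2norm_sq m setT (fun x => (f n x - y x)%R) <= (e ^+ 2)%:E)%E.
  move=> e0; have [M hM] := cf _ e0; exists M => n Mn.
  have hk j : (M <= j)%N -> (M <= k j)%N by move/leq_trans; apply; exact: leq_addl.
  pose h j x := (normc (f n x - f (k j) x) ^+ 2)%:E.
  have mh j : measurable_fun setT (h j).
    by apply: cmeas_enormc2; case: (sfB sf (Lf n) (Lf (k j))).
  have h0 j x : (0 <= h j x)%E by rewrite lee_fin sqr_ge0.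
  apply: le_trans (_ : (_ <= \int[m]_x limn_einf (h ^~ x))%E) _.
    apply: ae_ge0_le_integral => //.
    - by move=> x _; rewrite lee_fin sqr_ge0.
    - by apply: cmeas_enormc2; apply: cmeasB => //; case: (Lf n).
    - move=> x _; rewrite limn_einf_lim; apply: lime_ge; first exact: is_cvg_einfs.
      by apply: nearW => j; apply: le_ereal_inf_tmp => _ [i _ <-].
    - rewrite /limn_einf; apply: measurableT_comp => //.
      apply: measurable_fun_limn_esup => j; exact: measurableT_comp.
    - apply: filterS cvgx => x [cr ci] _.
      suff /cvg_limn_einf_sup[-> _] : h ^~ x @ \oo --> (normc (f n x - y x) ^+ 2)%:E by [].
      apply: EFin_cvgn.
      have E (z : R[i]) : normc z ^+ 2 = Re z * Re z + Im z * Im z by rewrite normc_sqr !expr2.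
      rewrite /=; under eq_fun do rewrite E ReB ImB.
      rewrite E ReB ImB.
      have cr' : (fun j => Re (f n x) - Re (f (k j) x)) @ \oo --> Re (f n x) - Re (y x).
        by apply: cvgB => //; exact: cvg_cst.
      have ci' : (fun j => Im (f n x) - Im (f (k j) x)) @ \oo --> Im (f n x) - Im (y x).
        by apply: cvgB => //; exact: cvg_cst.
      by apply: cvgD; exact: cvgM.
  apply: le_trans (fatou m measurableT mh _) _ => //.
  rewrite limn_einf_lim; apply: lime_le; first exact: is_cvg_einfs.
  apply: nearW => j.
  apply: le_trans (ereal_inf_lbound _) _.
    by exists (maxn j M) => //=; exact: leq_maxl.
  have L2nk := sfB sf (Lf n) (Lf (k (maxn j M))).
  rewrite -/(L2norm_sq m setT (fun x => f n x - f (k (maxn j M)) x)) L2norm_sqE// lee_fin.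
  rewrite ler_pXn2r ?nnegrE ?hnorm_ge0 ?(ltW e0)//; apply/ltW/hM => //.
  by apply: hk; exact: leq_maxr.
have Ly : L2 y.
  have [N1 /(_ N1 (leqnn _)) h1] := fat 1 ltr01.
  have : L2 (fun x => f N1 x - y x).
    split; last by apply: le_lt_trans h1 _; rewrite ltry.
    by apply: cmeasB => //; case: (Lf N1).
  move=> /(sfB sf (Lf N1)); congr (inL2 _ _ _); apply/funext => x.
  by rewrite !fctE opprB addrC subrK.
exists y, k; split => //.
apply/cvgrPdist_le => e e0; have [N1 hN1] := fat e e0.
exists N1 => // n /= N1n; rewrite sub0r normrN ger0_norm ?hnorm_ge0//.
rewrite -(ler_pXn2r (n := 2)) ?nnegrE ?hnorm_ge0 ?(ltW e0)//.
have Ld : L2 (fun x => f n x - y x) by exact: (sfB sf (Lf n) Ly).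
by have := hN1 n N1n; rewrite (L2norm_sqE Ld) lee_fin.
Qed.

End ComplexIntegral.

(** * Weak integrals of rank one operators *)

Lemma cauchy_seq_cvgn (R : realType) (u : nat -> R) :
  (forall e : R, 0 < e -> exists N, forall i j, (N <= i)%N -> (N <= j)%N ->
    `|u i - u j| < e) -> cvgn u.
Proof.
move=> h; apply/cauchy_cvgP/cauchy_exP => e e0.
have [N hN] := h e e0; exists (u N); exists N => // n /= Nn.
by rewrite /ball /=; exact: hN.
Qed.

(** One ultrafilter provides limits for all bounded sequences at once, without
    extracting a subsequence for each of them. *)
Lemma ultrafilter_bounded_lim (R : realType) (U : set_system nat) (u : nat -> R)
    (B : R) : UltraFilter U -> (forall n, `|u n| <= B) ->
  exists p : R, forall e, 0 < e -> U [set n | `|u n - p| < e].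
Proof.
move=> UU uB.
have UB : (u @ U) `[- B, B]%classic.
  rewrite /nbhs/=; apply: filterS (filterT : U setT) => n _ /=.
  by rewrite in_itv/= -ler_norml.
have [p [_ clp]] := @segment_compact R (- B) B (u @ U) _ UB.
exists p => e e0.
have [//|cU] := in_ultra_setVsetC [set n | `|u n - p| < e] UU.
have [x [/= ex]] := clp [set x | ~ (`|x - p| < e)] (ball p e) cU (nbhsx_ballx p e e0).
by rewrite /ball /= distrC.
Qed.

(** T is the weak integral of the operators f |-> w z <f, b_z> b_z. *)
Section WeakOperator.
Context (R : realType) (V : lmodType R[i]) (H : set V) (ip : V -> V -> R[i]).
Hypotheses (Hip : sesqui_form H ip) (Hc : hcomplete H ip).
Context d (Z : measurableType d) (P : {measure set Z -> \bar R}).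
Variables (w : Z -> R[i]) (b : Z -> V).
Hypotheses (lw : inL1 P setT w) (Hb : forall z, H (b z)).
Hypothesis b1 : forall z, hnorm ip (b z) <= 1.
Hypothesis mb : forall f, H f -> cmeasurable_fun setT (fun z => ip f (b z)).
Variable T : V -> V.
Hypothesis TH : forall f, H f -> H (T f).
Hypothesis TE : forall f g, H f -> H g ->
  ip (T f) g = cintegral P setT (fun z => w z * ip f (b z) * (ip g (b z))^*).
Local Notation nrm := (hnorm ip).

Let mw : cmeasurable_fun setT w. Proof. by case: lw. Qed.

Lemma coeff_le f z : H f -> normc (ip f (b z)) <= nrm f.
Proof.
move=> hf; apply: le_trans (cauchy_schwarz Hip hf (Hb z)) _.
by rewrite ler_piMr ?hnorm_ge0.
Qed.

Lemma inL1_coeff f g : H f -> H g ->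
  inL1 P setT (fun z => w z * ip f (b z) * (ip g (b z))^*).
Proof.
move=> hf hg; have mwf := cmeas_enormc mw.
apply: (inL1_le (g := fun z => (nrm f * nrm g)%:E * (normc (w z))%:E)%E).
- by apply: cmeasM; [apply: cmeasM => //; exact: mb|apply: cmeas_conj; exact: mb].
- exact: measurable_funeM.
- move=> z; rewrite -EFinM lee_fin !Normc.normcM normc_conj -mulrA mulrC.
  by rewrite ler_wpM2r ?normc_ge0// ler_pM ?normc_ge0// coeff_le.
- rewrite ge0_integralZl_EFin ?mulr_ge0 ?hnorm_ge0//; last first.
    by move=> z _; rewrite lee_fin normc_ge0.
  by rewrite lte_mul_pinfty ?lee_fin ?mulr_ge0 ?hnorm_ge0//; case: lw.
Qed.

(** Take g = v and divide by |v|, since |<v, b_z>| <= |v|. *)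
Lemma weak_norm_le v f : H v -> H f ->
  (forall g, H g -> ip v g =
     cintegral P setT (fun z => w z * ip f (b z) * (ip g (b z))^*)) ->
  ((nrm v)%:E <= \int[P]_z (normc (w z) * normc (ip f (b z)))%:E)%E.
Proof.
move=> hv hf hE; have mwf := cmeas_normc mw; have mff := cmeas_normc (mb hf).
have i0 : (0 <= \int[P]_z (normc (w z) * normc (ip f (b z)))%:E)%E.
  by apply: integral_ge0 => z _; rewrite lee_fin mulr_ge0 ?normc_ge0.
have [->//|v0] := eqVneq (nrm v) 0.
have vp : 0 < nrm v by rewrite lt_neqAle eq_sym v0 hnorm_ge0.
rewrite -(@lee_pmul2l _ (nrm v)%:E) ?lte_fin//.
rewrite -ge0_integralZl_EFin ?hnorm_ge0//; last 2 first.
- by move=> z _; rewrite lee_fin mulr_ge0 ?normc_ge0.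
- by apply/measurable_EFinP/measurable_funM.
have -> : ((nrm v)%:E * (nrm v)%:E = (normc (ip v v))%:E)%E.
  by rewrite -EFinM (ip_hnorm Hip hv) normc_real ger0_norm ?sqr_ge0// expr2.
rewrite (hE _ hv); apply: le_trans (normc_cintegral_le (inL1_coeff hf hv)) _.
apply: ge0_le_integral => //.
- by move=> z _; rewrite lee_fin normc_ge0.
- by apply: cmeas_enormc; case: (inL1_coeff hf hv).
- apply: measurable_funeM; apply/measurable_EFinP; exact: measurable_funM.
- move=> z _; rewrite -EFinM lee_fin !Normc.normcM normc_conj mulrC.
  by rewrite ler_wpM2r ?mulr_ge0 ?normc_ge0// coeff_le.
Qed.

Lemma weak_linear : linear_operator H ip T.
Proof.
split=> // a x y hx hy.
have hxy := sfZD Hip a hx hy.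
have hr := sfZD Hip a (TH hx) (TH hy).
pose v := T (a *: x + y) - (a *: T x + T y).
have hv : H v by apply: (sfB Hip) => //; exact: TH.
suff v0 : ip v v = 0 by rewrite /heq /hnorm -/v v0 sqrtr0.
have lx := inL1_coeff hx hv; have ly := inL1_coeff hy hv.
rewrite {1}/v (ipBl Hip)//; last exact: TH.
rewrite (ipZDl Hip) ?TE//; try exact: TH.
rewrite -cintegralZ// -cintegralD//; last exact: inL1Z.
apply/eqP; rewrite subr_eq0; apply/eqP; congr (cintegral _ _); apply/funext => z.
by rewrite (ipZDl Hip)//; ring.
Qed.

Lemma weak_diff_norm_le x y : H x -> H y ->
  ((nrm (T x - T y))%:E <= \int[P]_z (normc (w z) * normc (ip (x - y) (b z)))%:E)%E.
Proof.
move=> hx hy; apply: weak_norm_le.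
- by apply: (sfB Hip); exact: TH.
- exact: (sfB Hip).
move=> g hg; rewrite (ipBl Hip) ?TE//; try exact: TH.
rewrite -cintegralB; [|exact: inL1_coeff..].
by congr (cintegral _ _); apply/funext => z; rewrite (ipBl Hip)//; ring.
Qed.

(** The limits of <x_n, d_j> along an ultrafilter, for a dense sequence d_j, are
    realized diagonally by a subsequence; boundedness passes from the d_j to all
    vectors g. *)
Lemma weak_subsequence (x : nat -> V) (M : R) : hseparable H ip ->
  (forall n, H (x n)) -> (forall n, nrm (x n) <= M) ->
  exists2 k : nat -> nat, {homo k : m n / (m < n)%N} &
    forall g, H g -> forall e : R, 0 < e -> exists N, forall i j,
      (N <= i)%N -> (N <= j)%N -> normc (ip (x (k i)) g - ip (x (k j)) g) < e.
Proof.
move=> [D [HD Ddense]] Hx xM.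
have M0 : 0 <= M by exact: le_trans (hnorm_ge0 _ _) (xM 0%N).
have [U [UU subU]] := ultraFilterLemma (eventually_filter : ProperFilter \oo).
have bnd n j : normc (ip (x n) (D j)) <= M * nrm (D j).
  apply: le_trans (cauchy_schwarz Hip (Hx n) (HD j)) _.
  by rewrite ler_wpM2r ?hnorm_ge0.
have /choice[p hp] (j : nat) : exists p : R[i], forall e, 0 < e ->
    U [set n | normc (ip (x n) (D j) - p) < e].
  have [p1 h1] := ultrafilter_bounded_lim UU
    (fun n => le_trans (normr_Re_le _) (bnd n j)).
  have [p2 h2] := ultrafilter_bounded_lim UU
    (fun n => le_trans (normr_Im_le _) (bnd n j)).
  exists (p1 +i* p2) => e e0; have e20 : 0 < e / 2 by rewrite divr_gt0.
  apply: filterS2 (h1 _ e20) (h2 _ e20) => n /= a1 a2.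
  apply: le_lt_trans (normc_le_ReIm _) _; rewrite ReB ImB /= [e]splitr.
  exact: ltrD.
have /choice[nx hnx] (q : nat * nat) : exists n, (q.1 < n)%N /\
    forall j, (j <= q.2)%N -> normc (ip (x n) (D j) - p j) < (q.2.+1%:R)^-1.
  have e0 : 0 < (q.2.+1%:R : R)^-1 by rewrite invr_gt0.
  have h1 : U [set n | (q.1 < n)%N] by apply: subU; exists q.1.+1.
  have h2 : U [set n | forall j, (j < q.2.+1)%N ->
      normc (ip (x n) (D j) - p j) < (q.2.+1%:R)^-1].
    move: (q.2.+1) e0 => m; move: (m%:R^-1) => e e0; elim: m => [|m IH].
      by apply: filterS (filterT : U setT) => n _ j.
    apply: filterS2 IH (hp m _ e0) => n /= a1 a2 j; rewrite ltnS leq_eqVlt.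
    by case/orP => [/eqP->//|/a1].
  by have [n [n1 n2]] := filter_ex (filterI h1 h2); exists n; split.
pose k := fix k i := match i with O => nx (0%N, 0%N) | i'.+1 => nx (k i', i'.+1) end.
have kP i j : (j <= i)%N -> normc (ip (x (k i)) (D j) - p j) < (i.+1%:R)^-1.
  move=> ji; case: i ji => [|i] ji /=.
    by have [_] := hnx (0%N, 0%N); apply.
  by have [_] := hnx (k i, i.+1); apply.
exists k.
  apply: homo_ltn; first exact: ltn_trans.
  by move=> i /=; have [] := hnx (k i, i.+1).
move=> g hg e e0.
(* d_j is so close to g that replacing g by d_j costs at most e / 4 *)
have e8 : 0 < e / (4 * (M + 1)) by rewrite divr_gt0// mulr_gt0//; lra.
have [j hj] := Ddense g hg _ e8.
have e4 : 0 < e / 4 by rewrite divr_gt0.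
have [N0 _ /(_ N0 (leqnn _)) hN0] := near_infty_natSinv_lt (PosNum e4).
pose N := maxn j N0; exists N.
have key i : (N <= i)%N -> normc (ip (x (k i)) (D j) - p j) < e / 4.
  move=> Ni; apply: lt_trans (kP _ _ (leq_trans (leq_maxl _ _) Ni)) _.
  apply: le_lt_trans hN0; rewrite lef_pV2 ?posrE ?ltr0n// ler_nat ltnS.
  exact: leq_trans (leq_maxr _ _) Ni.
have Hgd := sfB Hip hg (HD j).
have small i : normc (ip (x (k i)) (g - D j)) <= e / 4.
  apply: le_trans (cauchy_schwarz Hip (Hx _) Hgd) _.
  apply: le_trans (_ : M * (e / (4 * (M + 1))) <= _).
    by rewrite ler_pM ?hnorm_ge0// ltW.
  rewrite mulrA ler_pdivrMr ?mulr_gt0//; last lra.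
  by nra.
move=> i l Ni Nl.
have -> : ip (x (k i)) g - ip (x (k l)) g =
    (ip (x (k i)) (g - D j) - ip (x (k l)) (g - D j)) +
    ((ip (x (k i)) (D j) - p j) - (ip (x (k l)) (D j) - p j)).
  by rewrite !(ipBr Hip)//; ring.
apply: le_lt_trans (le_normcD _ _) _.
have h1 : normc (ip (x (k i)) (g - D j) - ip (x (k l)) (g - D j)) <= e / 4 + e / 4.
  by apply: le_trans (le_normcD _ _) _; rewrite normcN lerD.
have h2 : normc ((ip (x (k i)) (D j) - p j) - (ip (x (k l)) (D j) - p j)) <
    e / 4 + e / 4.
  by apply: le_lt_trans (le_normcD _ _) _; rewrite normcN ltrD// key.
by apply: lt_le_trans (ler_ltD h1 h2) _; lra.
Qed.

(** Weak convergence of x_{k i} makes the coefficients <x_{k i}, b_z> converge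
    for every z; dominated convergence turns this into norm convergence of
    T x_{k i}. *)
Lemma weak_compact : hseparable H ip -> compact_operator H ip T.
Proof.
move=> Hsep; split; first exact: weak_linear.
move=> x Hx [M xM].
have M0 : 0 <= M by exact: le_trans (hnorm_ge0 _ _) (xM 0%N).
have [k kmono kC] := weak_subsequence Hsep Hx xM.
pose c i z := ip (x (k i)) (b z).
have cM i z : normc (c i z) <= M by exact: le_trans (coeff_le _ (Hx _)) (xM _).
have mc i : cmeasurable_fun setT (c i) by exact: mb.
have cv (h : R[i] -> R) (hB : forall u v, h (u - v) = h u - h v)
    (hn : forall u, `|h u| <= normc u) z : cvgn (fun i => h (c i z)).
  apply: cauchy_seq_cvgn => e e0.
  have [N hN] := kC _ (Hb z) e e0; exists N => i j Ni Nj.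
  by rewrite -hB; apply: le_lt_trans (hn _) _; exact: hN.
pose sr z := limn (fun i => Re (c i z)).
pose si z := limn (fun i => Im (c i z)).
have csr z : (fun i => Re (c i z)) @ \oo --> sr z.
  exact: cv (@complex.Re R) (@ReB R) (@normr_Re_le R) z.
have csi z : (fun i => Im (c i z)) @ \oo --> si z.
  exact: cv (@complex.Im R) (@ImB R) (@normr_Im_le R) z.
pose s z : R[i] := sr z +i* si z.
have ms : cmeasurable_fun setT s.
  apply: cmeas_ReIm.
    apply: (@measurable_fun_cvg _ _ _ _ (fun i z => Re (c i z))) => [i|z _].
      by case: (mc i).
    exact: csr.
  apply: (@measurable_fun_cvg _ _ _ _ (fun i z => Im (c i z))) => [i|z _].
    by case: (mc i).
  exact: csi.
have cs z : (fun i => normc (c i z - s z)) @ \oo --> (0 : R).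
  have h1 : (fun i => `|Re (c i z) - sr z| + `|Im (c i z) - si z|) @ \oo
      --> `|sr z - sr z| + `|si z - si z|.
    by apply: cvgD; apply: cvg_norm; apply: cvgB => //; exact: cvg_cst.
  rewrite !subrr !normr0 addr0 in h1.
  apply: (@squeeze_cvgr _ _ _ _ (cst 0) _ _ _ _ _ h1); last exact: cvg_cst.
  apply: nearW => i /=; rewrite normc_ge0/=.
  by have := normc_le_ReIm (c i z - s z); rewrite ReB ImB.
have sM z : normc (s z) <= M + M.
  apply: le_trans (normc_le_ReIm _) _; apply: lerD.
    rewrite -(cvg_lim _ (cvg_norm (csr z)))//.
    apply: limr_le; first by apply: cvgP; exact: cvg_norm (csr z).
    by apply: nearW => i; exact: le_trans (normr_Re_le _) (cM i z).
  rewrite -(cvg_lim _ (cvg_norm (csi z)))//.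
  apply: limr_le; first by apply: cvgP; exact: cvg_norm (csi z).
  by apply: nearW => i; exact: le_trans (normr_Im_le _) (cM i z).
pose F i z := (normc (w z) * normc (c i z - s z))%:E.
have F0 i z : (0 <= F i z)%E by rewrite lee_fin mulr_ge0 ?normc_ge0.
have mF i : measurable_fun setT (F i).
  apply/measurable_EFinP/measurable_funM; apply: cmeas_normc => //.
  exact: cmeasB.
have FE : (fun i => \int[P]_z F i z)%E @ \oo --> 0%E.
  have <- : (\int[P]_z (cst 0%E : Z -> \bar R) z = 0)%E by rewrite integral0.
  apply: (@dominated_cvg _ _ _ P setT measurableT F (cst 0%E)
    (fun z => (3 * M)%:E * (normc (w z))%:E)%E) => //.
  - move=> z _ /=.
    have h : (fun i => normc (w z) * normc (c i z - s z)) @ \oo --> normc (w z) * 0.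
      by apply: cvgM; [exact: cvg_cst|exact: cs].
    by rewrite mulr0 in h; exact: EFin_cvgn h.
  - exact: integrableZl (inL1_normc lw).
  - move=> i z _; rewrite gee0_abs// -EFinM lee_fin mulrC ler_wpM2r ?normc_ge0//.
    apply: le_trans (le_normcD _ _) _; rewrite normcN.
    by have := cM i z; have := sM z; lra.
have [|y Hy cy] := Hc (fun i => TH (Hx (k i))); last by exists k, y; split.
move=> e e0.
have e20 : 0 < e / 2 by rewrite divr_gt0.
have [N _ hN] : \forall i \near \oo, (\int[P]_z F i z < (e / 2)%:E)%E.
  move/fine_cvgP : FE => [fF /cvgrPdist_lt/(_ _ e20)].
  apply: filterS2 fF => i fi; rewrite sub0r normrN /= ger0_norm ?fine_ge0 ?integral_ge0//.
  by rewrite -lte_fin fineK.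
exists N => i j Ni Nj; rewrite -lte_fin.
apply: le_lt_trans (weak_diff_norm_le (Hx _) (Hx _)) _.
apply: (@le_lt_trans _ _ (\int[P]_z (F i z + F j z))%E).
  apply: ge0_le_integral => //.
  - by move=> z _; rewrite lee_fin mulr_ge0 ?normc_ge0.
  - apply/measurable_EFinP/measurable_funM; apply: cmeas_normc => //.
    by apply: mb; exact: (sfB Hip).
  - exact: emeasurable_funD.
  - move=> z _; rewrite -EFinD lee_fin -mulrDr ler_wpM2l ?normc_ge0//.
    rewrite (ipBl Hip)// -/(c i z) -/(c j z).
    rewrite (_ : c i z - c j z = (c i z - s z) - (c j z - s z)); last by ring.
    by apply: le_trans (le_normcD _ _) _; rewrite normcN.
rewrite ge0_integralD//; have := lte_leD _ (hN i Ni) (ltW (hN j Nj)).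
rewrite -EFinD -splitr; apply.
by rewrite ge0_fin_numE ?integral_ge0// (lt_trans (hN j Nj)) ?ltry.
Qed.

Section SymmetricOperator.
Variable A : V -> V.
Hypothesis AL : linear_operator H ip A.
Hypothesis A0 : forall x, H x -> 0 <= ip (A x) x.

Lemma heq_ipl x y z : H x -> H y -> H z -> heq ip x y -> ip x z = ip y z.
Proof.
move=> hx hy hz /(hnorm0_ip Hip (sfB Hip hx hy) hz); rewrite (ipBl Hip)//.
by move/eqP; rewrite subr_eq0 => /eqP.
Qed.

Lemma heq_ipr x y z : H x -> H y -> H z -> heq ip x y -> ip z x = ip z y.
Proof.
by move=> hx hy hz xy; rewrite (ip_conj Hip hx hz) (heq_ipl hx hy hz xy) -(ip_conj Hip).
Qed.

Let ALip a x y z : H x -> H y -> H z ->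
  ip (A (a *: x + y)) z = a * ip (A x) z + ip (A y) z.
Proof.
move=> hx hy hz; have [AH Al] := AL; have hxy := sfZD Hip a hx hy.
have AX := AH _ hx; have AY := AH _ hy.
have hA := sfZD Hip a AX AY.
by rewrite (heq_ipl (AH _ hxy) hA hz (Al a x y hx hy)) (ipZDl Hip).
Qed.

(** Polarization: positivity makes <A(x+y), x+y> and <A(ix+y), ix+y> real. *)
Lemma positive_symmetric x y : H x -> H y -> ip (A x) y = ip x (A y).
Proof.
move=> hx hy; have [AH _] := AL; have AX := AH _ hx; have AY := AH _ hy.
have hxy := sfZD Hip 1 hx hy; have hixy := sfZD Hip 'i hx hy.
have [rx _] := ge0_complexP (A0 hx); have [ry _] := ge0_complexP (A0 hy).
have expand (a : R[i]) : ip (A (a *: x + y)) (a *: x + y) =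
    a * a^* * ip (A x) x + a * ip (A x) y + a^* * ip (A y) x + ip (A y) y.
  have ha := sfZD Hip a hx hy.
  have hax : H (a *: x) by exact: (sfZ Hip a hx).
  by rewrite ALip// !(ipDr Hip) ?(ipZr Hip)//; ring.
have := ge0_complexP (A0 hxy); rewrite expand => -[r1 _].
have := ge0_complexP (A0 hixy); rewrite expand => -[r2 _].
rewrite [RHS](ip_conj Hip AY hx).
move: r1 r2 rx ry; case: (ip (A x) y) => p1 p2; case: (ip (A y) x) => q1 q2.
case: (ip (A x) x) => s1 s2; case: (ip (A y) y) => t1 t2.
move=> /= [h1] [h2] [h3] [h4]; apply: complex_eqP => /=; lra.
Qed.

Lemma eigenvectors_orthogonal (l l' : R) e e' : H e -> H e' -> l != l' ->
  heq ip (A e) (l%:C *: e) -> heq ip (A e') (l'%:C *: e') -> ip e e' = 0.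
Proof.
move=> he he' ll' E E'; have [AH _] := AL.
have := positive_symmetric he he'.
have hle := sfZ Hip l%:C he; have hle' := sfZ Hip l'%:C he'.
rewrite (heq_ipl (AH _ he) hle he' E) (heq_ipr (AH _ he') hle' he E').
rewrite (ipZl Hip _ he he') (ipZr Hip _ he' he).
rewrite conjc_real => /eqP.
rewrite -subr_eq0 -mulrBl mulf_eq0 => /orP[|/eqP//].
by rewrite -rmorphB/= => /eqP[]/eqP; rewrite subr_eq0 (negbTE ll').
Qed.

End SymmetricOperator.

Local Notation W := (L1norm P setT w).

(** If A = |T| and A e_i = l_i e_i with l_i > 0 and e_i orthonormal, then
    v_i = T e_i / l_i is orthonormal as well and l_i = <T e_i, v_i>. Bessel's
    inequality for both families bounds the sum of |<e_i, b_z>| |<v_i, b_z>|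
    by 1. *)
Lemma sum_singular_values_le (A : V -> V) (I : finType) (e : I -> V) (l : I -> R) :
  is_abs_operator H ip T A -> (forall i, H (e i)) -> (forall i, 0 < l i) ->
  (forall i, heq ip (A (e i)) ((l i)%:C *: e i)) ->
  (forall i j, ip (e i) (e j) = (i == j)%:R) ->
  ((\sum_i l i)%:E <= W)%E.
Proof.
move=> [AL A0 [Tadj [[TadjH _] adj] sq]] he l0 eA eo; have [AH _] := AL.
have TT i j : ip (T (e i)) (T (e j)) = (l i * l j)%:C * (i == j)%:R.
  rewrite adj//; last exact: TH.
  have HAA := AH _ (AH _ (he j)); have HTT := TadjH _ (TH (he j)).
  rewrite -(heq_ipr HAA HTT (he i) (sq _ (he j))).
  rewrite -(positive_symmetric AL A0)//; last exact: AH.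
  have hle k : H ((l k)%:C *: e k) by exact: (sfZ Hip _ (he k)).
  rewrite (heq_ipl _ _ _ (eA i)) ?(heq_ipr _ _ _ (eA j))//; try exact: AH.
  by rewrite (ipZl Hip)// (ipZr Hip)// eo conjc_real rmorphM/= mulrA.
pose v i := ((l i)^-1)%:C *: T (e i).
have hv i : H (v i) by exact: (sfZ Hip _ (TH (he i))).
have vo i j : ip (v i) (v j) = (i == j)%:R.
  rewrite {1}/v (ipZl Hip _ (TH (he i)) (hv j)) /v (ipZr Hip _ (TH (he j)) (TH (he i))) TT.
  have [->|] := eqVneq i j; last by rewrite !mulr0.
  rewrite mulr1 conjc_real -!rmorphM/=.
  have lj : l j != 0 by rewrite gt_eqF.
  by rewrite (_ : _ * _ = 1)//; field.
pose G i z := (normc (w z) * (normc (ip (e i) (b z)) * normc (ip (v i) (b z))))%:E.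
have G0 i z : (0 <= G i z)%E by rewrite lee_fin !mulr_ge0 ?normc_ge0.
have mG i : measurable_fun setT (G i).
  apply/measurable_EFinP/measurable_funM; first exact: cmeas_normc.
  by apply: measurable_funM; apply: cmeas_normc; exact: mb.
have lG i : ((l i)%:E <= \int[P]_z G i z)%E.
  have -> : l i = normc (ip (T (e i)) (v i)).
    rewrite /v (ipZr Hip _ (TH (he i)) (TH (he i))) TT eqxx mulr1 conjc_real -rmorphM.
    have li : l i != 0 by rewrite gt_eqF.
    by rewrite mulrA mulVf// mul1r /= expr0n/= addr0 sqrtr_sqr gtr0_norm.
  rewrite TE//; apply: le_trans (normc_cintegral_le (inL1_coeff _ _)) _ => //.
  apply: ge0_le_integral => //.
  - by move=> z _; rewrite lee_fin normc_ge0.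
  - by apply: cmeas_enormc; case: (inL1_coeff (he i) (hv i)).
  - by move=> z _; rewrite lee_fin !Normc.normcM normc_conj mulrA.
have bes z f : (forall i : I, H (f i)) -> (forall i j, ip (f i) (f j) = (i == j)%:R) ->
    \sum_i normc (ip (f i) (b z)) ^+ 2 <= 1.
  move=> hf fo; apply: le_trans (_ : hnorm ip (b z) ^+ 2 <= _).
    apply: le_trans (bessel Hip (Hb z) hf fo); apply: ler_sum => i _.
    by rewrite (ip_conj Hip (Hb z) (hf i)) normc_conj.
  by rewrite expr_le1 ?hnorm_ge0.
apply: (@le_trans _ _ (\sum_i \int[P]_z G i z)%E).
  by rewrite -sumEFin; apply: lee_sum.
rewrite -ge0_integral_sum//; apply: ge0_le_integral => //.
- by move=> z _; exact: sume_ge0.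
- exact: emeasurable_sum.
- exact: cmeas_enormc.
- move=> z _; rewrite sumEFin lee_fin -mulr_sumr ler_piMr ?normc_ge0//.
  have h1 := bes z e he eo; have h2 := bes z v hv vo.
  apply: le_trans (_ : \sum_i (normc (ip (e i) (b z)) ^+ 2 +
     normc (ip (v i) (b z)) ^+ 2) / 2 <= 1).
    apply: ler_sum => i _.
    have := sqr_ge0 (normc (ip (e i) (b z)) - normc (ip (v i) (b z))); nra.
  by rewrite -mulr_suml big_split/=; lra.
Qed.

(** The value 0 that stands for |T| when it does not exist has no eigenvector
    for a positive eigenvalue. *)
Lemma sum_abs_operator_eigenvalues_le (I : finType) (e : I -> V) (l : I -> R) :
  (forall i, H (e i)) -> (forall i, 0 < l i) ->
  (forall i, heq ip (abs_operator H ip T (e i)) ((l i)%:C *: e i)) ->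
  (forall i j, (i == j) || (l i != l j) || (ip (e i) (e j) == 0)) ->
  (forall i, ip (e i) (e i) = 1) ->
  ((\sum_i l i)%:E <= W)%E.
Proof.
move=> he l0 eA eo en.
have [[A hA]|nA] := pselect (exists A, is_abs_operator H ip T A).
  have aA : is_abs_operator H ip T (abs_operator H ip T).
    by apply: (xgetPex (fun=> 0) (P := [set A | is_abs_operator H ip T A])); exists A.
  apply: (sum_singular_values_le aA he l0 eA) => i j.
  have [->|ij] := eqVneq i j; first exact: en.
  have := eo i j; rewrite (negbTE ij)/= => /orP[ll|/eqP//].
  case: aA => AL A0 _.
  exact: (eigenvectors_orthogonal AL A0 (he i) (he j) ll (eA i) (eA j)).
have AE : abs_operator H ip T = fun=> 0.
  by apply: xgetPN => A hA; apply: nA; exists A.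
rewrite big1 ?lee_fin//; first by apply: integral_ge0 => z _; rewrite lee_fin normc_ge0.
move=> i _; have := eA i; have hl := sfZ Hip (l i)%:C (he i).
rewrite AE /heq sub0r (hnormN Hip hl) (hnormZ Hip _ (he i)).
rewrite normc_real gtr0_norm// {1}/hnorm en /= sqrtr1 mulr1.
by move=> li; have := l0 i; rewrite li ltxx.
Qed.

(** Each multiplicity is attained, because n l <= |w|_1 for an orthonormal
    family of n eigenvectors. The families belonging to the finitely many
    eigenvalues of a partial sum together form a single orthonormal family. *)
Lemma schatten_norm_le : (schatten_norm H ip 1 T <= W)%E.
Proof.
set A := abs_operator H ip T.
have W0 : (0 <= W)%E by apply: integral_ge0 => z _; rewrite lee_fin normc_ge0.
have Wf : W \is a fin_num by rewrite ge0_fin_numE//; case: lw.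
pose E (l : R) := [set n : nat | exists e : 'I_n -> V,
    (forall i, H (e i) /\ heq ip (A (e i)) (l%:C *: e i)) /\
    forall i j, ip (e i) (e j) = (i == j)%:R].
have bndE l n : 0 < l -> E l n -> n%:R * l <= fine W.
  move=> l0 [e [eP eo]].
  suff : ((\sum_(i < n) l)%:E <= W)%E.
    by rewrite sumr_const card_ord -[l *+ n]mulr_natl -[in X in X -> _](fineK Wf) lee_fin.
  apply: (@sum_abs_operator_eigenvalues_le 'I_n e (fun=> l)) => //.
  - by move=> i; case: (eP i).
  - by move=> i; case: (eP i).
  - move=> i j; rewrite eo; case: (eqVneq i j) => //= _.
    by rewrite !eqxx orbT.
  - by move=> i; rewrite eo eqxx.
have /choice[n hn] (l : R) : exists n : nat, 0 < l ->
    E l n /\ eigen_mult H ip A l = (n%:R)%:E.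
  have [l0|nl0] := boolP (0 < l); last by exists 0%N.
  have E0 : exists n, [pred n | `[< E l n >]] n.
    by exists 0%N => /=; apply/asboolP; exists (fun=> 0); split; case.
  have Eb n : [pred n | `[< E l n >]] n -> (n <= Num.truncn (fine W / l))%N.
    move=> /asboolP/(bndE _ _ l0) h; rewrite -ltnS -(ltr_nat R).
    apply: le_lt_trans (truncnS_gt _); rewrite ler_pdivlMr//.
  case: (ex_maxnP E0 Eb) => m /asboolP Em mmax; exists m => _; split => //.
  apply/eqP; rewrite eq_le; apply/andP; split.
    apply: ge_ereal_sup => _ [k /= Ek <-]; rewrite lee_fin ler_nat.
    by apply: mmax; apply/asboolP.
  by apply: ereal_sup_ubound; exists m.
rewrite /schatten_norm invr1 poweRe1; last first.
  apply: esum_ge0 => l l0; apply: mule_ge0; last by rewrite lee_fin powR_ge0.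
  by have [_ ->] := hn l l0; rewrite lee_fin.
apply: ge_ereal_sup => _ [X [fX Xpos] <-].
rewrite fsbig_finite//; set s := finmap.enum_fset (fset_set X).
have sX x : x \in s -> 0 < x.
  by move=> xs; apply: Xpos; move: xs; rewrite /s in_fset_set// inE.
have us : uniq s by exact: finmap.fset_uniq.
rewrite big_tnth; set t := tnth (in_tuple s).
have tinj : injective t by apply/(tuple_uniqP (in_tuple s)).
have t0 i : 0 < t i by apply: sX; exact: mem_tnth.
have -> : (\sum_(i < size s) eigen_mult H ip A (t i) * (t i `^ 1)%:E =
    (\sum_(i < size s) \sum_(j < n (t i)) t i)%:E)%E.
  rewrite -sumEFin; apply: eq_bigr => i _; have [_ ->] := hn _ (t0 i).
  by rewrite powRr1 ?(ltW (t0 i))// -EFinM sumr_const card_ord mulr_natl.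
rewrite (sig_big_dep (J := fun i : 'I_(size s) => 'I_(n (t i))))/=.
have Et i : E (t i) (n (t i)) by have [] := hn _ (t0 i).
pose e i := projT1 (cid (Et i)).
have he i : (forall j, H (e i j) /\ heq ip (A (e i j)) ((t i)%:C *: e i j)) /\
    forall j k, ip (e i j) (e i k) = (j == k)%:R by exact: (projT2 (cid (Et i))).
apply: (@sum_abs_operator_eigenvalues_le _ (fun p => e (tag p) (tagged p))
  (fun p : {i : 'I_(size s) & 'I_(n (t i))} => t (tag p))).
- by move=> [i j] /=; have [/(_ j)[]] := he i.
- by move=> [i j] /=; exact: t0.
- by move=> [i j] /=; have [/(_ j)[]] := he i.
- move=> [i j] [i' j'] /=; have [ii|ii] := eqVneq i i'.
    subst i'; rewrite eq_Tagged /= ?eqxx/=; have [_ ->] := he i.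
    by case: (eqVneq j j') => //= _; rewrite eqxx.
  rewrite (_ : t i != t i') ?orbT//; apply: contra ii => /eqP h.
  by apply/eqP/tinj.
- by move=> [i j] /=; have [_ ->] := he i; rewrite eqxx.
Qed.

End WeakOperator.

(** * Product measurability and measure-preserving maps *)

Section ComplexFubini.
Context d1 d2 (T1 : measurableType d1) (T2 : measurableType d2) (R : realType).
Variable m1 : {sigma_finite_measure set T1 -> \bar R}.
Variable m2 : {sigma_finite_measure set T2 -> \bar R}.

Lemma measurable_Rintegral (f : T1 * T2 -> R) : measurable_fun setT f ->
  measurable_fun setT (fun x => \int[m2]_y f (x, y)).
Proof.
move=> mf; have mef : measurable_fun setT (EFin \o f) by exact/measurable_EFinP.
apply: (measurableT_comp (f := fine) (g := fun x => (\int[m2]_y (f (x, y))%:E)%E)) => //.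
rewrite (_ : (fun x => _) = (fun x => \int[m2]_y ((EFin \o f)^\+ (x, y)) -
    \int[m2]_y ((EFin \o f)^\- (x, y)))%E); last first.
  apply/funext => x; rewrite integralE; congr (_ - _)%E.
    by apply: eq_integral => y _; rewrite !funeposE.
  by apply: eq_integral => y _; rewrite !funenegE.
apply: emeasurable_funB.
  by apply: measurable_fun_fubini_tonelli_F => //; exact: measurable_funepos.
by apply: measurable_fun_fubini_tonelli_F => //; exact: measurable_funeneg.
Qed.

Lemma cmeas_cintegral (F : T1 * T2 -> R[i]) : cmeasurable_fun setT F ->
  cmeasurable_fun setT (fun x => cintegral m2 setT (fun y => F (x, y))).
Proof.
move=> [f1 f2]; apply: cmeas_ReIm.
  exact: (measurable_Rintegral f1).
exact: (measurable_Rintegral f2).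
Qed.

Lemma Rfubini12 (f : T1 * T2 -> R) :
  (m1 \x m2)%E.-integrable setT (EFin \o f) ->
  \int[m1]_x \int[m2]_y f (x, y) = \int[(m1 \x m2)%E]_z f z.
Proof.
move=> fi; rewrite /Rintegral; congr fine.
have mf : measurable_fun setT f.
  by apply/measurable_EFinP; exact: measurable_int fi.
rewrite -[RHS](integral12_prod_meas1 fi); apply: ae_eq_integral => //.
- by apply/measurable_EFinP; exact: measurable_Rintegral.
- exact: (measurable_fubini_F fi).
- apply: filterS (ae_integrable1 fi) => x xi _.
  by rewrite fineK//; exact: integrable_fin_num.
Qed.

Lemma cfubini12 (F : T1 * T2 -> R[i]) : inL1 (m1 \x m2)%E setT F ->
  cintegral m1 setT (fun x => cintegral m2 setT (fun y => F (x, y))) =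
  cintegral (m1 \x m2)%E setT F.
Proof.
move=> lF; apply: complex_eqP.
  exact: (Rfubini12 (inL1_Re lF)).
exact: (Rfubini12 (inL1_Im lF)).
Qed.

Lemma inL1_prod (F : T1 * T2 -> R[i]) : cmeasurable_fun setT F ->
  (\int[m1]_x \int[m2]_y (normc (F (x, y)))%:E < +oo)%E ->
  inL1 (m1 \x m2)%E setT F.
Proof.
move=> mF h; split => //.
rewrite /L1norm fubini_tonelli1//; first exact: cmeas_enormc.
by move=> z; rewrite lee_fin normc_ge0.
Qed.

End ComplexFubini.

Section ComplexFubiniSwap.
Context d1 d2 (T1 : measurableType d1) (T2 : measurableType d2) (R : realType).
Variable m1 : {sigma_finite_measure set T1 -> \bar R}.
Variable m2 : {sigma_finite_measure set T2 -> \bar R}.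

Lemma Rfubini21 (f : T1 * T2 -> R) :
  (m1 \x m2)%E.-integrable setT (EFin \o f) ->
  \int[m2]_y \int[m1]_x f (x, y) = \int[(m1 \x m2)%E]_z f z.
Proof.
move=> fi; rewrite /Rintegral; congr fine.
have mf : measurable_fun setT f.
  by apply/measurable_EFinP; exact: measurable_int fi.
rewrite -[RHS](integral21_prod_meas1 fi); apply: ae_eq_integral => //.
- apply/measurable_EFinP.
  have ms : measurable_fun setT (fun z : T2 * T1 => f (z.2, z.1)).
    exact: (measurableT_comp mf (@measurable_swap _ _ T2 T1)).
  exact: (measurable_Rintegral m1 ms).
- exact: (measurable_fubini_G fi).
- apply: filterS (ae_integrable2 fi) => x xi _.
  by rewrite fineK//; exact: integrable_fin_num.
Qed.

Lemma cfubini21 (F : T1 * T2 -> R[i]) : inL1 (m1 \x m2)%E setT F ->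
  cintegral m2 setT (fun y => cintegral m1 setT (fun x => F (x, y))) =
  cintegral (m1 \x m2)%E setT F.
Proof.
move=> lF; apply: complex_eqP.
  exact: (Rfubini21 (inL1_Re lF)).
exact: (Rfubini21 (inL1_Im lF)).
Qed.

Lemma cfubini (F : T1 * T2 -> R[i]) : inL1 (m1 \x m2)%E setT F ->
  cintegral m1 setT (fun x => cintegral m2 setT (fun y => F (x, y))) =
  cintegral m2 setT (fun y => cintegral m1 setT (fun x => F (x, y))).
Proof. by move=> lF; rewrite cfubini12// cfubini21. Qed.

End ComplexFubiniSwap.

Section MeasurePreserving.
Context d (T : measurableType d) (R : realType) (m : {measure set T -> \bar R}).

Definition measure_preserving (h : T -> T) :=
  measurable_fun setT h /\ forall A, measurable A -> m (h @^-1` A) = m A.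

Variable h : T -> T.
Hypothesis mph : measure_preserving h.
Let mh : measurable_fun setT h. Proof. by case: mph. Qed.

Lemma mp_ge0_integral (f : T -> \bar R) : measurable_fun setT f ->
  (forall x, 0 <= f x)%E -> (\int[m]_x f (h x) = \int[m]_x f x)%E.
Proof.
move=> mf f0; have := @ge0_integral_pushforward _ _ _ _ _ _ mh m setT f measurableT mf.
rewrite preimage_setT => <-; last by move=> y _; exact: f0.
by apply: eq_measure_integral => A mA _; case: mph => _ /(_ A mA).
Qed.

Lemma mp_integral (f : T -> \bar R) : measurable_fun setT f ->
  (\int[m]_x f (h x) = \int[m]_x f x)%E.
Proof.
move=> mf; rewrite integralE [in RHS]integralE; congr (_ - _)%E.
  under eq_integral do rewrite (funepos_comp f h)/=.
  by rewrite mp_ge0_integral//; exact: measurable_funepos.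
under eq_integral do rewrite (funeneg_comp f h)/=.
by rewrite mp_ge0_integral//; exact: measurable_funeneg.
Qed.

Lemma mp_cintegral (f : T -> R[i]) : cmeasurable_fun setT f ->
  cintegral m setT (fun x => f (h x)) = cintegral m setT f.
Proof.
move=> [f1 f2]; apply: complex_eqP; rewrite /= /Rintegral; congr fine.
  by rewrite (mp_integral (f := fun x => (Re (f x))%:E))//; exact/measurable_EFinP.
by rewrite (mp_integral (f := fun x => (Im (f x))%:E))//; exact/measurable_EFinP.
Qed.

Lemma mp_ae (P : T -> Prop) : {ae m, forall x, P x} -> {ae m, forall x, P (h x)}.
Proof.
move=> [N [mN N0 PN]]; exists (h @^-1` N); split.
- by rewrite -[_ @^-1` _]setTI; exact: mh.
- by case: mph => _ ->.
- by move=> x /= nP; exact: PN.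
Qed.

End MeasurePreserving.

Section Exhaustion.
Context (X : ptopologicalType).

Definition exhaustion (C : nat -> set X) := [/\ forall n, compact (C n),
  forall n, closed (C n), forall m n, (m <= n)%N -> C m `<=` C n &
  forall x, exists n, C n x].

(** Finitely many of the U x cover each set of the exhaustion. *)
Lemma exhaustion_lindelof (C : nat -> set X) (U : X -> set X) : exhaustion C ->
  (forall x, open_nbhs x (U x)) -> exists s : nat -> X, forall x, exists n, U (s n) x.
Proof.
move=> [cC _ _ covC] oU.
have fin n : exists s : seq X, forall x, C n x -> exists2 y, y \in s & U y x.
  have := cC n; rewrite compact_cover => /(_ X setT U) [].
  - by move=> x _; case: (oU x).
  - by move=> x _; exists x => //; case: (oU x).
  move=> D _ cD; exists (finmap.enum_fset D) => x /cD [y yD Uyx].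
  by exists y.
have [s hs] := choice fin.
exists (fun k => if unpickle k is Some (n, i) then nth point (s n) i else point).
move=> x; have [n Cx] := covC x; have [y ys Uyx] := hs n x Cx.
by exists (pickle (n, index y (s n))); rewrite pickleK nth_index.
Qed.

End Exhaustion.

Lemma borel_continuous_measurable (R : realType) (X : ptopologicalType) (f : X -> R) :
  continuous f -> measurable_fun setT (f : borel X -> R).
Proof.
move=> cf; apply: (@measurability _ _ (borel X) R setT f _ (RGenOpens.measurableE R)).
move=> _ [_ [a [b ->]] <-].
rewrite setTI; apply: sub_sigma_algebra.
by move/continuousP : cf; apply; exact: interval_open.
Qed.

Lemma borel_open_measurable (X : ptopologicalType) (U : set X) : open U ->
  measurable (U : set (borel X)).
Proof. exact: sub_sigma_algebra. Qed.

Lemma borel_closed_measurable (X : ptopologicalType) (U : set X) : closed U ->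
  measurable (U : set (borel X)).
Proof.
move=> cU; rewrite -[U]setCK; apply: measurableC; apply: borel_open_measurable.
by rewrite openC.
Qed.

Lemma borel_map_measurable (X Y : ptopologicalType) (f : X -> Y) :
  continuous f -> measurable_fun setT (f : borel X -> borel Y).
Proof.
move=> cf; apply: (@measurability _ _ (borel X) (borel Y) setT f open) => //.
move=> _ [V oV <-]; rewrite setTI; apply: borel_open_measurable.
by move/continuousP : cf; apply.
Qed.

(** For every n, countably many neighbourhoods on which F varies by at most 1/n
    in x, whatever y is, cover X. This writes the set where F > a as a countable
    union of rectangles. *)
Lemma equicontinuous_measurable (R : realType) (X : ptopologicalType)
    d (Y : measurableType d) (C : nat -> set X) (F : X -> Y -> R) :
  exhaustion C -> (forall x, measurable_fun setT (F x)) ->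
  (forall x (e : R), 0 < e -> \forall x' \near x, forall y, `|F x' y - F x y| <= e) ->
  measurable_fun setT (fun p : borel X * Y => F p.1 p.2).
Proof.
move=> eC mF eF.
pose e n : R := n.+1%:R^-1.
have e0 n : 0 < e n by rewrite invr_gt0.
pose U n x := interior [set x' | forall y, `|F x' y - F x y| <= e n].
have oU n x : open_nbhs x (U n x).
  by split; [exact: open_interior|exact: eF].
have [s hs] := choice (fun n => exhaustion_lindelof eC (oU n)).
apply: (@measurability _ _ (borel X * Y)%type R setT (fun p => F p.1 p.2) _
  (RGenOInfty.measurableE R)) => _ [_ [a ->] <-].
rewrite setTI.
have -> : (fun p : borel X * Y => F p.1 p.2) @^-1` `]a, +oo[%classic =
    \bigcup_n \bigcup_i ((U n (s n i) : set (borel X)) `*`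
      (F (s n i) @^-1` `]a + e n, +oo[%classic)).
  apply/seteqP; split=> -[x y] /=.
    rewrite in_itv/= andbT => aF.
    have [n hn] : exists n, a + e n + e n < F x y.
      have d0 : 0 < (F x y - a) / 2 by rewrite divr_gt0// subr_gt0.
      have [n _ /(_ n (leqnn _)) /= hn] := near_infty_natSinv_lt (PosNum d0).
      by exists n; move: hn; rewrite -/(e n); lra.
    have [i Ui] := hs n x; exists n => //; exists i => //=; split => //=.
    rewrite in_itv/= andbT.
    have := interior_subset Ui => /(_ y); rewrite ler_norml => /andP[_ h2].
    lra.
  move=> [n _ [i _ /= [Ui]]]; rewrite !in_itv/= !andbT.
  have := interior_subset Ui => /(_ y); rewrite ler_norml => /andP[h1 _].
  lra.
apply: bigcupT_measurable => n; apply: bigcupT_measurable => i.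
apply: measurableX; first by apply: borel_open_measurable; case: (oU n (s n i)).
by rewrite -[_ @^-1` _]setTI; apply: mF => //; exact: measurable_itv.
Qed.

Lemma continuous_section (X Y Z : topologicalType) (F : X * Y -> Z) (x : X) :
  continuous F -> continuous (fun y => F (x, y)).
Proof.
move=> cF y; apply: (cvg_comp (fun y => (x, y)) F); last exact: cF.
by apply: cvg_pair; [exact: cvg_cst|exact: cvg_id].
Qed.

(** The estimate at (x, y) holds on a product neighbourhood, and finitely many
    of these cover {x} x C. *)
Lemma compact_uniform_continuous (R : realType) (X Y : topologicalType)
    (F : X * Y -> R) (C : set Y) (x : X) (e : R) :
  compact C -> continuous F -> 0 < e ->
  \forall x' \near x, forall y, C y -> `|F (x', y) - F (x, y)| <= e.
Proof.
move=> cC cF e0.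
have := (compact_near_coveringP C).1 cC X (nbhs x)
  (fun x' y => `|F (x', y) - F (x, y)| <= e) _; apply => y Cy.
have e20 : 0 < e / 2 by rewrite divr_gt0.
have /cvgrPdist_lt/(_ _ e20) [[A B] /= [A1 B1] AB] := cF (x, y).
exists (B, A) => //= -[y' x'] /= [By' Ax'].
have h1 := AB (x', y') (conj Ax' By'); have h2 := AB (x, y') (conj (nbhs_singleton A1) By').
rewrite /= in h1 h2; rewrite -(subrKA (F (x, y))).
apply: le_trans (ler_normD _ _) _; rewrite [e]splitr lerD//.
  by rewrite distrC ltW.
by rewrite ltW.
Qed.

Section ContinuousOnProduct.
Context (R : realType) (X Y : ptopologicalType).

(** A Borel set of X x Y need not be measurable for the product of the Borel
    sigma-algebras. For continuous F it is enough that the factors are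
    sigma-compact: restricted to y in a compact set, F is continuous in x
    uniformly in y. *)
Lemma continuous_prod_measurable (F : X * Y -> R) (C : nat -> set X)
    (D : nat -> set Y) : exhaustion C -> exhaustion D -> continuous F ->
  measurable_fun setT (F : borel X * borel Y -> R).
Proof.
move=> eC eD cF; have [cD clD mD covD] := eD.
pose Fm n (x : X) (y : Y) := F (x, y) * (\1_(D n) y : R).
apply: (@measurable_fun_cvg _ _ _ _ (fun n (p : borel X * borel Y) => Fm n p.1 p.2)).
  move=> n; apply: (equicontinuous_measurable eC).
    move=> x; apply: measurable_funM.
      by apply: borel_continuous_measurable; exact: continuous_section.
    by apply: (@measurable_indic _ (borel Y) R setT); exact: borel_closed_measurable.
  move=> x e e0; apply: filterS (compact_uniform_continuous x (cD n) cF e0).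
  move=> x' h y; rewrite /Fm indicE.
  have [Dy|nDy] := pselect (D n y).
    by rewrite mem_set// !mulr1; exact: h.
  by rewrite memNset// !mulr0 subrr normr0 ltW.
move=> [x y] _; have [N DN] := covD y.
apply: cvg_near_cst; exists N => // n /= Nn.
by rewrite /Fm indicE mem_set ?mulr1//; exact: mD DN.
Qed.

End ContinuousOnProduct.

Lemma integrable_indic_lty d (T : measurableType d) (R : realType)
    (m : {measure set T -> \bar R}) (A : set T) : measurable A ->
  (m A < +oo)%E -> m.-integrable setT (EFin \o (\1_A : T -> R)).
Proof.
move=> mA Af; apply/integrableP; split.
  by apply/measurable_EFinP; exact: measurable_indic.
rewrite (_ : (\int[m]_x _)%E = (\int[m]_x (\1_A x)%:E)%E).
  by rewrite integral_indic// setIT.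
by apply: eq_integral => x _ /=; rewrite ger0_norm// indicE.
Qed.

Section IntegralOfContinuous.
Context (R : realType) (Y : ptopologicalType) (m : {measure set (borel Y) -> \bar R}).

Lemma compact_support_integrable (C : set Y) (f : Y -> R) : compact C ->
  closed C -> (m C < +oo)%E -> continuous f -> (forall y, ~ C y -> f y = 0) ->
  m.-integrable setT (EFin \o (f : borel Y -> R)).
Proof.
move=> cC clC mC cf f0.
have mCs : measurable (C : set (borel Y)) by exact: borel_closed_measurable.
have mf : measurable_fun setT (f : borel Y -> R) by exact: borel_continuous_measurable.
have : m.-integrable C (EFin \o (f : borel Y -> R)).
  apply: measurable_bounded_integrable => //; first exact: measurable_funS mf.
  have : compact (f @` C).
    by apply: continuous_compact => //; exact: continuous_subspaceT.
  move=> /compact_bounded [M [Mr hM]]; exists M; split => // x Mx y Cy.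
  by apply: (hM x Mx); exists y.
rewrite integrable_mkcond//; congr (_.-integrable _ _); apply/funext => y.
by rewrite patchE /=; case: ifPn => // /negP; rewrite inE => /f0 ->.
Qed.

Lemma continuous_param_integral (X : ptopologicalType) (F : X * Y -> R)
    (C : set Y) (x : X) : compact C -> closed C -> (m C < +oo)%E ->
  continuous F -> (\forall x' \near x, forall y, ~ C y -> F (x', y) = 0) ->
  {for x, continuous (fun x' => \int[m]_y F (x', y))}.
Proof.
move=> cC clC mC cF F0.
have mCs : measurable (C : set (borel Y)) by exact: borel_closed_measurable.
have cFx (t : X) : continuous (fun y => F (t, y)) by exact: continuous_section.
have iF (t : X) : (forall y, ~ C y -> F (t, y) = 0) ->
    m.-integrable setT (EFin \o (fun y : borel Y => F (t, y))).
  by move=> h; exact: (compact_support_integrable cC).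
have F0x := nbhs_singleton F0.
have iFx := iF x F0x.
apply/cvgrPdist_le => e e0.
pose c := fine (m C) + 1.
have c0 : 0 < c by rewrite ltr_wpDl// fine_ge0.
have ec : 0 < e / c by rewrite divr_gt0.
apply: filterS2 F0 (compact_uniform_continuous x cC cF ec) => x' h1 h2.
rewrite -RintegralB//; last exact: iF.
have iB : m.-integrable setT (EFin \o (fun y : borel Y => F (x, y) - F (x', y))).
  have := integrableB measurableT iFx (iF x' h1).
  by under eq_fun do rewrite /= -EFinB.
apply: le_trans (le_normr_Rintegral measurableT iB) _.
have iC : m.-integrable setT (EFin \o (fun y : borel Y => (e / c) * \1_C y)).
  have /(integrableZl measurableT (e / c)) := integrable_indic_lty mCs mC.
  by under eq_fun do rewrite -EFinM.
apply: le_trans (le_Rintegral _ _ iC _) _ => //.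
- by have := integrable_abse iB.
- move=> y _; rewrite distrC indicE; have [Cy|nCy] := pselect (C y).
    by rewrite mem_set// mulr1; exact: h2.
  by rewrite memNset// mulr0 h1// F0x// subrr normr0.
- rewrite RintegralZl//; last exact: integrable_indic_lty.
  rewrite /Rintegral integral_indic// setIT mulrAC ler_pdivrMr//.
  by rewrite ler_pM2l// lerDl.
Qed.

End IntegralOfContinuous.

(** * Locally compact groups and Haar measure *)

Section GroupTopology.
Context (G : topGroupType).

Lemma continuousM_g (X : topologicalType) (f g : X -> G) : continuous f ->
  continuous g -> continuous (fun x => (f x * g x)%g).
Proof.
move=> cf cg x; apply: (cvg_comp (fun x => (f x, g x)) (fun p : G * G => (p.1 * p.2)%g));
  last exact: (@mulg_continuous G (f x, g x)).
by apply: cvg_pair; [exact: cf|exact: cg].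
Qed.

Lemma continuousV_g (X : topologicalType) (f : X -> G) : continuous f ->
  continuous (fun x => (f x)^-1%g).
Proof.
move=> cf x; apply: (cvg_comp f (fun x : G => x^-1%g)); first exact: cf.
exact: invg_continuous.
Qed.

Lemma lmul_continuous (a : G) : continuous (fun x : G => (a * x)%g).
Proof. by apply: continuousM_g => x; [exact: cvg_cst|exact: cvg_id]. Qed.

Lemma rmul_continuous (a : G) : continuous (fun x : G => (x * a)%g).
Proof. by apply: continuousM_g => x; [exact: cvg_id|exact: cvg_cst]. Qed.

Definition mulset (A B : set G) : set G := [set (p.1 * p.2)%g | p in A `*` B].

Lemma mulsetP (A B : set G) a b : A a -> B b -> mulset A B (a * b)%g.
Proof. by move=> Aa Bb; exists (a, b). Qed.

Lemma compact_mulset (A B : set G) : compact A -> compact B -> compact (mulset A B).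
Proof.
move=> cA cB; apply: continuous_compact; last exact: compact_setX.
by apply: continuous_subspaceT; exact: mulg_continuous.
Qed.

Lemma compact_inv (A : set G) : compact A -> compact [set x^-1%g | x in A].
Proof.
move=> cA; apply: continuous_compact => //.
by apply: continuous_subspaceT; exact: invg_continuous.
Qed.

Lemma open_mulset (A B : set G) : open B -> open (mulset A B).
Proof.
move=> oB; rewrite (_ : mulset A B = \bigcup_(a in A) ((fun x : G => (a^-1 * x)%g) @^-1` B)).
  apply: bigcup_open => a _; move/continuousP : (@lmul_continuous a^-1%g); exact.
apply/seteqP; split=> [_ [[a b] [/= Aa Bb] <-]|x [a Aa /= Bx]].
  by exists a => //=; rewrite mulKg.
by exists (a, (a^-1 * x)%g) => //=; rewrite mulVKg.
Qed.

Lemma open_mulset_r (A B : set G) : open A -> open (mulset A B).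
Proof.
move=> oA; rewrite (_ : mulset A B = \bigcup_(b in B) ((fun x : G => (x * b^-1)%g) @^-1` A)).
  apply: bigcup_open => b _; move/continuousP : (@rmul_continuous b^-1%g); exact.
apply/seteqP; split=> [_ [[a b] [/= Aa Bb] <-]|x [b Bb /= Ax]].
  by exists b => //=; rewrite mulgK.
by exists ((x * b^-1)%g, b) => //=; rewrite mulgVK.
Qed.

Hypothesis hG : hausdorff_space G.
Hypothesis lcG : locally_compact [set: G].

Lemma unit_compact_nbhs : exists U : set G, [/\ open U, U 1%g &
  exists2 D : set G, compact D & U `<=` D].
Proof.
have [D nD [cD _]] : compact_near (within setT (nbhs (1%g : G))) := @lcG 1%g I.
have {}nD : nbhs (1%g : G) D by move: nD; rewrite /within /=; apply: filterS => x; exact.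
exists (interior D); split; [exact: open_interior|exact: nD|].
by exists D => //; exact: interior_subset.
Qed.

(** Complete regularity separates points from closed sets; a finite sum of such
    functions, truncated at 1, separates a compact set. *)
Lemma compact_urysohn (R : realType) (C U : set G) : compact C -> open U ->
  C `<=` U -> exists c : G -> R, [/\ continuous c, forall x, 0 <= c x <= 1,
    forall x, C x -> c x = 1, forall x, ~ U x -> c x = 0 &
    exists2 D, compact D & forall x, ~ D x -> c x = 0].
Proof.
move=> cC oU CU; have [U0 [oU0 U01 [D0 cD0 UD0]]] := unit_compact_nbhs.
have crs := @locally_compact_completely_regular G R lcG hG.
have sep (x : G) : exists f : G -> R, C x -> [/\ continuous f, forall y, 0 <= f y,
    f x = 1, forall y, ~ U y -> f y = 0 &
    forall y, ~ mulset [set x] D0 y -> f y = 0].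
  have [Cx|] := pselect (C x); last by exists (fun=> 0).
  pose V := U `&` mulset [set x] U0.
  have oV : open V by apply: openI => //; exact: open_mulset.
  have Vx : V x by split; [exact: CU|exists (x, 1%g) => //=; rewrite mulg1].
  have ufs : uniform_separator [set x] (~` V).
    by apply: crs; [exact: open_closedC|exact].
  have /uniform_separatorP := ufs => /(_ R)[f [cf f01 fx0 fV1]].
  have fr y : 0 <= f y <= 1.
    by have := f01 (f y) (ex_intro2 _ _ y I erefl); rewrite /= in_itv.
  exists (fun y => 1 - f y) => _; split.
  - by move=> y; apply: cvgB; [exact: cvg_cst|exact: cf].
  - by move=> y; rewrite subr_ge0; case/andP: (fr y).
  - by rewrite (_ : f x = 0) ?subr0//; apply: fx0; exists x.
  - move=> y nUy; rewrite (_ : f y = 1) ?subrr//; apply: fV1; exists y => //.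
    by move=> [/nUy].
  - move=> y nDy; rewrite (_ : f y = 1) ?subrr//; apply: fV1; exists y => //.
    move=> [_ [[a b] [/= -> U0b] E]]; apply: nDy; rewrite -E.
    by apply: mulsetP => //; exact: UD0.
have [f fP] := choice sep.
have [s sC hs] : exists2 s : seq G, (forall x, x \in s -> C x) &
    forall y, C y -> exists2 x, x \in s & 2^-1 < f x y.
  have := cC; rewrite compact_cover =>
    /(_ G C (fun x => (f x) @^-1` `]2^-1, +oo[%classic)) [].
  - move=> x /fP [cf _ _ _ _]; move/continuousP : cf; apply.
    exact: interval_open.
  - move=> x Cx; exists x => //=; have [_ _ -> _ _] := fP x Cx.
    by rewrite in_itv/= andbT invf_lt1// ltr1n.
  move=> D DC cD; exists (finmap.enum_fset D) => [x xD|y /cD [x xD]].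
    by have := DC x xD; rewrite inE.
  by rewrite /= in_itv/= andbT => h; exists x.
pose g y := \sum_(x <- s) f x y.
have g0 y : 0 <= g y.
  by rewrite /g big_seq sumr_ge0// => x /sC/fP[].
have cg : continuous g.
  rewrite /g; elim: (s) sC => [|x t IH] tC y.
    by under eq_fun do rewrite big_nil; exact: cvg_cst.
  under eq_fun do rewrite big_cons.
  apply: cvgD.
    by have [cf _ _ _ _] := fP x (tC x (mem_head _ _)); exact: cf.
  by apply: IH => z zt; apply: tC; rewrite inE zt orbT.
exists (fun y => Num.min 1 (2 * g y)); split.
- have c2 : continuous (fun y => 2 * g y).
    by move=> y; apply: cvgM; [exact: cvg_cst|exact: cg].
  rewrite (_ : (fun y => _) = fun y => (1 + 2 * g y - `|1 - 2 * g y|) / 2).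
    move=> y; apply: cvgM; last exact: cvg_cst.
    apply: cvgB; first by apply: cvgD; [exact: cvg_cst|exact: c2].
    by apply: cvg_norm; apply: cvgB; [exact: cvg_cst|exact: c2].
  by apply/funext => y; rewrite minr_absE.
- by move=> y; rewrite le_min ge_min lexx ler01/= mulr_ge0.
- move=> y Cy; apply/min_idPl; have [x xs fx] := hs y Cy.
  rewrite -(@ler_pM2l _ 2^-1)// mulr1 mulrA mulVf// mul1r.
  apply: le_trans (ltW fx) _; rewrite /g (perm_big _ (perm_to_rem xs))/= big_cons lerDl.
  by rewrite big_seq sumr_ge0// => z /mem_rem/sC/fP[].
- move=> y nUy; rewrite /g big_seq big1 ?mulr0; first by apply/min_idPr.
  by move=> x /sC/fP[_ _ _ h _]; exact: h.
- exists (mulset [set x | x \in s] D0).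
    apply: compact_mulset => //.
    by apply: finite_compact; exact: finite_seq.
  move=> y nDy; rewrite /g big_seq big1 ?mulr0; first by apply/min_idPr.
  move=> x xs; have [_ _ _ _ h] := fP x (sC x xs); apply: h => -[[a b] [/= -> Db] E].
  by apply: nDy; rewrite -E; exact: mulsetP.
Qed.

End GroupTopology.

Section SigmaFinitePack.
Context d (T : measurableType d) (R : realType) (m : {measure set T -> \bar R}).
Hypothesis sf : sigma_finite setT m.

(** The measure m bundled with a proof that it is sigma-finite, as the theory
    of product measures expects it. *)
Definition sfpack : set T -> \bar R := let _ := sf in m.

HB.instance Definition _ := Measure.copy sfpack m.
HB.instance Definition _ := Measure_isSigmaFinite.Build _ _ _ sfpack sf.

End SigmaFinitePack.

Section Haar.
Context (R : realType) (G : topGroupType) (mu : {measure set (borel G) -> \bar R}).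
Hypotheses (hG : hausdorff_space G) (lcG : locally_compact [set: G]).
Hypothesis hmu : left_haar mu.

Lemma haar_compact (C : set G) : compact C -> (mu C < +oo)%E.
Proof. by case: hmu => -[h _ _] _ _; exact: h. Qed.

Lemma haar_left (a : G) : measure_preserving mu (fun x : borel G => (a * x)%g : borel G).
Proof.
split; first by apply: borel_map_measurable; exact: lmul_continuous.
by move=> A mA; case: hmu => _ _ /(_ a A mA).
Qed.

Lemma haar_translate (a : G) (A : set G) : measurable (A : set (borel G)) ->
  mu ((fun x => (a * x)%g) @^-1` A) = mu A.
Proof. by move=> mA; case: (haar_left a) => _ /(_ A mA). Qed.

(** A null open set would have null translates, hence all compact sets would be
    null. *)
Lemma haar_open_gt0 (U : set G) (x : G) : open U -> U x -> (0 < mu U)%E.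
Proof.
move=> oU Ux; rewrite lt0e measure_ge0 andbT; apply/eqP => U0.
have [_ mT0 _] := hmu; have [_ _ inner_reg] : radon_measure mu by case: hmu.
have [+ _] : mu setT = 0%E /\ True.
  split=> //; rewrite inner_reg; last exact: openT.
  apply/eqP; rewrite eq_le; apply/andP; split; last first.
    apply: ereal_sup_ubound; exists set0; last exact: measure0.
    by split => //; exact: compact0.
  apply: ge_ereal_sup => _ [C [cC _] <-].
  have := cC; rewrite compact_cover =>
    /(_ G setT (fun a : G => (fun y => (a * y)%g) @^-1` U)) [].
  - by move=> a _; move/continuousP : (@lmul_continuous _ a); exact.
  - by move=> y _; exists (x * y^-1)%g => //=; rewrite mulgVK.
  move=> D _ cD.
  have {cD} : C `<=` \big[setU/set0]_(a <- finmap.enum_fset D) ((fun y => (a * y)%g) @^-1` U).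
    by move=> y /cD [a aD /= Uay]; rewrite -bigcup_seq; exists a.
  move: (finmap.enum_fset D) => s Cs.
  have oU' a : measurable ((fun y => (a * y)%g) @^-1` U : set (borel G)).
    apply: borel_open_measurable.
    by move/continuousP : (@lmul_continuous _ a); exact.
  have s0 : mu (\big[setU/set0]_(a <- s) ((fun y => (a * y)%g) @^-1` U)) = 0%E.
    elim: s {Cs} => [|a s IH]; first by rewrite big_nil measure0.
    rewrite big_cons null_set_setU//.
    - exact: bigsetU_measurable.
    - by rewrite haar_translate//; exact: borel_open_measurable.
  rewrite -s0; apply: le_measure; rewrite ?inE//.
    by apply: borel_closed_measurable; exact: compact_closed.
  exact: bigsetU_measurable.
by move/eqP; rewrite (negbTE mT0).
Qed.

(** Otherwise f exceeds (f x) / 2 on an open set, which has positive measure. *)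
Lemma haar_integral_eq0 (f : G -> R) : continuous f -> (forall x, 0 <= f x) ->
  (\int[mu]_x (f x)%:E = 0)%E -> forall x, f x = 0.
Proof.
move=> cf f0 If x; apply/eqP; rewrite eq_le f0 andbT leNgt; apply/negP => fx.
pose e := f x / 2; have e0 : 0 < e by rewrite divr_gt0.
pose U := f @^-1` `]e, +oo[%classic.
have oU : open U by move/continuousP : cf; apply; exact: interval_open.
have Ux : U x by rewrite /U /= in_itv/= andbT /e ltr_pdivrMr// ltr_pMr// ltr1n.
have mU : measurable (U : set (borel G)) by exact: borel_open_measurable.
have muU := haar_open_gt0 oU Ux.
have mf : measurable_fun setT (f : borel G -> R) by exact: borel_continuous_measurable.
have : (e%:E * mu U <= \int[mu]_x (f x)%:E)%E.
  rewrite -[U]setIT -integral_indic// -ge0_integralZl_EFin ?(ltW e0)//.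
  - apply: ge0_le_integral => //.
    + by move=> y _; rewrite lee_fin mulr_ge0// ltW.
    + by apply/measurable_EFinP/measurable_funM => //; exact: measurable_indic.
    + exact/measurable_EFinP.
    + move=> y _; rewrite lee_fin indicE; have [Uy|nUy] := pselect (U y).
        by rewrite mem_set// mulr1; move: Uy; rewrite /U /= in_itv/= andbT => /ltW.
      by rewrite memNset// mulr0.
  - exact/measurable_EFinP/measurable_indic.
by rewrite If leNgt mule_gt0.
Qed.

Section CompactSubgroup.
Variable K : set G.
Hypothesis hK : compact_subgroup K.

Let cK : compact K. Proof. by case: hK. Qed.
Let K1 : K 1%g. Proof. by case: hK. Qed.
Let KM x y : K x -> K y -> K (x * y)%g. Proof. by case: hK => _ _ h _; exact: h. Qed.
Let KV x : K x -> K (x^-1)%g. Proof. by case: hK => _ _ _ h; exact: h. Qed.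

Definition biinvariant_set (A : set G) :=
  forall k k' x, K k -> K k' -> A (k * x * k')%g <-> A x.

Definition double_coset (A : set G) := mulset (mulset K A) K.

Lemma double_cosetP (A : set G) x : double_coset A x <->
  exists k a k', [/\ K k, A a, K k' & x = (k * a * k')%g].
Proof.
split=> [[[_ k'] [/= [[k a] [/= Kk Aa] <-] Kk'] <-]|[k [a [k' [Kk Aa Kk' ->]]]]].
  by exists k, a, k'.
by apply: mulsetP => //; exact: mulsetP.
Qed.

Lemma double_coset_biinvariant (A : set G) : biinvariant_set (double_coset A).
Proof.
move=> k k' x Kk Kk'; rewrite !double_cosetP; split=> -[l [a [l' [Kl Aa Kl' E]]]].
  exists (k^-1 * l)%g, a, (l' * k'^-1)%g; split; rewrite ?KM ?KV//.
    by apply: KM => //; exact: KV.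
    by apply: KM => //; exact: KV.
  by rewrite -!mulgA !mulgA -[(_ * l * _ * _)%g]mulgA -!mulgA [(l * _)%g]mulgA
    [(l * _ * _)%g]mulgA -E -!mulgA mulKg mulgV mulg1.
exists (k * l)%g, a, (l' * k')%g; split => //; try exact: KM.
by rewrite E !mulgA.
Qed.

Lemma sub_double_coset (A : set G) : A `<=` double_coset A.
Proof. by move=> x Ax; apply/double_cosetP; exists 1%g, x, 1%g; split; rewrite ?mul1g ?mulg1. Qed.

Lemma compact_double_coset (A : set G) : compact A -> compact (double_coset A).
Proof. by move=> cA; do 2 apply: compact_mulset => //. Qed.

Lemma open_double_coset (A : set G) : open A -> open (double_coset A).
Proof. by move=> oA; apply: open_mulset_r; exact: open_mulset. Qed.

Lemma crestrict_biinvariant_L2K (A : set G) : biinvariant_set A ->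
  measurable (A : set (borel G)) -> (mu A < +oo)%E ->
  L2K mu K (crestrict A (fun=> 1)).
Proof.
move=> bA mA fA; split.
  apply: (inL2_le (g := fun x : borel G => (\1_(A : set (borel G)) x)%:E)).
  - by apply: (cmeas_crestrict mA); exact: cmeas_cst.
  - by apply/measurable_EFinP; exact: measurable_indic.
  - move=> x; rewrite lee_fin /crestrict indicE; case: ifP => _.
      by rewrite Normc.normc1 expr1n.
    by rewrite Normc.normc0 expr0n.
  - by rewrite integral_indic// setIT.
move=> k k' Kk Kk'; apply: aeW => x; rewrite /crestrict.
have [Ax|nAx] := pselect (A x).
  by rewrite !mem_set//; exact/(bA k k' x Kk Kk').
by rewrite !memNset// => /(bA k k' x Kk Kk').
Qed.

(** The indicators of disjoint sets K g U K, with U relatively compact, are far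
    apart in L^2(G//K). So countably many of these sets meet all the others,
    and every g lies in one of countably many compact sets. *)
Lemma separable_sigma_compact : hseparable (L2K mu K) (L2inner mu) ->
  exists B : nat -> set G, (forall n, compact (B n)) /\ forall x, exists n, B n x.
Proof.
move=> [D [HD dD]]; have [U [oU U1 [Q cQ UQ]]] := unit_compact_nbhs lcG.
pose A g := double_coset (mulset [set g] U).
have oA g : open (A g) by apply: open_double_coset; exact: open_mulset.
have mA g : measurable (A g : set (borel G)) by exact: borel_open_measurable.
have AQ g : A g `<=` double_coset (mulset [set g] Q).
  move=> x /double_cosetP[k [_ [k' [Kk [[a u] [/= -> Uu] <-] Kk' ->]]]].
  by apply/double_cosetP; exists k, (g * u)%g, k'; split => //; apply: mulsetP => //; exact: UQ.
have cAQ g : compact (double_coset (mulset [set g] Q)).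
  by apply: compact_double_coset; apply: compact_mulset => //; exact: compact_set1.
have fA g : (mu (A g) < +oo)%E.
  apply: le_lt_trans (haar_compact (cAQ g)); apply: le_measure => //; rewrite ?inE//.
  by apply: borel_closed_measurable; exact: compact_closed.
have pA g : (0 < mu (A g))%E.
  apply: (haar_open_gt0 (oA g) (x := g)); apply: sub_double_coset.
  by exists (g, 1%g) => //=; rewrite mulg1.
pose f g : G -> R[i] := crestrict (A g) (fun=> 1).
have Lf g : L2K mu K (f g).
  by apply: crestrict_biinvariant_L2K => //; exact: double_coset_biinvariant.
have sf := sesqui_inner mu.
have Lf2 g : inL2 mu setT (f g : borel G -> R[i]) by case: (Lf g).
have nf g : hnorm (L2inner mu) (f g) ^+ 2 = fine (mu (A g)).
  apply: EFin_inj; rewrite fineK ?ge0_fin_numE//.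
  rewrite -(L2norm_sqE (Lf2 g)) -[A g in RHS]setIT -integral_indic//.
  apply: eq_integral => x _; rewrite /f /crestrict indicE; case: ifP => _.
    by rewrite Normc.normc1 expr1n.
  by rewrite Normc.normc0 expr0n.
have nf0 g : 0 < hnorm (L2inner mu) (f g).
  rewrite lt_neqAle hnorm_ge0 andbT eq_sym -sqrf_eq0 nf gt_eqF// fine_gt0//.
  by rewrite pA fA.
pose P n := [set g | hnorm (L2inner mu) (f g - D n) < hnorm (L2inner mu) (f g) / 2].
pose r n := xget 1%g (P n).
exists (fun n => mulset (double_coset (mulset [set r n] Q)) (mulset K [set x^-1%g | x in mulset Q K])).
split=> [n|g].
  apply: compact_mulset => //; apply: compact_mulset => //.
  by apply: compact_inv; exact: compact_mulset.
have [n hn] : exists n, P n g by apply: (dD _ (Lf g)); rewrite divr_gt0.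
exists n; have hr : P n (r n) by exact: (xgetI 1%g hn).
have LD : inL2 mu setT (D n : borel G -> R[i]) by case: (HD n).
have [x [Ax Axr]] : exists x, A g x /\ A (r n) x.
  apply: contrapT => nx.
  have orth : L2inner mu (f g) (f (r n)) = 0.
    rewrite /L2inner /inner (_ : (fun x => _) = cst 0).
      by apply: complex_eqP; rewrite /= Rintegral_cst// mul0r.
    apply/funext => x /=; rewrite /f /crestrict.
    case: ifPn => [|_]; last by rewrite mul0r.
    rewrite inE => Ax; rewrite memNset ?conjC0 ?mulr0// => Axr.
    by apply: nx; exists x.
  have E := nrm2B sf (Lf2 g) (Lf2 (r n)).
  have h1 := hnorm_dist sf (Lf2 g) LD (Lf2 (r n)).
  rewrite (hnormBC sf LD (Lf2 (r n))) in h1.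
  have E' : hnorm (L2inner mu) (f g - f (r n)) ^+ 2 =
     hnorm (L2inner mu) (f g) ^+ 2 + hnorm (L2inner mu) (f (r n)) ^+ 2.
    rewrite !(hnorm_sqr sf)//; last exact: (sfB sf).
    by rewrite -/(L2inner mu) in E; rewrite E -/(L2inner mu) orth /=; lra.
  have h0 := hnorm_ge0 (L2inner mu) (f g - f (r n)).
  move: hn hr h1 E' h0 (nf0 g) (nf0 (r n)); rewrite /P /=.
  move: (hnorm _ (f g - D n)) (hnorm _ (f (r n) - D n)) (hnorm _ (f g - f (r n))).
  move: (hnorm _ (f g)) (hnorm _ (f (r n))) => a b p q t hp hq ht E' t0 a0 b0.
  clear E orth.
  have : t ^+ 2 < (a / 2 + b / 2) ^+ 2.
    by rewrite ltr_pXn2r ?nnegrE//; lra.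
  rewrite E'; have := sqr_ge0 (a - b); nra.
move: Ax => /double_cosetP[k [_ [k' [Kk [[a u] [/= -> Uu] <-] Kk' xE]]]].
have gE : g = (k^-1 * x * (k'^-1 * u^-1))%g.
  by rewrite xE -!mulgA mulKg mulVKg mulgV mulg1.
rewrite gE; have -> : (k^-1 * x * (k'^-1 * u^-1) = k^-1 * x * 1 * (1 * (u * k')^-1))%g.
  by rewrite mulg1 mul1g invgM.
apply: mulsetP.
  by apply/(@double_coset_biinvariant _ _ _ _ (KV Kk) K1); exact: AQ.
apply: mulsetP => //; exists (u * k')%g => //; apply: mulsetP => //; exact: UQ.
Qed.

(** The sets K B Q K, where Q is a compact neighbourhood of the unit and B runs
    through finite unions of the compact sets covering G: they contain the open
    sets K B U K, which cover G, so a compact set lies in one of them. *)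
Lemma biinvariant_exhaustion : hseparable (L2K mu K) (L2inner mu) ->
  exists C : nat -> set G, [/\ exhaustion C, forall n, biinvariant_set (C n) &
    forall Q, compact Q -> exists n, Q `<=` C n].
Proof.
move=> /separable_sigma_compact[B [cB covB]].
have [U [oU U1 [Q cQ UQ]]] := unit_compact_nbhs lcG.
pose B' n := \big[setU/set0]_(i < n.+1) B i.
have cB' n : compact (B' n) by apply: bigsetU_compact.
have B'mono m n : (m <= n)%N -> B' m `<=` B' n.
  by move=> mn x; rewrite /B' -!bigcup_mkord => -[i /= im Bx]; exists i => //=; exact: (leq_trans im (mn : (m.+1 <= n.+1)%N)).
pose C n := double_coset (mulset (B' n) Q).
pose O n := double_coset (mulset (B' n) U).
have cC n : compact (C n) by apply: compact_double_coset; exact: compact_mulset.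
have mono (V : set G) m n : (m <= n)%N ->
    double_coset (mulset (B' m) V) `<=` double_coset (mulset (B' n) V).
  move=> mn x /double_cosetP[k [_ [k' [Kk [[a u] [/= Ba Vu] <-] Kk' ->]]]].
  apply/double_cosetP; exists k, (a * u)%g, k'; split => //.
  by apply: mulsetP => //; exact: B'mono Ba.
have OC n : O n `<=` C n.
  move=> x /double_cosetP[k [_ [k' [Kk [[a u] [/= Ba Vu] <-] Kk' ->]]]].
  apply/double_cosetP; exists k, (a * u)%g, k'; split => //.
  by apply: mulsetP => //; exact: UQ.
have covO x : exists n, O n x.
  have [n Bx] := covB x; exists n; apply: sub_double_coset.
  exists (x, 1%g) => /=; last by rewrite mulg1.
  split => //; by rewrite /B' -bigcup_mkord; exists n => /=.
exists C; split.
- split => //.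
  + by move=> n; exact: compact_closed.
  + by move=> m n mn; exact: mono.
  + by move=> x; have [n /OC] := covO x; exists n.
- by move=> n; exact: double_coset_biinvariant.
- move=> Q' cQ'; have := cQ'; rewrite compact_cover => /(_ nat setT O) [].
  + by move=> n _; apply: open_double_coset; exact: open_mulset.
  + by move=> x _; have [n On] := covO x; exists n.
  move=> D _ cD; exists (\max_(i <- finmap.enum_fset D) i)%N => x /cD[n nD On].
  by apply: OC; apply: mono On; exact: (leq_bigmax_seq (F := id)).
Qed.

End CompactSubgroup.

End Haar.

(** * The modular function *)

Section ComplexTopology.
Context (R : realType).

Lemma normrC (z : R[i]) : `|z : R[i]^o| = (normc z)%:C.
Proof. by case: z. Qed.

Lemma continuous_Re (X : topologicalType) (f : X -> R[i]^o) :
  continuous f -> continuous (fun x => Re (f x)).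
Proof.
move=> cf x; apply/cvgrPdist_lt => e e0.
have ec0 : 0 < e%:C :> R[i] by rewrite ltcR.
have /cvgrPdist_lt/(_ _ ec0) := cf x; apply: filterS => y.
rewrite normrC ltcR; apply: le_lt_trans.
by rewrite -ReB normr_Re_le.
Qed.

Lemma continuous_Im (X : topologicalType) (f : X -> R[i]^o) :
  continuous f -> continuous (fun x => Im (f x)).
Proof.
move=> cf x; apply/cvgrPdist_lt => e e0.
have ec0 : 0 < e%:C :> R[i] by rewrite ltcR.
have /cvgrPdist_lt/(_ _ ec0) := cf x; apply: filterS => y.
rewrite normrC ltcR; apply: le_lt_trans.
by rewrite -ImB normr_Im_le.
Qed.

Lemma continuous_ReIm (X : topologicalType) (f g : X -> R) :
  continuous f -> continuous g -> continuous ((fun x => f x +i* g x) : X -> R[i]^o).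
Proof.
move=> cf cg x; apply/cvgrPdist_lt => e e0.
have [eE er0] : e = (Re e)%:C /\ 0 < Re e.
  by move: e0; rewrite ltcE => /andP[/eqP/= h0 h1]; split=> //; exact: complex_eqP.
have e20 : 0 < Re e / 2 by rewrite divr_gt0.
have /cvgrPdist_lt/(_ _ e20) h1 := cf x; have /cvgrPdist_lt/(_ _ e20) h2 := cg x.
apply: filterS2 h1 h2 => y /= h1 h2; rewrite eE normrC ltcR.
apply: le_lt_trans (normc_le_ReIm _) _; rewrite ReB ImB /= [ltRHS]splitr.
exact: ltrD.
Qed.

Lemma continuous_normc (X : topologicalType) (f : X -> R[i]^o) :
  continuous f -> continuous (fun x => normc (f x)).
Proof.
move=> cf x; apply/cvgrPdist_lt => e e0.
have ec0 : 0 < e%:C :> R[i] by rewrite ltcR.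
have /cvgrPdist_lt/(_ _ ec0) := cf x; apply: filterS => y.
rewrite normrC ltcR; apply: le_lt_trans; rewrite ler_norml.
apply/andP; split.
  rewrite lerBrDl lerBlDr -[leLHS](_ : normc (f x - (f x - f y)) = _); last first.
    by congr normc; ring.
  by apply: le_trans (le_normcD _ _) _; rewrite normcN addrC.
rewrite lerBlDr -[leLHS](_ : normc ((f x - f y) + f y) = _); last first.
  by congr normc; ring.
exact: le_normcD.
Qed.

End ComplexTopology.

Lemma tonelli d1 d2 (T1 : measurableType d1) (T2 : measurableType d2)
    (R : realType) (m1 : {measure set T1 -> \bar R}) (m2 : {measure set T2 -> \bar R})
    (f : T1 * T2 -> \bar R) : sigma_finite setT m1 -> sigma_finite setT m2 ->
  measurable_fun setT f -> (forall z, 0 <= f z)%E ->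
  (\int[m1]_x \int[m2]_y f (x, y) = \int[m2]_y \int[m1]_x f (x, y))%E.
Proof.
move=> s1 s2 mf f0; exact: (@fubini_tonelli _ _ _ _ _ (sfpack s1) (sfpack s2) f).
Qed.

Section Unimodular.
Context (R : realType) (G : topGroupType) (mu : {measure set (borel G) -> \bar R}).
Hypotheses (hG : hausdorff_space G) (lcG : locally_compact [set: G]).
Hypothesis hmu : left_haar mu.
Variable C : nat -> set G.
Hypothesis eC : exhaustion C.

Lemma haar_sigma_finite : sigma_finite setT mu.
Proof.
have [cC clC _ covC] := eC; exists C.
  by apply/seteqP; split=> x // _; have [n Cx] := covC x; exists n.
move=> n; split; first exact: borel_closed_measurable.
exact: haar_compact.
Qed.

(** The nonnegative functions of Cc(G). *)
Definition cc (f : G -> R) := [/\ continuous f, forall x, 0 <= f x &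
  exists2 D, compact D & forall x, ~ D x -> f x = 0].

Lemma cc_integrable f : cc f -> mu.-integrable setT (EFin \o (f : borel G -> R)).
Proof.
move=> [cf _ [D cD fD]]; apply: (compact_support_integrable cD) => //.
  exact: compact_closed.
exact: haar_compact.
Qed.

Lemma cc_meas f : cc f -> measurable_fun setT (f : borel G -> R).
Proof. by move=> [cf _ _]; exact: borel_continuous_measurable. Qed.

Lemma cc_inv f : cc f -> cc (fun x => f (x^-1)%g).
Proof.
move=> [cf f0 [D cD fD]]; split => //.
  move=> x; apply: (cvg_comp (fun x : G => x^-1%g) f); last exact: cf.
  exact: invg_continuous.
exists [set x^-1%g | x in D]; first exact: compact_inv.
by move=> x nDx; apply: fD => Dx; apply: nDx; exists x^-1%g => //; exact: invgK.
Qed.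

Lemma cc_lmul f a : cc f -> cc (fun x => f (a * x)%g).
Proof.
move=> [cf f0 [D cD fD]]; split => //.
  move=> x; apply: (cvg_comp (fun x : G => (a * x)%g) f); last exact: cf.
  exact: lmul_continuous.
exists (mulset [set (a^-1)%g] D); first by apply: compact_mulset => //; exact: compact_set1.
move=> x nDx; apply: fD => Dx; apply: nDx.
by exists (a^-1, a * x)%g => //=; rewrite mulKg.
Qed.

Lemma cc_mul (f h : G -> R) : cc f -> continuous h -> (forall x, 0 <= h x) ->
  cc (fun x => f x * h x).
Proof.
move=> [cf f0 [D cD fD]] ch h0; split.
- by move=> x; apply: cvgM; [exact: cf|exact: ch].
- by move=> x; rewrite mulr_ge0.
- by exists D => // x /fD ->; rewrite mul0r.
Qed.

Lemma continuous_comp_inv (f : G -> R) : continuous f -> continuous (fun x : G => f (x^-1)%g).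
Proof.
move=> cf x; apply: (cvg_comp (fun x : G => x^-1%g) f); last exact: cf.
exact: invg_continuous.
Qed.

Lemma cc_at (z : G) : exists2 chi, cc chi & chi z = 1.
Proof.
have cz : compact [set z] by exact: compact_set1.
have [c [cc1 c01 c1 _ cD]] := compact_urysohn hG lcG R cz openT (fun _ _ => I).
exists c; last exact: c1.
by split => // x; case/andP: (c01 x).
Qed.

(** The integral of g for the right Haar measure. *)
Definition invint (g : G -> R) := \int[mu]_x g (x^-1)%g.
(** The right Haar integral of a left translate of g. Divided by invint g, if
    this is nonzero, it is the modular function of G or its inverse at z. *)
Definition modular (g : G -> R) (z : G) := \int[mu]_x g (z * x^-1)%g.

Lemma modularE g z : modular g z = invint (fun x => g (z * x)%g).
Proof. by []. Qed.

Lemma efine_cc f : cc f -> (\int[mu]_x (f x)%:E = (\int[mu]_x f x)%:E)%E.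
Proof. by move=> h; rewrite /Rintegral fineK//; apply: integrable_fin_num => //; exact: cc_integrable. Qed.

Lemma modular_continuous g : cc g -> continuous (modular g).
Proof.
move=> [cg g0 [D cD gD]] z.
have [U [oU U1 [Q cQ UQ]]] := unit_compact_nbhs lcG.
pose V := mulset [set y^-1%g | y in D] (mulset [set z] Q).
have cV : compact V.
  apply: compact_mulset; first exact: compact_inv.
  by apply: compact_mulset => //; exact: compact_set1.
apply: (@continuous_param_integral R G mu G (fun p => g (p.1 * p.2^-1)%g) V z) => //.
- exact: compact_closed.
- exact: haar_compact.
- move=> p; apply: (cvg_comp (fun p : G * G => (p.1 * p.2^-1)%g) g); last exact: cg.
  apply: (continuousM_g (X := (G * G)%type)); first by move=> q; exact: cvg_fst.
  apply: (continuousV_g (X := (G * G)%type)) => q; exact: cvg_snd.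
- have : nbhs z (mulset [set z] U).
    apply: open_nbhs_nbhs; split; first exact: open_mulset.
    by exists (z, 1%g) => //=; rewrite mulg1.
  apply: filterS => y Uy x nVx; apply: gD => Dyx; apply: nVx.
  have -> : x = ((y * x^-1)^-1 * y)%g by rewrite invgM invgK mulgVK.
  apply: mulsetP; first by exists (y * x^-1)%g.
  case: Uy => -[a u] [/= -> Uu] <-; apply: mulsetP => //; exact: UQ.
Qed.

Lemma modular_ge0 g z : cc g -> 0 <= modular g z.
Proof. by move=> [_ g0 _]; apply: Rintegral_ge0. Qed.

(** Left invariance turns f(x) g(y^-1) into f(y^-1 x) g(y^-1), and then, in the
    other variable, into f(y^-1) g(y^-1 x^-1). *)
Lemma haar_swap f g : cc f -> cc g ->
  (\int[mu]_x f x) * invint g = \int[mu]_y (f (y^-1)%g * modular g (y^-1)%g).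
Proof.
move=> hf hg; have [cf f0 _] := hf; have [cg g0 _] := hg.
have hfi := cc_inv hf; have hgi := cc_inv hg.
have sfm := haar_sigma_finite.
have hgz z : cc (fun x => g (z * x^-1)%g) := cc_inv (cc_lmul z hg).
have cD := modular_continuous hg.
have hfD : cc (fun y => f (y^-1)%g * modular g (y^-1)%g).
  by apply: (cc_inv (f := fun y => f y * modular g y)); apply: cc_mul => // x; exact: modular_ge0.
apply: EFin_inj; rewrite EFinM -!efine_cc//.
have cont (h : G * G -> G) (k : G -> R) : continuous h -> continuous k ->
    continuous (fun p => k (h p)).
  by move=> ch ck p; apply: (cvg_comp h k); [exact: ch|exact: ck].
have c1 : continuous (fun p : G * G => p.1) by move=> p; exact: cvg_fst.
have c2 : continuous (fun p : G * G => p.2) by move=> p; exact: cvg_snd.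
have mprod (h k : G * G -> G) (a b : G -> R) : continuous h -> continuous k ->
    continuous a -> continuous b ->
    measurable_fun setT ((fun p : borel G * borel G => (a (h p) * b (k p))%:E)).
  move=> ch ck ca cb; apply/measurable_EFinP.
  apply: (@continuous_prod_measurable R G G (fun p => a (h p) * b (k p)) C C) => //.
  by move=> p; apply: cvgM; apply: cont.
transitivity (\int[mu]_y \int[mu]_x (f (y^-1 * x)%g * g (y^-1)%g)%:E)%E.
  rewrite -ge0_integralZl//; last 3 first.
  - by apply/measurable_EFinP; exact: cc_meas hgi.
  - by move=> y _; rewrite lee_fin.
  - by apply: integral_ge0 => x _; rewrite lee_fin.
  apply: eq_integral => y _; under [RHS]eq_integral do rewrite EFinM.
  rewrite ge0_integralZr//; last 3 first.
  - by apply/measurable_EFinP; exact: cc_meas (cc_lmul _ hf).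
  - by move=> x _; rewrite lee_fin.
  - by rewrite lee_fin.
  congr (_ * _)%E; rewrite (mp_ge0_integral (haar_left hmu _) (f := fun x => (f x)%:E))//.
  by apply/measurable_EFinP; exact: cc_meas hf.
rewrite (tonelli sfm sfm (f := fun p : borel G * borel G => (f ((p.1 : G)^-1 * (p.2 : G))%g * g ((p.1 : G)^-1)%g)%:E)); last 2 first.
- apply: mprod => //; last exact: continuousV_g.
  by apply: continuousM_g => //; exact: continuousV_g.
- by move=> z; rewrite lee_fin mulr_ge0.
transitivity (\int[mu]_x \int[mu]_y (f (y^-1)%g * g (y^-1 * x^-1)%g)%:E)%E.
  apply: eq_integral => x _ /=.
  rewrite -(mp_ge0_integral (haar_left hmu x) (f := fun y => (f (y^-1 * x)%g * g (y^-1)%g)%:E)).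
  - by apply: eq_integral => y _; rewrite invgM mulgVK.
  - apply/measurable_EFinP; apply: borel_continuous_measurable => y; apply: cvgM.
      apply: (cvg_comp (fun y : G => (y^-1 * x)%g) f); last exact: cf.
      apply: (continuousM_g (X := G)); first exact: (@invg_continuous G).
      by move=> ?; exact: cvg_cst.
    exact: continuous_comp_inv.
  - by move=> y; rewrite lee_fin mulr_ge0.
rewrite (tonelli sfm sfm (f := fun p : borel G * borel G => (f ((p.2 : G)^-1)%g * g ((p.2 : G)^-1 * (p.1 : G)^-1)%g)%:E)); last 2 first.
- apply: mprod => //; first exact: continuousV_g.
  by apply: continuousM_g; exact: continuousV_g.
- by move=> z; rewrite lee_fin mulr_ge0.
apply: eq_integral => y _ /=; under eq_integral do rewrite EFinM.
rewrite ge0_integralZl//.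
- by rewrite EFinM (efine_cc (hgz _)).
- by apply/measurable_EFinP; exact: cc_meas (hgz _).
- by move=> x _; rewrite lee_fin.
- by rewrite lee_fin.
Qed.

(** Testing h against chi h^+ shows that h is nonpositive where chi is positive. *)
Lemma test_le0 (h chi : G -> R) (z : G) : continuous h -> cc chi -> 0 < chi z ->
  \int[mu]_y (chi (y^-1)%g * Num.max (h (y^-1)%g) 0 * h (y^-1)%g) = 0 -> h z <= 0.
Proof.
move=> ch hchi chiz I0; have [_ chi0 _] := hchi.
pose p y := chi y * Num.max (h y) 0 ^+ 2.
have pE y : chi y * Num.max (h y) 0 * h y = p y.
  rewrite /p -mulrA; congr (_ * _); rewrite expr2; case: (leP (h y) 0) => hy.
    by rewrite !mul0r.
  by [].
have cp : cc p.
  apply: cc_mul => //; last by move=> y; exact: sqr_ge0.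
  have cm : continuous (fun y => Num.max (h y) 0).
    move=> y; apply: continuous_max; [exact: ch|exact: cvg_cst].
  rewrite (_ : (fun y => _) = fun y => Num.max (h y) 0 * Num.max (h y) 0).
    by move=> y; apply: cvgM; exact: cm.
  by apply/funext => y; rewrite expr2.
have cpi := cc_inv cp.
have : (\int[mu]_y (p (y^-1)%g)%:E = 0)%E.
  by rewrite (efine_cc cpi); congr (_%:E); rewrite -[RHS]I0; apply: eq_Rintegral => y _; rewrite pE.
have [c1 c2 _] := cpi; move=> /(haar_integral_eq0 hG hmu c1 c2)/(_ z^-1%g).
rewrite invgK /p => /eqP; rewrite mulf_eq0 (gt_eqF chiz)/= sqrf_eq0.
by case: (leP (h z) 0) => // hz; rewrite (gt_eqF hz).
Qed.

Lemma invint_gt0 g z : cc g -> 0 < g z -> 0 < invint g.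
Proof.
move=> hg gz; rewrite lt_neqAle eq_sym; apply/andP; split; last first.
  by apply: Rintegral_ge0 => x _; case: hg.
apply/eqP => I0; have hgi := cc_inv hg; have [c1 c2 _] := hgi.
have : (\int[mu]_x (g (x^-1)%g)%:E = 0)%E by rewrite (efine_cc hgi) -/(invint g) I0.
move=> /(haar_integral_eq0 hG hmu c1 c2)/(_ z^-1%g); rewrite invgK => g0.
by rewrite g0 ltxx in gz.
Qed.

Lemma cc_max (h : G -> R) : continuous h -> continuous (fun y => Num.max (h y) 0).
Proof. by move=> ch y; apply: continuous_max; [exact: ch|exact: cvg_cst]. Qed.

(** By haar_swap, modular g * invint g' and modular g' * invint g have the same
    integral against every x |-> f (x^-1), f in Cc(G). *)
Lemma modular_ratio_le g g' z : cc g -> cc g' ->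
  modular g z * invint g' <= modular g' z * invint g.
Proof.
move=> hg hg'; rewrite -subr_le0.
have cg := modular_continuous hg; have cg' := modular_continuous hg'.
pose h y := modular g y * invint g' - modular g' y * invint g.
have ch : continuous h.
  by move=> y; apply: cvgB; apply: cvgM; [exact: cg|exact: cvg_cst|exact: cg'|exact: cvg_cst].
have [chi hchi chi1] := cc_at z.
apply: (@test_le0 h chi z) => //; first by rewrite chi1.
pose f y := chi y * Num.max (h y) 0.
have hf : cc f.
  by apply: cc_mul => //; [exact: cc_max|move=> y; rewrite le_max lexx orbT].
have hfg k : cc k -> cc (fun y => f (y^-1)%g * modular k (y^-1)%g).
  move=> hk; apply: (cc_inv (f := fun y => f y * modular k y)); apply: cc_mul => //.
    exact: modular_continuous.
  by move=> x; exact: modular_ge0.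
have E1 := haar_swap hf hg; have E2 := haar_swap hf hg'.
have i1 := cc_integrable (hfg _ hg); have i2 := cc_integrable (hfg _ hg').
transitivity (\int[mu]_y (invint g' * (f (y^-1)%g * modular g (y^-1)%g) -
    invint g * (f (y^-1)%g * modular g' (y^-1)%g))).
  by apply: eq_Rintegral => y _; rewrite -/(f _) /h; ring.
rewrite RintegralB//; last 2 first.
- exact: (integrableZl measurableT (invint g') i1).
- exact: (integrableZl measurableT (invint g) i2).
by rewrite !RintegralZl// -E1 -E2; ring.
Qed.

Lemma modular_ratio g g' z : cc g -> cc g' ->
  modular g z * invint g' = modular g' z * invint g.
Proof. by move=> hg hg'; apply/eqP; rewrite eq_le !modular_ratio_le. Qed.

(** The ratio modular g / invint g does not change when g is replaced by its
    translate by y. *)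
Lemma modularM g y z : cc g ->
  modular g (y * z)%g * invint g = modular g y * modular g z.
Proof.
move=> hg; have := modular_ratio z (cc_lmul y hg) hg.
rewrite -modularE => E; rewrite [RHS]mulrC -E.
by congr (_ * _); apply: eq_Rintegral => x _; rewrite mulgA.
Qed.

End Unimodular.

(** * Unimodularity of Gelfand pairs *)

Section GelfandUnimodular.
Context (R : realType) (G : topGroupType) (mu : {measure set (borel G) -> \bar R}).
Variable K : set G.
Hypotheses (hG : hausdorff_space G) (lcG : locally_compact [set: G]).
Hypotheses (hmu : left_haar mu) (hK : compact_subgroup K).
Variable C : nat -> set G.
Hypothesis eC : exhaustion C.

Let cK : compact K. Proof. by case: hK. Qed.
Let K1 : K 1%g. Proof. by case: hK. Qed.
Let KM x y : K x -> K y -> K (x * y)%g. Proof. by case: hK => _ _ h _; exact: h. Qed.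
Let KV x : K x -> K (x^-1)%g. Proof. by case: hK => _ _ _ h; exact: h. Qed.

Definition biinvariant_fun (T : Type) (f : G -> T) :=
  forall k k' x, K k -> K k' -> f (k * x * k')%g = f x.

(** The supremum over k, k' in K of c (k x k'), with c a Urysohn function, is
    continuous because c (k x k') is continuous in x uniformly in k, k'. *)
Lemma biinvariant_cutoff (Q : set G) : compact Q -> exists c : G -> R,
  [/\ cc c, biinvariant_fun c, forall x, c x <= 1 & forall x, Q x -> c x = 1].
Proof.
move=> cQ; have [c [cc0 c01 c1 _ [D cD c0]]] :=
  compact_urysohn hG lcG R (compact_double_coset hK cQ) openT (fun _ _ => I).
pose S x := [set c (p.1 * x * p.2)%g | p in K `*` K].
have S0 x : S x !=set0 by exists (c (1 * x * 1)%g), (1%g, 1%g).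
have Sub x : ubound (S x) 1 by move=> _ [[k k'] _ <-]; case/andP: (c01 (k * x * k')%g).
have Ssup x : has_sup (S x) by split; [exact: S0|exists 1; exact: Sub].
have Sle x k k' : K k -> K k' -> c (k * x * k')%g <= sup (S x).
  by move=> Kk Kk'; apply: sup_upper_bound => //; exists (k, k').
have supS x : c x <= sup (S x).
  by rewrite -[X in c X <= _]mul1g -[X in c X <= _]mulg1; exact: Sle.
exists (fun x => sup (S x)); split; [split| | |].
- move=> x; apply/cvgrPdist_le => e e0.
  have KK : compact (K `*` K) by exact: compact_setX.
  have cF : continuous (fun p : G * (G * G) => c (p.2.1 * p.1 * p.2.2)%g).
    move=> p; apply: (cvg_comp (fun p : G * (G * G) => (p.2.1 * p.1 * p.2.2)%g) c);
      last exact: cc0.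
    apply: (continuousM_g (X := (G * (G * G))%type)) => [|q]; last first.
      by apply: (cvg_comp snd snd); exact: cvg_snd.
    apply: (continuousM_g (X := (G * (G * G))%type)) => q; last exact: cvg_fst.
    by apply: (cvg_comp snd fst); [exact: cvg_snd|exact: cvg_fst].
  have := @compact_uniform_continuous R G (G * G)%type _ _ x e KK cF e0.
  apply: filterS => y /= h.
  have le (a b : G) : (forall k k', K k -> K k' ->
      c (k * a * k')%g <= c (k * b * k')%g + e) -> sup (S a) <= sup (S b) + e.
    move=> hab; apply: ge_sup => // _ [[k k'] [/= Kk Kk'] <-].
    by apply: le_trans (hab _ _ Kk Kk') _; rewrite lerD2r; exact: Sle.
  rewrite ler_distlC; apply/andP; split.
    rewrite lerBlDr; apply: le => k k' Kk Kk'.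
    by have := h (k, k') (conj Kk Kk'); rewrite ler_distl lerBlDr => /andP[].
  apply: le => k k' Kk Kk'.
  by have := h (k, k') (conj Kk Kk'); rewrite ler_distl => /andP[].
- by move=> x; apply: le_trans (supS x); case/andP: (c01 x).
- exists (double_coset K D); first exact: compact_double_coset.
  move=> x nDx; rewrite (_ : S x = [set 0]) ?sup1//.
  apply/seteqP; split=> [_ [[k k'] [/= Kk Kk'] <-]|_ ->]/=.
    apply: c0 => Dx; apply: nDx; apply/double_cosetP.
    exists k^-1%g, (k * x * k')%g, k'^-1%g; split => //; try exact: KV.
    by rewrite -!mulgA mulKg mulgV mulg1.
  exists (1%g, 1%g) => //=; rewrite mul1g mulg1; apply: c0 => Dx; apply: nDx.
  exact: sub_double_coset.
- move=> k k' x Kk Kk'; congr sup; apply/seteqP; split=> _ [[l l'] [/= Kl Kl'] <-].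
    exists (l * k, k' * l')%g => /=; first by split; exact: KM.
    by rewrite !mulgA.
  exists (l * k^-1, k'^-1 * l')%g => /=; first by split; apply: KM => //; exact: KV.
  by rewrite -!mulgA mulKg mulVKg.
- by move=> x; apply: ge_sup.
- move=> x Qx; apply/eqP; rewrite eq_le ge_sup//= -(c1 x) ?supS//.
  exact: sub_double_coset.
Qed.

(** Cc(G), with complex values. *)
Definition ccc (f : G -> R[i]) := continuous (f : G -> R[i]^o) /\
  exists2 D, compact D & forall x, ~ D x -> f x = 0.

Lemma ccc_CcK (f : G -> R[i]) : ccc f -> biinvariant_fun f -> CcK K f.
Proof.
move=> [cf [D cD fD]] bf; split => //.
apply: (subclosed_compact _ cD); first exact: closed_closure.
have clD : closed D by exact: compact_closed.
rewrite [X in _ `<=` X]((closure_id D).1 clD); apply: closure_subset => x /=.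
by move=> fx0; apply: contrapT => /fD h; rewrite h eqxx in fx0.
Qed.

Lemma CcK_ccc (f : G -> R[i]) : CcK K f -> ccc f.
Proof.
move=> [cf cD _]; split => //; exists (closure [set x | f x != 0]) => // x nx.
by apply: contrapT => /eqP fx; apply: nx; exact: subset_closure.
Qed.

Lemma cc_CcK (f : G -> R) : cc f -> biinvariant_fun f -> CcK K (fun x => (f x)%:C).
Proof.
move=> [cf f0 [D cD fD]] bf; apply: ccc_CcK; last first.
  by move=> k k' x Kk Kk'; rewrite bf.
split; last by exists D => // x /fD ->.
by apply: continuous_ReIm => // x; exact: cvg_cst.
Qed.

Hypothesis gel : gelfand_pair mu K.

(** Commutativity of f * g at the unit, with g equal to 1 on the support of f
    and its inverse. *)
Lemma gelfand_invint (f : G -> R) : cc f -> biinvariant_fun f ->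
  \int[mu]_x f x = invint mu f.
Proof.
move=> hf bf; have [_ _ [D cD fD]] := hf.
have cDV : compact (D `|` [set x^-1%g | x in D]).
  by apply: compactU => //; exact: compact_inv.
have [g [hg bg _ g1]] := biinvariant_cutoff cDV.
have := gel (cc_CcK hf bf) (cc_CcK hg bg).
move=> /(congr1 (fun h => Re (h 1%g))); rewrite /convolution /= => E.
transitivity (\int[mu]_x Re ((f x)%:C * (g (x^-1 * 1)%g)%:C)).
  apply: eq_Rintegral => x _; rewrite ReM/= mul0r subr0 mulg1.
  have [Dx|/fD ->] := pselect (D x); last by rewrite mul0r.
  by rewrite g1 ?mulr1//; right; exists x.
rewrite E; apply: eq_Rintegral => x _; rewrite mul0r subr0 mulg1.
have [Dx|/fD ->] := pselect (D x^-1%g); last by rewrite mulr0.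
by rewrite g1 ?mul1r//; right; exists x^-1%g => //; exact: invgK.
Qed.

(** For a biinvariant g the function modular g is biinvariant too, hence
    determined by its integrals against biinvariant functions f; there haar_swap
    and the equality of the left and right integrals of f give the constant
    invint g. *)
Lemma gelfand_modular : exists2 g, cc g /\ 0 < invint mu g &
  forall z, modular mu g z = invint mu g.
Proof.
have [g [hg bg _ g1]] := biinvariant_cutoff (@compact_set1 _ (1%g : G)).
have Ig : 0 < invint mu g by apply: (invint_gt0 hG hmu (z := 1%g)) => //; rewrite g1.
exists g => // z.
have Dk k : K k -> modular mu g k = invint mu g.
  move=> Kk; apply: eq_Rintegral => x _.
  by rewrite -[(k * x^-1)%g]mulg1 bg.
have bD : biinvariant_fun (modular mu g).
  move=> k k' x Kk Kk'; apply: (@mulIf _ (invint mu g)); first by rewrite gt_eqF.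
  rewrite (modularM hG lcG hmu eC)// (Dk k')//.
  by congr (_ * _); apply: (@mulIf _ (invint mu g)); rewrite ?gt_eqF//
    (modularM hG lcG hmu eC)// (Dk k)// mulrC.
have cD := modular_continuous hG lcG hmu hg.
have swapD f : cc f -> biinvariant_fun f ->
    \int[mu]_y (f (y^-1)%g * (modular mu g (y^-1)%g - invint mu g)) = 0.
  move=> hf bf.
  have hfi := cc_integrable hG hmu (cc_inv hf).
  have hfD : cc (fun y => f (y^-1)%g * modular mu g (y^-1)%g).
    apply: (cc_inv (f := fun y => f y * modular mu g y)); apply: cc_mul => // x.
    exact: modular_ge0.
  under eq_Rintegral do rewrite mulrBr [X in _ - X]mulrC.
  rewrite RintegralB//; last 2 first.
  - exact: cc_integrable hfD.
  - exact: (integrableZl measurableT (invint mu g) hfi).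
  rewrite RintegralZl// -(haar_swap hG lcG hmu eC hf hg) gelfand_invint//.
  by rewrite mulrC subrr.
have [chi [hchi bchi _ chi1]] := biinvariant_cutoff (@compact_set1 _ z).
have cDI : continuous (fun y => modular mu g y - invint mu g).
  by move=> y; apply: cvgB; [exact: cD|exact: cvg_cst].
have cID : continuous (fun y => invint mu g - modular mu g y).
  by move=> y; apply: cvgB; [exact: cvg_cst|exact: cD].
have pos : 0 < chi z by rewrite chi1.
apply/eqP; rewrite eq_le -subr_le0 -(subr_le0 (modular mu g z)).
apply/andP; split.
  apply: (test_le0 hG hmu cDI hchi pos).
  apply: (swapD (fun y => chi y * Num.max (modular mu g y - invint mu g) 0)).
    by apply: cc_mul => //; [exact: cc_max|move=> y; rewrite le_max lexx orbT].
  by move=> k k' x Kk Kk'; rewrite bchi// bD.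
apply: (test_le0 hG hmu cID hchi pos); apply/eqP; rewrite -oppr_eq0; apply/eqP.
rewrite -[RHS](swapD (fun y => chi y * Num.max (invint mu g - modular mu g y) 0)).
- rewrite -mulN1r -RintegralZl//.
    by apply: eq_Rintegral => y _; ring.
  have : cc (fun y => chi y * Num.max (invint mu g - modular mu g y) 0 * Num.max (invint mu g - modular mu g y) 0).
    by do 2?apply: cc_mul => //; do ?exact: cc_max;move=> y; rewrite le_max lexx orbT.
  move=> /cc_inv /(cc_integrable hG hmu); congr (_.-integrable _ _); apply/funext => y /=; congr (_%:E).
  rewrite -!mulrA; congr (_ * _); case: leP => //; by rewrite !(mul0r,mulr0).
- by apply: cc_mul => //; [exact: cc_max|move=> y; rewrite le_max lexx orbT].
- by move=> k k' x Kk Kk'; rewrite bchi// bD.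
Qed.

Lemma gelfand_unimodular (f : G -> R) : cc f -> \int[mu]_x f x = invint mu f.
Proof.
move=> hf; have [g [hg Ig] Dg] := gelfand_modular.
apply: (@mulIf _ (invint mu g)); first by rewrite gt_eqF.
rewrite (haar_swap hG lcG hmu eC hf hg).
under eq_Rintegral do rewrite Dg mulrC.
rewrite RintegralZl//; first by rewrite mulrC.
exact: cc_integrable (cc_inv hf).
Qed.

(** Integrals of Urysohn functions compare mu and its image under inversion on
    open sets, by inner regularity, and then on Borel sets, by outer
    regularity. *)
Lemma haar_inv : measure_preserving mu (fun x : borel G => (x : G)^-1%g : borel G).
Proof.
have minv : measurable_fun setT (fun x : borel G => (x : G)^-1%g : borel G).
  by apply: borel_map_measurable; exact: invg_continuous.
split=> // A mA.
have [[_ outer inner_reg] _ _] := hmu.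
have oinv (U : set G) : open U -> open ((fun x : G => x^-1%g) @^-1` U).
  by move=> oU; move/continuousP : (@invg_continuous G); exact.
have invI (U : set G) : (fun x : G => x^-1%g) @^-1` ((fun x : G => x^-1%g) @^-1` U) = U.
  by apply/seteqP; split=> x /=; rewrite invgK.
have openle (U : set G) : open U -> (mu U <= mu ((fun x : G => x^-1%g) @^-1` U))%E.
  move=> oU; rewrite inner_reg//; apply: ge_ereal_sup => _ [Q [cQ QU] <-].
  have [c [cc0 c01 c1 cU [D cD c0]]] := compact_urysohn hG lcG R cQ oU QU.
  have hc : cc c by split => //; [move=> x; case/andP: (c01 x)|exists D].
  have mQ : measurable (Q : set (borel G)).
    by apply: borel_closed_measurable; exact: compact_closed.
  have mU := borel_open_measurable oU; have mUi := borel_open_measurable (oinv _ oU).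
  apply: (@le_trans _ _ (\int[mu]_x (c x)%:E)%E).
    rewrite -[Q]setIT -integral_indic//; apply: ge0_le_integral => //.
    - exact/measurable_EFinP/measurable_indic.
    - by apply/measurable_EFinP; exact: cc_meas.
    - move=> x _; rewrite lee_fin indicE; have [Qx|nQx] := pselect (Q x).
        by rewrite mem_set// c1.
      by rewrite memNset//; case/andP: (c01 x).
  rewrite (efine_cc hG hmu hc) gelfand_unimodular// -(efine_cc hG hmu (cc_inv hc)).
  rewrite -[X in (_ <= mu X)%E]setIT -integral_indic//; apply: ge0_le_integral => //.
  - by move=> x _; rewrite lee_fin; case/andP: (c01 x^-1%g).
  - by apply/measurable_EFinP; exact: cc_meas (cc_inv hc).
  - exact/measurable_EFinP/measurable_indic.
  - move=> x _; rewrite lee_fin indicE; have [Ux|nUx] := pselect (U x^-1%g).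
      by rewrite mem_set//; case/andP: (c01 x^-1%g).
    by rewrite memNset// cU.
have openeq (U : set G) : open U -> mu ((fun x : G => x^-1%g) @^-1` U) = mu U.
  move=> oU; apply/eqP; rewrite eq_le openle// andbT.
  by rewrite -[X in (_ <= mu X)%E]invI; apply: openle; exact: oinv.
have setle (B : set (borel G)) : measurable B ->
    (mu ((fun x : G => x^-1%g) @^-1` B) <= mu B)%E.
  move=> mB; rewrite [leRHS]outer//; apply: le_ereal_inf_tmp => _ [U [oU BU] <-].
  rewrite -(openeq U)//; apply: le_measure; rewrite ?inE.
  - by rewrite -[_ @^-1` _]setTI; exact: minv.
  - by apply: borel_open_measurable; exact: oinv.
  - by move=> x /= /BU.
apply/eqP; rewrite eq_le setle//= -[X in (mu X <= _)%E]invI; apply: setle.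
by rewrite -[_ @^-1` _]setTI; exact: minv.
Qed.

Lemma measure_preserving_comp (g h : borel G -> borel G) : measure_preserving mu g ->
  measure_preserving mu h -> measure_preserving mu (fun x => g (h x)).
Proof.
move=> [mg pg] [mh ph]; split; first exact: measurableT_comp.
move=> A mA; rewrite -(pg A mA) -(ph (g @^-1` A))//.
by rewrite -[_ @^-1` _]setTI; exact: mg.
Qed.

Lemma haar_right (a : G) : measure_preserving mu (fun x : borel G => ((x : G) * a)%g : borel G).
Proof.
have := measure_preserving_comp haar_inv
  (measure_preserving_comp (haar_left hmu a^-1%g) haar_inv).
rewrite (_ : (fun x => _) = (fun x : borel G => ((x : G) * a)%g : borel G))//.
by apply/funext => x; rewrite invgM !invgK.
Qed.

Lemma haar_conv (x : G) : measure_preserving mu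
  (fun t : borel G => ((t : G)^-1 * x)%g : borel G).
Proof. exact: (measure_preserving_comp (haar_right x) haar_inv). Qed.

End GelfandUnimodular.

(** * Positive-definite functions and the space L^2(G//K) *)

Lemma ae_imp2 d (T : measurableType d) (R : realType) (m : {measure set T -> \bar R})
    (P Q S : T -> Prop) : {ae m, forall x, P x} -> {ae m, forall x, Q x} ->
  (forall x, P x -> Q x -> S x) -> {ae m, forall x, S x}.
Proof. by move=> h1 h2 h; apply: filterS2 h1 h2 => x; exact: h. Qed.

Section SigmaFiniteFubini.
Context d1 d2 (T1 : measurableType d1) (T2 : measurableType d2) (R : realType).
Context (m1 : {measure set T1 -> \bar R}) (m2 : {measure set T2 -> \bar R}).
Hypotheses (s1 : sigma_finite setT m1) (s2 : sigma_finite setT m2).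

Lemma cfubini_sf (F : T1 * T2 -> R[i]) : cmeasurable_fun setT F ->
  (\int[m1]_x \int[m2]_y (normc (F (x, y)))%:E < +oo)%E ->
  cintegral m1 setT (fun x => cintegral m2 setT (fun y => F (x, y))) =
  cintegral m2 setT (fun y => cintegral m1 setT (fun x => F (x, y))).
Proof.
move=> mF lF; have := @inL1_prod _ _ _ _ _ (sfpack s1) (sfpack s2) F mF lF.
exact: (@cfubini _ _ _ _ _ (sfpack s1) (sfpack s2) F).
Qed.

Lemma measurable_fubini_sf (f : T1 * T2 -> \bar R) : measurable_fun setT f ->
  (forall z, 0 <= f z)%E -> measurable_fun setT (fun x => \int[m2]_y f (x, y))%E.
Proof. by move=> mf f0; exact: (measurable_fun_fubini_tonelli_F (m2 := sfpack s2)). Qed.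

Lemma cmeas_cintegral_sf (F : T1 * T2 -> R[i]) : cmeasurable_fun setT F ->
  cmeasurable_fun setT (fun x => cintegral m2 setT (fun y => F (x, y))).
Proof. exact: (@cmeas_cintegral _ _ _ _ _ (sfpack s2) F). Qed.

End SigmaFiniteFubini.

Lemma cmeas_swap d1 d2 (T1 : measurableType d1) (T2 : measurableType d2)
    (R : realType) (F : T1 * T2 -> R[i]) : cmeasurable_fun setT F ->
  cmeasurable_fun setT (fun p : T2 * T1 => F (p.2, p.1)).
Proof. by move=> mF; apply: (cmeas_comp mF); exact: measurable_swap. Qed.

Section PositiveDefinite.
Context (R : realType) (G : topGroupType) (phi : G -> R[i]).
Hypothesis pd : positive_definite phi.

Lemma posdef2 (x : G) (a b : R[i]) : 0 <= a * a^* * phi 1%g + a * b^* * phi x +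
  (b * a^* * phi (x^-1)%g + b * b^* * phi 1%g).
Proof.
have := pd (fun i : 'I_2 => if i == ord0 then 1%g else x) (fun i : 'I_2 => if i == ord0 then a else b).
rewrite !big_ord_recl !big_ord0 /= !invg1 !mul1g mulg1 mulVg !addr0.
exact.
Qed.

Lemma posdef_unit : phi 1%g = (Re (phi 1%g))%:C /\ 0 <= Re (phi 1%g).
Proof.
have := posdef2 1%g 1 0; rewrite conjc0 conjc1 !mul0r !mulr0 !mul0r !addr0 !mul1r.
exact: ge0_complexP.
Qed.

(** The Hermitian form of the points 1, x is real on the vectors (1, 1) and
    (1, i). *)
Lemma posdef_inv x : phi (x^-1)%g = (phi x)^*.
Proof.
have [h1 _] := ge0_complexP (posdef2 x 1 1); have [h2 _] := ge0_complexP (posdef2 x 1 'i).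
have [h0 _] := posdef_unit.
move: h1 h2; rewrite h0; case: (phi x) (phi x^-1%g) => [a b] [c d].
move=> /eqP; rewrite eq_complex => /andP[_ /eqP/= h1].
move=> /eqP; rewrite eq_complex => /andP[_ /eqP/= h2].
clear h0; move: (Re (phi 1%g)) h1 h2 => r h1 h2.
by apply: complex_eqP => /=; lra.
Qed.

(** The Hermitian form of the points 1, x is nonnegative on the vector
    (|phi x|, - phi x). *)
Lemma posdef_le x : normc (phi x) <= Re (phi 1%g).
Proof.
have [-> | p0] := eqVneq (phi x) 0.
  by rewrite Normc.normc0; case: posdef_unit.
have n0 : 0 < normc (phi x) by rewrite lt_neqAle normc_ge0 andbT eq_sym normc_eq0.
have [_] := ge0_complexP (posdef2 x (normc (phi x))%:C (- phi x)).
have [-> _] := posdef_unit; rewrite posdef_inv.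
have -> : (normc (phi x))%:C * ((normc (phi x))%:C)^* = (normc (phi x) ^+ 2)%:C.
  by rewrite mul_conjc normc_real ger0_norm ?normc_ge0.
have -> : (normc (phi x))%:C * (- phi x)^* * phi x = - (normc (phi x) ^+ 3)%:C.
  rewrite rmorphN mulrN mulNr -mulrA [_^* * _]mulrC mul_conjc.
  by rewrite -rmorphM/= -exprS.
have -> : - phi x * ((normc (phi x))%:C)^* * (phi x)^* = - (normc (phi x) ^+ 3)%:C.
  rewrite !mulNr mulrAC mul_conjc conjc_real -rmorphM/= -exprSr//.
have -> : - phi x * (- phi x)^* = (normc (phi x) ^+ 2)%:C.
  by rewrite mul_conjc normcN.
rewrite !ReD !ReN !ReM /= ?(mul0r,mulr0,subr0).
move: (normc (phi x)) (Re (phi 1%g)) n0 => n r n0 h.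
have : 0 <= n ^+ 2 * (r - n) by move: h; rewrite !exprS expr0; nra.
by rewrite pmulr_rge0 ?exprn_gt0// subr_ge0.
Qed.

End PositiveDefinite.

Section ComplexContinuous.
Context (R : realType) (X : topologicalType).
Implicit Types f g : X -> R[i]^o.

Lemma continuousM_c f g : continuous f -> continuous g ->
  continuous ((fun x => (f x : R[i]) * (g x : R[i])) : X -> R[i]^o).
Proof.
move=> cf cg; have [rf jf] := (continuous_Re cf, continuous_Im cf).
have [rg jg] := (continuous_Re cg, continuous_Im cg).
rewrite (_ : (fun x => _) = fun x => (Re (f x) * Re (g x) - Im (f x) * Im (g x)) +i*
    (Re (f x) * Im (g x) + Im (f x) * Re (g x))); last first.
  by apply/funext => x; apply: complex_eqP; rewrite ?ReM ?ImM.
by apply: continuous_ReIm => x; [apply: cvgB|apply: cvgD]; apply: cvgM;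
  do ?[exact: rf|exact: jf|exact: rg|exact: jg].
Qed.

Lemma continuousZ_c (c : R[i]) f : continuous f ->
  continuous ((fun x => c * (f x : R[i])) : X -> R[i]^o).
Proof.
move=> cf; have cc : continuous ((fun=> c) : X -> R[i]^o) by move=> x; exact: cvg_cst.
exact: (continuousM_c cc cf).
Qed.

Lemma continuousB_c f g : continuous f -> continuous g ->
  continuous ((fun x => (f x : R[i]) - (g x : R[i])) : X -> R[i]^o).
Proof.
move=> cf cg; have [rf jf] := (continuous_Re cf, continuous_Im cf).
have [rg jg] := (continuous_Re cg, continuous_Im cg).
rewrite (_ : (fun x => _) = fun x => (Re (f x) - Re (g x)) +i* (Im (f x) - Im (g x))).
  by apply: continuous_ReIm => x; apply: cvgB; do ?[exact: rf|exact: jf|exact: rg|exact: jg].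
by apply/funext => x; apply: complex_eqP; rewrite ?ReB ?ImB.
Qed.

Lemma continuous_conj f : continuous f ->
  continuous ((fun x => (f x)^*) : X -> R[i]^o).
Proof.
move=> cf; rewrite (_ : (fun x => _) = fun x => Re (f x) +i* (- Im (f x))).
  apply: continuous_ReIm; first exact: continuous_Re.
  by move=> x; apply: cvgN; exact: continuous_Im.
by apply/funext => x; apply: complex_eqP; rewrite ?Re_conj ?Im_conj.
Qed.

Lemma continuous_comp_c (Y : topologicalType) (h : Y -> X) f : continuous h ->
  continuous f -> continuous ((fun y => f (h y)) : Y -> R[i]^o).
Proof. by move=> ch cf y; apply: (cvg_comp h f); [exact: ch|exact: cf]. Qed.

End ComplexContinuous.

Lemma borel_continuous_cmeas (R : realType) (X : ptopologicalType) (f : X -> R[i]^o) :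
  continuous f -> cmeasurable_fun setT (f : borel X -> R[i]).
Proof.
by move=> cf; split; apply: borel_continuous_measurable;
  [exact: continuous_Re|exact: continuous_Im].
Qed.

Section L2K.
Context (R : realType) (G : topGroupType) (mu : {measure set (borel G) -> \bar R}).
Variable K : set G.

Lemma sesqui_L2 : sesqui_form (inL2 mu setT : set (G -> R[i])) (L2inner mu).
Proof. exact: (sesqui_inner mu). Qed.

Lemma sesqui_L2K : sesqui_form (L2K mu K) (L2inner mu).
Proof.
have [h0 hD hl hc hp] := sesqui_L2; split.
- by split => // k k' _ _; apply: aeW.
- move=> a f g [Lf bf] [Lg bg]; split; first exact: hD.
  move=> k k' Kk Kk'; apply: (ae_imp2 (bf k k' Kk Kk') (bg k k' Kk Kk')) => x E1 E2.
  by rewrite -[LHS]/(a * f _ + g _) E1 E2.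
- by move=> a f g h [Lf _] [Lg _] [Lh _]; exact: hl.
- by move=> f g [Lf _] [Lg _]; exact: hc.
- by move=> f [Lf _]; exact: hp.
Qed.

Hypothesis hleft : forall a : G, measure_preserving mu (fun x : borel G => (a * (x : G))%g : borel G).
Hypothesis hright : forall a : G, measure_preserving mu (fun x : borel G => ((x : G) * a)%g : borel G).

(** The L^2 limit is an almost everywhere limit along a subsequence, and
    two-sided translations preserve null sets. *)
Lemma L2K_complete : hcomplete (L2K mu K) (L2inner mu).
Proof.
move=> f Lf cf; have [y [k [Ly fy aey]]] := riesz_fischer (fun n => (Lf n).1) cf.
exists y => //; split => // l l' Kl Kl'.
have mp : measure_preserving mu (fun x : borel G => (l * x * l')%g : borel G).
  exact: (measure_preserving_comp (hright l') (hleft l)).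
have inv : {ae mu, forall x : G, forall n, f n (l * x * l')%g = f n x}.
  by apply/ae_foralln => n; case: (Lf n) => _ /(_ l l' Kl Kl').
have aey' := mp_ae mp aey.
apply: (ae_imp2 inv (ae_imp2 aey aey' (fun x h h' => conj h h'))) => x {}inv [[r1 i1] [r2 i2]].
have rE : (fun j => Re (f (k j) (l * x * l')%g)) = (fun j => Re (f (k j) x)).
  by apply/funext => j; rewrite inv.
have iE : (fun j => Im (f (k j) (l * x * l')%g)) = (fun j => Im (f (k j) x)).
  by apply/funext => j; rewrite inv.
rewrite rE in r2; rewrite iE in i2.
by apply: complex_eqP; [exact: (cvg_unique _ r2 r1)|exact: (cvg_unique _ i2 i1)].
Qed.

End L2K.

(** * Spherical functions *)

Section Spherical.
Context (R : realType) (G : topGroupType) (mu : {measure set (borel G) -> \bar R}).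
Variable K : set G.
Hypotheses (hG : hausdorff_space G) (lcG : locally_compact [set: G]).
Hypotheses (hmu : left_haar mu) (hK : compact_subgroup K).
Hypothesis gel : gelfand_pair mu K.
Variable C : nat -> set G.
Hypothesis eC : exhaustion C.

Let sfm : sigma_finite setT mu. Proof. by apply: haar_sigma_finite; eassumption. Qed.
Let minv := haar_inv hG lcG hmu hK eC gel.
Let mright := haar_right hG lcG hmu hK eC gel.
Let mleft := haar_left hmu.

Lemma ccc_normc (f : G -> R[i]) : ccc f -> cc (fun x => normc (f x) : R).
Proof.
move=> [cf [D cD fD]]; split.
- exact: continuous_normc.
- by move=> x; exact: normc_ge0.
- by exists D => // x /fD ->; rewrite Normc.normc0.
Qed.

Lemma ccc_cmeas (f : G -> R[i]) : ccc f -> cmeasurable_fun setT (f : borel G -> R[i]).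
Proof. by move=> [cf _]; exact: borel_continuous_cmeas. Qed.

Lemma ccc_inL1 (f : G -> R[i]) : ccc f -> inL1 mu setT (f : borel G -> R[i]).
Proof.
move=> hf; split; first exact: ccc_cmeas.
by rewrite /L1norm (efine_cc hG hmu (ccc_normc hf)) ltry.
Qed.

Lemma ccc_inL2 (f : G -> R[i]) : ccc f -> inL2 mu setT (f : borel G -> R[i]).
Proof.
move=> hf; split; first exact: ccc_cmeas.
have hf2 : cc (fun x => normc (f x) * normc (f x) : R).
  by apply: cc_mul; [exact: ccc_normc|case: (ccc_normc hf)|case: (ccc_normc hf)].
rewrite /L2norm_sq; under eq_integral do rewrite expr2.
by rewrite (efine_cc hG hmu hf2) ltry.
Qed.

Lemma cccM (f h : G -> R[i]) : ccc f -> continuous (h : G -> R[i]^o) ->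
  ccc (fun x => f x * h x).
Proof.
move=> [cf [D cD fD]] ch; split; first exact: (continuousM_c cf ch).
by exists D => // x /fD ->; rewrite mul0r.
Qed.

Lemma ccc_inv (f : G -> R[i]) : ccc f -> ccc (fun x => f (x^-1)%g).
Proof.
move=> [cf [D cD fD]]; split; first exact: (continuous_comp_c (@invg_continuous G) cf).
exists [set x^-1%g | x in D]; first exact: compact_inv.
by move=> x nDx; apply: fD => Dx; apply: nDx; exists x^-1%g => //; exact: invgK.
Qed.

Lemma CcK_inv f : CcK K f -> CcK (R := R) K (fun x => f (x^-1)%g).
Proof.
move=> hf; apply: (ccc_CcK hG); first exact: ccc_inv (CcK_ccc hf).
have [_ _ bf] := hf; have [_ _ _ KV] := hK.
by move=> k k' x Kk Kk'; rewrite !invgM mulgA bf//; exact: KV.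
Qed.

Lemma continuous_cparam_integral (F : G * G -> R[i]^o) (D : set G) : compact D ->
  continuous F -> (forall x y, ~ D y -> F (x, y) = 0) ->
  continuous ((fun x => cintegral mu setT (fun y => F (x, y))) : G -> R[i]^o).
Proof.
move=> cD cF F0; have clD : closed D by exact: compact_closed.
have mD := haar_compact hmu cD.
apply: continuous_ReIm => x.
  apply: (continuous_param_integral cD clD mD (continuous_Re cF)).
  by apply: nearW => x' y /F0 ->.
apply: (continuous_param_integral cD clD mD (continuous_Im cF)).
by apply: nearW => x' y /F0 ->.
Qed.

Lemma cmeas_continuous_prod (F : G * G -> R[i]^o) : continuous F ->
  cmeasurable_fun setT (F : borel G * borel G -> R[i]).
Proof.
move=> cF; split; first exact: (continuous_prod_measurable eC eC (continuous_Re cF)).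
exact: (continuous_prod_measurable eC eC (continuous_Im cF)).
Qed.

(** F is bounded and vanishes off the compact set D1 x D2. *)
Lemma compact_prod_fubini (F : G * G -> R[i]^o) (D1 D2 : set G) :
  compact D1 -> compact D2 -> continuous F ->
  (forall y x, ~ (D1 y /\ D2 x) -> F (y, x) = 0) ->
  cintegral mu setT (fun y => cintegral mu setT (fun x => F (y, x))) =
  cintegral mu setT (fun x => cintegral mu setT (fun y => F (y, x))).
Proof.
move=> cD1 cD2 cF F0; have mF := cmeas_continuous_prod cF.
apply: (cfubini_sf sfm sfm (F := F)) => //.
have mD1 : measurable (D1 : set (borel G)) by apply: borel_closed_measurable; exact: compact_closed.
have mD2 : measurable (D2 : set (borel G)) by apply: borel_closed_measurable; exact: compact_closed.
have cn := continuous_normc cF.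
have [M M0 FM] : exists2 M : R, 0 <= M & forall y x, normc (F (y, x)) <= M * (\1_D1 y * \1_D2 x).
  have cD : compact (D1 `*` D2) by exact: compact_setX.
  have : compact ((fun p => normc (F p)) @` (D1 `*` D2)).
    exact: (continuous_compact (continuous_subspaceT cn) cD).
  move=> /compact_bounded [N [Nr hN]]; exists (Num.max N 0 + 1).
    by rewrite addr_ge0// le_max lexx orbT.
  move=> y x; have [[Dy Dx]|nD] := pselect (D1 y /\ D2 x); last first.
    by rewrite F0// Normc.normc0 !mulr_ge0 ?indicE// addr_ge0// le_max lexx orbT.
  rewrite !indicE !mem_set// !mulr1 -[leLHS]ger0_norm ?normc_ge0//.
  apply: hN; first by rewrite ltr_pwDr// le_max lexx.
  by exists (y, x).
apply: (@le_lt_trans _ _ (\int[mu]_y ((M * fine (mu D2)) * \1_D1 y)%:E)%E).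
  apply: ge0_le_integral => //.
  - by move=> y _; apply: integral_ge0 => x _; rewrite lee_fin normc_ge0.
  - apply: (measurable_fubini_sf sfm (f := fun p : borel G * borel G => (normc (F p))%:E)).
      exact: cmeas_enormc.
    by move=> p; rewrite lee_fin normc_ge0.
  - by apply/measurable_EFinP/measurable_funM => //; exact: measurable_indic.
  move=> y _.
  have mFy : measurable_fun setT (fun x : borel G => normc (F (y, x))).
    have cFy : continuous (fun x : G => normc (F (y, x))) := continuous_section (x := y) cn.
    exact: (borel_continuous_measurable cFy).
  apply: (@le_trans _ _ (\int[mu]_x ((M * \1_D1 y) * \1_D2 x)%:E)%E).
    apply: ge0_le_integral => //.
    - by move=> x _; rewrite lee_fin normc_ge0.
    - exact/measurable_EFinP.
    - by apply/measurable_EFinP/measurable_funM => //; exact: measurable_indic.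
    - by move=> x _; rewrite lee_fin -mulrA; exact: FM.
  under eq_integral do rewrite EFinM.
  rewrite ge0_integralZl_EFin//; last 2 first.
  - exact/measurable_EFinP/measurable_indic.
  - by rewrite mulr_ge0.
  rewrite integral_indic// setIT -[mu D2]fineK; last first.
    by rewrite ge0_fin_numE// haar_compact.
  by rewrite -EFinM lee_fin mulrAC.
under eq_integral do rewrite EFinM.
rewrite ge0_integralZl_EFin//; last 2 first.
- exact/measurable_EFinP/measurable_indic.
- by rewrite mulr_ge0// fine_ge0.
rewrite integral_indic// setIT lte_mul_pinfty// ?lee_fin ?mulr_ge0 ?fine_ge0//.
exact: haar_compact.
Qed.

(** Take for g the conjugate of r times a cutoff. *)
Lemma CcK_orthogonal_eq0 (r : G -> R[i]) : continuous (r : G -> R[i]^o) ->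
  biinvariant_fun K r ->
  (forall g, CcK K g -> cintegral mu setT (fun z : G => g z * r z) = 0) ->
  forall x, r x = 0.
Proof.
move=> cr br orth x.
have [chi [hchi bchi _ chi1]] := biinvariant_cutoff R hG lcG hK (@compact_set1 _ x).
have [cchi chi0 [Q cQ chiQ]] := hchi.
have cchiC : continuous ((fun z => (chi z)%:C) : G -> R[i]^o).
  by apply: continuous_ReIm => // z; exact: cvg_cst.
have hg : CcK K (fun z => (chi z)%:C * (r z)^*).
  apply: (ccc_CcK hG).
    apply: (cccM _ (continuous_conj cr)).
    by split=> //; exists Q => // z /chiQ ->.
  by move=> k k' z Kk Kk'; rewrite br// bchi.
have h2 : cc (fun z => chi z * normc (r z) ^+ 2).
  rewrite (_ : (fun z => _) = fun z => chi z * (normc (r z) * normc (r z))); last first.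
    by apply/funext => z; rewrite expr2.
  apply: cc_mul => //; last by move=> z; rewrite mulr_ge0 ?normc_ge0.
  have cn : continuous (fun z => normc (r z)) := continuous_normc cr.
  by move=> z; apply: cvgM; exact: cn.
have : (\int[mu]_z (chi z * normc (r z) ^+ 2)%:E = 0)%E.
  rewrite (efine_cc hG hmu h2); congr (_%:E).
  rewrite -[RHS](congr1 (fun z : R[i] => Re z) (orth _ hg)) /=.
  by apply: eq_Rintegral => z _; rewrite -mulrA (mulrC _ (r z)) mul_conjc -rmorphM.
have [ch2 h20 _] := h2; move=> /(haar_integral_eq0 hG hmu ch2 h20)/(_ x)/eqP.
by rewrite chi1// mul1r sqrf_eq0 normc_eq0 => /eqP.
Qed.

Section FunctionalEquation.
Variable phi : G -> R[i].
Hypothesis sphi : spherical mu K phi.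

Let cphi : continuous (phi : G -> R[i]^o). Proof. by case: sphi. Qed.
Let bphi : biinvariant_fun K phi. Proof. by case: sphi. Qed.

Let cmap1 : continuous (fun p : G * G => p.1). Proof. by move=> p; exact: cvg_fst. Qed.
Let cmap2 : continuous (fun p : G * G => p.2). Proof. by move=> p; exact: cvg_snd. Qed.

(** Multiplicativity of f |-> int f phi on f * g says that
    int g(x) (int f(y) phi(y x) dy - (int f phi) phi(x)) dx = 0; the function
    in parentheses is continuous and biinvariant, so g may be taken to be its
    conjugate times a cutoff. *)
Lemma spherical_equation f x : CcK K f ->
  cintegral mu setT (fun y : G => f y * phi (y * x)%g) = pairing mu f phi * phi x.
Proof.
move=> hf; have cf := CcK_ccc hf; have [cfc [D cD fD]] := cf.
have [_ _ bf] := hf; have [cK K1 KM KV] := hK.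
have [H HE] : exists H : G -> R[i],
    H = fun x => cintegral mu setT (fun y : G => f y * phi (y * x)%g) by eexists.
have [a aE] : exists a, a = pairing mu f phi by eexists.
pose r (x : G) : R[i] := a * phi x - H x.
have cm21 : continuous (fun p : G * G => (p.2 * p.1)%g).
  exact: (continuousM_g cmap2 cmap1).
have cm12 : continuous (fun p : G * G => (p.1 * p.2)%g).
  exact: (continuousM_g cmap1 cmap2).
have cV12 : continuous (fun p : G * G => (p.1^-1 * p.2)%g).
  exact: (continuousM_g (continuousV_g cmap1) cmap2).
have cVr z : continuous (fun y : G => (y^-1 * z)%g).
  by apply: (continuousM_g (@invg_continuous G)) => ?; exact: cvg_cst.
have cphir z := continuous_comp_c (@rmul_continuous _ z) cphi.
have cF := continuousM_c (continuous_comp_c cmap2 cfc) (continuous_comp_c cm21 cphi).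
have cH : continuous (H : G -> R[i]^o).
  rewrite HE; apply: (continuous_cparam_integral (F := fun p => f p.2 * phi (p.2 * p.1)%g) cD cF).
  by move=> z y /= /fD ->; rewrite mul0r.
have cr : continuous (r : G -> R[i]^o).
  have := continuousB_c (continuousZ_c (c := a) cphi) cH.
  exact.
have bH : biinvariant_fun K H.
  move=> k k' z Kk Kk'; rewrite HE.
  transitivity (cintegral mu setT (fun y : G => f (y * k)%g * phi ((y * k) * z)%g)).
    congr cintegral; apply/funext => y.
    have -> : f (y * k)%g = f y by rewrite -[(y * k)%g]mul1g mulgA bf.
    congr (_ * _); rewrite !mulgA.
    by have := bphi (y * k * z)%g K1 Kk'; rewrite mul1g.
  apply: (mp_cintegral (mright k) (f := fun y => f y * phi (y * z)%g)).
  exact: (ccc_cmeas (cccM cf (cphir z))).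
have br : biinvariant_fun K r.
  by move=> k k' z Kk Kk'; rewrite /r bH// bphi.
have orth g : CcK K g -> cintegral mu setT (fun z : G => g z * r z) = 0.
  move=> hg; have cg := CcK_ccc hg; have [cgc [E cE gE]] := cg.
  have [_ _ mult _] := sphi.
  have E1 : pairing mu (convolution mu f g) phi =
      cintegral mu setT (fun z : G => g z * H z).
    rewrite /pairing /convolution.
    transitivity (cintegral mu setT (fun z : G => cintegral mu setT (fun y : G =>
        f y * (g (y^-1 * z)%g * phi z)))).
      congr cintegral; apply/funext => z; rewrite mulrC -cintegralZ.
        by congr cintegral; apply/funext => y; ring.
      exact: (ccc_inL1 (cccM cf (continuous_comp_c (cVr z) cgc))).
    have cF1 := continuousM_c (continuous_comp_c cmap1 cfc) (continuousM_c
      (continuous_comp_c cV12 cgc) (continuous_comp_c cmap2 cphi)).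
    rewrite -(compact_prod_fubini cD (compact_mulset cD cE) cF1); last first.
      move=> y z /= nDE; have [Dy|/fD ->] := pselect (D y); last by rewrite mul0r.
      rewrite gE ?mul0r ?mulr0// => Ez; apply: nDE; split => //.
      by exists (y, y^-1 * z)%g => //=; rewrite mulVKg.
    transitivity (cintegral mu setT (fun y : G => cintegral mu setT (fun z : G =>
        f y * (g z * phi (y * z)%g)))).
      congr cintegral; apply/funext => y.
      rewrite -(mp_cintegral (mleft y) (f := fun z => f y * (g (y^-1 * z)%g * phi z))).
        by congr cintegral; apply/funext => z; rewrite mulKg.
      exact: (borel_continuous_cmeas (continuousZ_c (c := f y) (continuousM_c
        (continuous_comp_c (@lmul_continuous _ y^-1%g) cgc) cphi))).
    have cF2 := continuousM_c (continuous_comp_c cmap1 cfc) (continuousM_c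
      (continuous_comp_c cmap2 cgc) (continuous_comp_c cm12 cphi)).
    rewrite (compact_prod_fubini cD cE cF2); last first.
      move=> y z /= nDE; have [Dy|/fD ->] := pselect (D y); last by rewrite mul0r.
      by rewrite gE ?mul0r ?mulr0// => Ez; apply: nDE.
    congr cintegral; apply/funext => z; rewrite HE -cintegralZ.
      by congr cintegral; apply/funext => y; ring.
    exact: (ccc_inL1 (cccM cf (cphir z))).
  rewrite (_ : (fun z => g z * r z) = fun z =>
      a * (g z * phi z) - g z * H z); last first.
    by apply/funext => z; rewrite /r; ring.
  have i1 := ccc_inL1 (cccM cg cphi); have i2 := ccc_inL1 (cccM cg cH).
  by rewrite cintegralB ?cintegralZ -?E1 ?mult ?aE ?subrr//; exact: inL1Z.
have := CcK_orthogonal_eq0 cr br orth x; rewrite /r aE HE => /eqP.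
by rewrite subr_eq0 => /eqP <-.
Qed.

End FunctionalEquation.

Section PositiveDefiniteSpherical.
Variable phi : G -> R[i]^o.
Hypothesis sphi : Splus mu K phi.

Lemma Splus_spherical : spherical mu K phi. Proof. by case: sphi => -[]. Qed.
Lemma Splus_continuous : continuous phi. Proof. by case: Splus_spherical. Qed.
Lemma Splus_posdef : positive_definite phi. Proof. by case: sphi. Qed.

Lemma Splus_inv x : phi (x^-1)%g = (phi x)^*.
Proof. exact: posdef_inv Splus_posdef x. Qed.

(** The functional equation at 1, for f with nonzero integral against phi. *)
Lemma Splus_unit : phi 1%g = 1.
Proof.
have [cphi _ _ [f hf nf]] := Splus_spherical.
have := spherical_equation Splus_spherical 1%g hf.
rewrite (_ : (fun y => _) = fun y => f y * phi y); last first.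
  by apply/funext => y; rewrite mulg1.
by move=> E; apply: (mulfI nf); rewrite -E mulr1.
Qed.

Lemma Splus_le1 x : normc (phi x) <= 1.
Proof. by have := posdef_le Splus_posdef x; rewrite Splus_unit. Qed.

Lemma sphericalF_conj f : sphericalF mu f phi =
  cintegral mu setT (fun x : G => f x * (phi x)^*).
Proof. by congr cintegral; apply/funext => x; rewrite Splus_inv. Qed.

(** The functional equation for y |-> f (y^-1), after inverting and translating
    the variable of integration. In this form the translations act on f. *)
Lemma Splus_translation f x : CcK K f ->
  cintegral mu setT (fun y : G => f (x * y)%g * (phi y)^*) = sphericalF mu f phi * phi x.
Proof.
move=> hf; have cf := CcK_ccc hf; have hfi := CcK_inv hf.
have cphi := Splus_continuous.
have cinv := continuous_comp_c (@invg_continuous G) cphi.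
have -> : sphericalF mu f phi = pairing mu (fun y => f (y^-1)%g) phi.
  rewrite /sphericalF /pairing -(mp_cintegral minv (f := fun y => f y * phi (y^-1)%g)).
    by congr cintegral; apply/funext => y; rewrite invgK.
  exact: (ccc_cmeas (cccM cf cinv)).
rewrite -(spherical_equation Splus_spherical x hfi).
have cVx : continuous (fun y : G => (y^-1 * x)%g).
  by apply: (continuousM_g (@invg_continuous G)) => ?; exact: cvg_cst.
have cx := continuous_comp_c cVx cphi.
have mF : cmeasurable_fun setT ((fun y : G => f y * phi (y^-1 * x)%g) : borel G -> R[i]).
  exact: (ccc_cmeas (cccM cf cx)).
transitivity (cintegral mu setT (fun y : G => f y * phi (y^-1 * x)%g)).
  rewrite -(mp_cintegral (mleft x) mF); congr cintegral; apply/funext => y.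
  by rewrite invgM mulgVK Splus_inv.
rewrite -(mp_cintegral minv mF); congr cintegral; apply/funext => y.
by rewrite invgK.
Qed.

End PositiveDefiniteSpherical.

End Spherical.

(** * Measurability in the spherical variable and the Plancherel measure *)

(** Pick a point of S in each ball of radius 1/k around a point of the dense
    sequence that meets S. *)
Lemma hseparable_subset (R : realType) (V : lmodType R[i]) (H S : set V)
    (ip : V -> V -> R[i]) : sesqui_form H ip -> hseparable H ip -> S `<=` H ->
  S !=set0 -> exists s : nat -> V, (forall n, S (s n)) /\
    forall x, S x -> forall e : R, 0 < e -> exists n, hnorm ip (x - s n) < e.
Proof.
move=> Hip [d [Hd dd]] SH [z Sz].
have /choice[s hs] (p : nat * nat) : exists y, S y /\ ((exists2 y', S y' &
    hnorm ip (y' - d p.1) < p.2.+1%:R^-1) -> hnorm ip (y - d p.1) < p.2.+1%:R^-1).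
  have [[y Sy hy]|no] := pselect (exists2 y', S y' & hnorm ip (y' - d p.1) < p.2.+1%:R^-1).
    by exists y.
  by exists z; split.
exists (fun i => if unpickle i is Some p then s p else z); split.
  by move=> i; case: (unpickle i) => [p|//]; case: (hs p).
move=> x Sx e e0.
have e20 : 0 < e / 2 by rewrite divr_gt0.
have [k _ /(_ k (leqnn _)) /= hk] := near_infty_natSinv_lt (PosNum e20).
have k0 : 0 < k.+1%:R^-1 :> R by rewrite invr_gt0.
have [n hn] := dd x (SH _ Sx) _ k0.
exists (pickle (n, k)); rewrite pickleK; have [Ss hsn] := hs (n, k).
have {}hsn := hsn (ex_intro2 _ _ x Sx hn); rewrite /= in hsn.
apply: le_lt_trans (hnorm_dist Hip (SH _ Sx) (Hd n) (SH _ Ss)) _.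
rewrite (hnormBC Hip (Hd n) (SH _ Ss)).
move: hn hsn hk; move: (hnorm _ _) (hnorm _ _) (k.+1%:R^-1) => a b c; lra.
Qed.

Section PositiveDefiniteSphericalFunctions.
Context (R : realType) (G : topGroupType) (mu : {measure set (borel G) -> \bar R}).
Variable K : set G.
Hypotheses (hG : hausdorff_space G) (lcG : locally_compact [set: G]).
Hypotheses (hmu : left_haar mu) (hK : compact_subgroup K).
Hypothesis gel : gelfand_pair mu K.
Variable C : nat -> set G.
Hypothesis eC : exhaustion C.
Hypothesis Cbi : forall n, biinvariant_set K (C n).
Hypothesis Csub : forall Q, compact Q -> exists n, Q `<=` C n.

Let sfm : sigma_finite setT mu. Proof. by apply: haar_sigma_finite; eassumption. Qed.
Let minv := haar_inv hG lcG hmu hK eC gel.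
Let mright := haar_right hG lcG hmu hK eC gel.
Let mleft := haar_left hmu.

Local Notation S := (Splus_space mu K).

Let mC n : measurable (C n : set (borel G)).
Proof. by have [_ clC _ _] := eC; exact: borel_closed_measurable. Qed.

Let cut1_inL2 n : inL2 mu setT (crestrict (C n) (fun=> 1) : borel G -> R[i]).
Proof.
have [cC _ _ _] := eC.
by case: (crestrict_biinvariant_L2K (mu := mu) (@Cbi n) (mC n) (haar_compact hmu (cC n))).
Qed.

Lemma Splus_measurable : measurable (Splus mu K : set (borel S)).
Proof. by apply: borel_open_measurable; exact: open_subspaceT. Qed.

Lemma sphericalF_continuous f : L1K mu K f ->
  continuous (sphericalF mu f : S -> R[i]^o).
Proof.
move=> hf.
suff : {within (Splus mu K : set (weak_space mu K)), continuous (sphericalF mu f : weak_space mu K -> R[i]^o)} by [].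
apply: continuous_subspaceT => phi.
have /cvg_sup/(_ (exist _ f hf)) h : phi --> (phi : weak_space mu K) by exact: cvg_id.
apply: cvg_trans; last exact: (@initial_continuous _ _ (sphericalF mu f) phi).
exact: cvg_app h.
Qed.

Lemma sphericalF_cmeas f : L1K mu K f ->
  cmeasurable_fun setT (sphericalF mu f : borel S -> R[i]).
Proof. by move=> hf; exact: (borel_continuous_cmeas (sphericalF_continuous hf)). Qed.

Lemma CcK_L2K f : CcK K f -> L2K mu K f.
Proof.
move=> hf; split; first exact: (ccc_inL2 hG hmu (CcK_ccc hf)).
by move=> k k' Kk Kk'; apply: aeW => x; have [_ _ ->] := hf.
Qed.

Lemma CcK_L1K f : CcK K f -> L1K mu K f.
Proof.
move=> hf; split; first exact: (ccc_inL1 hG hmu (CcK_ccc hf)).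
by move=> k k' Kk Kk'; apply: aeW => x; have [_ _ ->] := hf.
Qed.

Lemma Splus_cut_L2K n (phi : G -> R[i]^o) : Splus mu K phi ->
  L2K mu K (crestrict (C n) phi).
Proof.
move=> sphi; have le1 := Splus_le1 hG lcG hmu hK gel eC sphi.
have cphi := Splus_continuous sphi; split.
  have [m1 L1] := cut1_inL2 n.
  apply: (inL2_le (g := fun x : borel G => (normc (crestrict (C n) (fun=> 1 : R[i]) x) ^+ 2)%:E)) => //.
  - by apply: cmeas_crestrict => //; exact: borel_continuous_cmeas.
  - exact: cmeas_enormc2.
  - move=> x; rewrite lee_fin /crestrict; case: ifP => _ //.
    by rewrite ler_pXn2r ?nnegrE ?normc_ge0// Normc.normc1.
move=> k k' Kk Kk'; apply: aeW => x; rewrite /crestrict.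
have [_ bphi _ _] := Splus_spherical sphi.
have [Cx|nCx] := pselect (C n x).
  by rewrite !mem_set//; [exact: bphi|exact/(@Cbi n k k' x Kk Kk')].
by rewrite !memNset// => /(@Cbi n k k' x Kk Kk').
Qed.

(** Projecting h onto L^2(G//K) turns the pairing into a spherical Fourier
    transform. *)
Lemma cut_pairing_cmeas h n : inL2 mu setT (h : borel G -> R[i]) ->
  cmeasurable_fun setT (crestrict (Splus mu K : set (borel S)) (fun phi =>
    L2inner mu h (crestrict (C n) phi))).
Proof.
move=> Lh.
have [p Lp pE] := hprojection (sesqui_L2 mu) (sesqui_L2K mu K)
  (fun f (hf : L2K mu K f) => hf.1) (L2K_complete mleft mright) Lh.
pose q : G -> R[i] := crestrict (C n) p.
have qE x : q x = p x * crestrict (C n) (fun=> 1) x.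
  by rewrite /q /crestrict; case: ifP; rewrite ?mulr1// mulr0.
have Lq : L1K mu K q.
  split.
    rewrite (_ : q = fun x => p x * crestrict (C n) (fun=> 1) x); last exact/funext.
    by apply: inL2M; [case: Lp|exact: cut1_inL2].
  move=> k k' Kk Kk'; case: Lp => _ /(_ k k' Kk Kk').
  move=> H; apply: (ae_imp2 H H) => x E _; rewrite /q /crestrict.
  have [Cx|nCx] := pselect (C n x).
    by rewrite !mem_set//; exact/(@Cbi n k k' x Kk Kk').
  by rewrite !memNset// => /(@Cbi n k k' x Kk Kk').
have := cmeas_crestrict Splus_measurable (sphericalF_cmeas Lq).
congr cmeasurable_fun; apply/funext => phi; rewrite /crestrict.
case: ifPn => // /set_mem sphi.
rewrite (pE _ (Splus_cut_L2K n sphi)) (sphericalF_conj sphi).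
congr cintegral; apply/funext => x; rewrite /q /crestrict.
by case: ifP => _ //; rewrite conjC0 mulr0 mul0r.
Qed.

Lemma pairing_cut (h : G -> R[i]) (phi : G -> R[i]) n : (forall x, ~ C n x -> h x = 0) ->
  L2inner mu h (crestrict (C n) phi) = cintegral mu setT (fun x : G => h x * (phi x)^*).
Proof.
move=> h0; congr cintegral; apply/funext => x; rewrite /crestrict.
by case: ifPn => // /negP; rewrite inE => /h0 ->; rewrite !mul0r.
Qed.

Section Translation.
Variable f : G -> R[i].
Hypothesis hf : CcK K f.

Let cf : continuous (f : G -> R[i]^o). Proof. by case: hf. Qed.
Let F (x : G) (phi : S) : R[i] := crestrict (Splus mu K : set S)
  (fun phi : G -> R[i]^o => cintegral mu setT (fun y : G => f (x * y)%g * (phi y)^*)) phi.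

Let ccc_translate x : ccc (fun y => f (x * y)%g).
Proof.
have [_ [D cD fD]] := CcK_ccc hf; split.
  exact: (continuous_comp_c (@lmul_continuous _ x) cf).
exists (mulset [set (x^-1)%g] D); first by apply: compact_mulset => //; exact: compact_set1.
move=> y nDy; apply: fD => Dy; apply: nDy.
by exists (x^-1, x * y)%g => //=; rewrite mulKg.
Qed.

Let mF x : cmeasurable_fun setT (F x : borel S -> R[i]).
Proof.
have hx := ccc_translate x; have [_ [D cD xD]] := hx; have [n DC] := Csub cD.
have := cut_pairing_cmeas n (ccc_inL2 hG hmu hx).
congr cmeasurable_fun; apply/funext => phi; rewrite /F /crestrict.
case: ifP => // _; rewrite -/(crestrict _ _) pairing_cut// => y nCy.
by apply: xD => /DC.
Qed.

Let dist x x' := \int[mu]_y (normc (f (x' * y)%g - f (x * y)%g)).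

Let eqF x (e : R) : 0 < e -> \forall x' \near x, forall phi, normc (F x' phi - F x phi) <= e.
Proof.
move=> e0; have [_ [D cD fD]] := CcK_ccc hf.
have [U [oU U1 [Q cQ UQ]]] := unit_compact_nbhs lcG.
pose W := mulset [set y^-1%g | y in Q] (mulset [set (x^-1)%g] D).
have cW : compact W.
  apply: compact_mulset; first exact: compact_inv.
  by apply: compact_mulset => //; exact: compact_set1.
have W0 x' y : mulset [set x] U x' -> ~ W y -> f (x' * y)%g = 0.
  move=> [[a u] [/= -> Uu] <-] nW; apply: fD => Dy; apply: nW.
  have -> : y = (u^-1 * (x^-1 * (x * u * y)))%g by rewrite -mulgA mulKg mulKg.
  apply: mulsetP; first by exists u => //; exact: UQ.
  exact: mulsetP.
have oxU : open (mulset [set x] U) by exact: open_mulset.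
have xU : mulset [set x] U x by exists (x, 1%g) => //=; rewrite mulg1.
have nU : nbhs x (mulset [set x] U) by exact: open_nbhs_nbhs.
have cmul : continuous (fun p : G * G => (p.1 * p.2)%g) := @mulg_continuous G.
have cm2 : continuous (fun p : G * G => (x * p.2)%g).
  apply: (continuousM_g (X := (G * G)%type)) => p; [exact: cvg_cst|exact: cvg_snd].
have cd := continuous_normc (continuousB_c (continuous_comp_c cmul cf) (continuous_comp_c cm2 cf)).
have cdist : {for x, continuous (dist x)}.
  apply: (continuous_param_integral cW (compact_closed hG cW) (haar_compact hmu cW) cd).
  apply: filterS nU => x' Ux' y nW /=.
  by rewrite W0// W0// subrr Normc.normc0.
have dist0 : dist x x = 0.
  rewrite /dist; under eq_Rintegral do rewrite subrr Normc.normc0.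
  by rewrite Rintegral_cst// mul0r.
have {cdist} : \forall x' \near x, dist x x' <= e.
  move/cvgrPdist_le : cdist => /(_ e e0); apply: filterS => x'.
  by rewrite dist0 sub0r normrN; apply: le_trans; exact: ler_norm.
apply: filterS => x' hd phi; rewrite /F /crestrict; case: ifPn => [|_]; last first.
  by rewrite subrr Normc.normc0 ltW.
rewrite inE => sphi; have cphi := continuous_conj (Splus_continuous sphi).
have le1 := Splus_le1 hG lcG hmu hK gel eC sphi.
have L x0 := ccc_inL1 hG hmu (cccM (ccc_translate x0) cphi).
rewrite -cintegralB; [|exact: L|exact: L].
have Ld : inL1 mu setT ((fun y : G => f (x' * y)%g - f (x * y)%g) : borel G -> R[i]).
  by apply: inL1B; apply: ccc_inL1.
rewrite -lee_fin; apply: le_trans (normc_cintegral_le (inL1B (L x') (L x))) _.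
apply: (@le_trans _ _ (L1norm mu setT ((fun y : G => f (x' * y)%g - f (x * y)%g) : borel G -> R[i]))).
  apply: ge0_le_integral => //.
  - by move=> y _; rewrite lee_fin normc_ge0.
  - by apply: cmeas_enormc; case: (inL1B (L x') (L x)).
  - by apply: cmeas_enormc; case: Ld.
  - move=> y _; rewrite lee_fin -mulrBl Normc.normcM normc_conj.
    by rewrite ler_piMr ?normc_ge0.
rewrite -lee_fin in hd; apply: le_trans hd; rewrite /dist /L1norm /Rintegral fineK//.
by apply: integrable_fin_num => //; exact: inL1_normc Ld.
Qed.

(** By the functional equation the function is the pairing of phi with the
    translates of f, which depend on x continuously in L^1, while |phi| <= 1. *)
Lemma Splus_translation_cmeas : cmeasurable_fun setT (fun p : borel G * borel S =>
  crestrict (Splus mu K : set S) (fun phi : G -> R[i]^o => sphericalF mu f phi * phi p.1) p.2).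
Proof.
rewrite (_ : (fun p => _) = fun p => F p.1 p.2); last first.
  apply/funext => p; rewrite /F /crestrict; case: ifPn => //; rewrite inE => sphi.
  by rewrite (Splus_translation hG lcG hmu hK gel eC sphi).
split.
  apply: (@equicontinuous_measurable R G _ (borel S) C (fun x phi => Re (F x phi)) eC).
    by move=> x; case: (mF x).
  move=> x e /(eqF x); apply: filterS => x' h phi; rewrite -ReB.
  exact: le_trans (normr_Re_le _) (h phi).
apply: (@equicontinuous_measurable R G _ (borel S) C (fun x phi => Im (F x phi)) eC).
  by move=> x; case: (mF x).
move=> x e /(eqF x); apply: filterS => x' h phi; rewrite -ImB.
exact: le_trans (normr_Im_le _) (h phi).
Qed.

End Translation.

Hypothesis hsep : hseparable (L2K mu K) (L2inner mu).

(** Each phi has a nonzero integral against some f in Cc(G//K), and then against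
    all functions near f in L^2 with support in the same C m. *)
Lemma separating_sequence : exists s : nat -> G -> R[i], (forall n, CcK K (s n)) /\
  forall phi, Splus mu K phi -> exists n, sphericalF mu (s n) phi != 0.
Proof.
have sf := sesqui_L2K mu K.
pose A m := [set f : G -> R[i] | CcK K f /\ forall x, ~ C m x -> f x = 0].
have AL m : A m `<=` L2K mu K by move=> f [hf _]; exact: CcK_L2K.
have A0 m : A m !=set0.
  exists (fun=> 0); split=> //; split => //; first by move=> x; exact: cvg_cst.
  rewrite (_ : [set x | _] = set0) ?closure0; first exact: compact0.
  by apply/seteqP; split=> x //=; rewrite eqxx.
have /choice[s hs] m := hseparable_subset sf hsep (@AL m) (A0 m).
have A1 := A0 0%N; case: A1 => z [hz _].
exists (fun i => if unpickle i is Some (m, n) then s m n else z); split.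
  by move=> i; case: (unpickle i) => [[m n]|//]; have [/(_ n)[]] := hs m.
move=> phi sphi; have [cphi _ _ [f hf nf]] := Splus_spherical sphi.
have hg := CcK_inv hG hK hf; have cg := CcK_ccc hg; have [_ [D cD gD]] := cg.
have [m DC] := Csub cD.
have g0 x : ~ C m x -> f (x^-1)%g = 0 by move=> nC; apply: gD => /DC.
have cphiC := continuous_conj cphi.
have gE : sphericalF mu (fun x => f (x^-1)%g) phi = pairing mu f phi.
  by apply: (mp_cintegral minv (f := fun x => f x * phi x)); exact: (ccc_cmeas (cccM (CcK_ccc hf) cphi)).
pose c := crestrict (C m) phi.
have Lc : L2K mu K c := Splus_cut_L2K m sphi.
have [sA sdense] := hs m.
have pairc (h : G -> R[i]) : A m h -> L2inner mu h c = sphericalF mu h phi.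
  by move=> [_ h0]; rewrite pairing_cut// (sphericalF_conj sphi).
have Ag : A m (fun x => f (x^-1)%g) by split.
have d0 : 0 < normc (pairing mu f phi) / (hnorm (L2inner mu) c + 1).
  rewrite divr_gt0 ?ltr_wpDl ?hnorm_ge0//.
  by rewrite lt_neqAle eq_sym normc_eq0 nf normc_ge0.
have [n hn] := sdense _ Ag _ d0.
exists (pickle (m, n)); rewrite pickleK; apply/eqP => s0.
have := cauchy_schwarz sf (sfB sf (AL _ _ Ag) (AL _ _ (sA n))) Lc.
rewrite (ipBl sf (AL _ _ Ag) (AL _ _ (sA n)) Lc) !pairc// s0 subr0 gE.
move: hn; rewrite ltr_pdivlMr ?ltr_wpDl ?hnorm_ge0//.
move: (hnorm_ge0 (L2inner mu) c) (hnorm_ge0 (L2inner mu) ((fun x => f (x^-1)%g) - s m n)).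
move: (hnorm (L2inner mu) c) => a.
move: (hnorm (L2inner mu) _) (normc _) => b r a0 b0 h1 h2.
have : b * a <= b * (a + 1) by rewrite ler_wpM2l// lerDl.
by move=> h3; have := lt_le_trans h1 (le_trans h2 h3); rewrite ltxx.
Qed.

(** phi x is a quotient of measurable functions wherever the transform of some
    member of the separating sequence does not vanish at phi. *)
Lemma Splus_eval_cmeas : cmeasurable_fun setT (fun p : borel G * borel S =>
  crestrict (Splus mu K : set S) (fun phi : G -> R[i]^o => phi p.1) p.2).
Proof.
have [s [sC ss]] := separating_sequence.
pose g (p : borel G * borel S) : R[i] :=
  crestrict (Splus mu K : set S) (fun phi : G -> R[i]^o => phi p.1) p.2.
pose a n (p : borel G * borel S) : R[i] := sphericalF mu (s n) p.2.
have ma n : cmeasurable_fun setT (a n).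
  apply: (cmeas_comp (f := sphericalF mu (s n) : borel S -> R[i])).
    by apply: sphericalF_cmeas; exact: CcK_L1K.
  exact: measurable_snd.
pose h n (p : borel G * borel S) : R[i] :=
  crestrict (Splus mu K : set S) (fun phi : G -> R[i]^o => sphericalF mu (s n) phi * phi p.1) p.2
  * ((a n p)^* * ((normc (a n p) ^+ 2) `^ (-1))%:C).
have mh n : cmeasurable_fun setT (h n).
  apply: cmeasM; first exact: Splus_translation_cmeas.
  apply: cmeasM; first exact: cmeas_conj.
  apply: cmeas_real; apply: (measurableT_comp (measurable_powR _)).
  by apply: measurable_funX; exact: cmeas_normc.
have hE n p : a n p != 0 -> h n p = g p.
  move=> an0; rewrite /h /g /crestrict; case: ifP => _; last by rewrite mul0r.
  rewrite -/(a n p) powR_inv1 ?sqr_ge0//.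
  transitivity ((a n p * (a n p)^*) * ((normc (a n p) ^+ 2)^-1)%:C * p.2 p.1); first by ring.
  have n0 : normc (a n p) ^+ 2 != 0 by rewrite sqrf_eq0 normc_eq0.
  by rewrite mul_conjc -rmorphM/= mulfV// mul1r.
pose E i : set (borel G * borel S) := if i is n.+1 then [set p | 0 < normc (a n p)]
  else setT `*` ~` (Splus mu K : set (borel S)).
have mpos (r : borel G * borel S -> R) : measurable_fun setT r ->
    measurable [set p | 0 < r p].
  move=> mr; rewrite (_ : [set p | _] = r @^-1` `]0, +oo[%classic).
    by rewrite -[_ @^-1` _]setTI; apply: mr.
  by apply/seteqP; split=> p /=; rewrite in_itv/= andbT.
have mE i : measurable (E i).
  case: i => [|n] /=.
    by apply: measurableX => //; apply: measurableC; exact: Splus_measurable.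
  exact: mpos (cmeas_normc (ma n)).
have ET : setT = \bigcup_i E i.
  apply/seteqP; split=> [[x phi] _|//].
  have [sphi|nsphi] := pselect (Splus mu K phi); last by exists 0%N.
  have [n an] := ss _ sphi; exists n.+1 => //.
  by rewrite /E /mkset lt_neqAle normc_ge0 andbT eq_sym normc_eq0.
have key (r : R[i] -> R) : (forall n, measurable_fun setT (fun p => r (h n p))) ->
    measurable_fun setT (fun p => r (g p)).
  move=> mr; rewrite ET; apply/measurable_fun_bigcup => // -[|n].
    apply: (eq_measurable_fun (fun=> r 0)); last exact: measurable_cst.
    move=> p; rewrite inE => -[_ np]; rewrite /g /crestrict memNset//.
  apply: (eq_measurable_fun (fun p => r (h n p))); last exact: measurable_funS (mr n).
  by move=> p; rewrite inE => an0; rewrite hE// -normc_eq0 gt_eqF.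
by split; apply: key => n; case: (mh n).
Qed.

Variable nu : {measure set (borel S) -> \bar R}.
Hypothesis hnu : plancherel_measure nu.

(** The transform of a function of Cc(G//K) is square integrable, and the sets
    where one of the countably many transforms exceeds 1/k cover S^+. *)
Lemma plancherel_sigma_finite : sigma_finite setT nu.
Proof.
have [s [sC ss]] := separating_sequence.
have [_ nu0 _ [F [FL2 FE _ _]]] := hnu.
have mS := Splus_measurable.
have ms n := sphericalF_cmeas (CcK_L1K (sC n)).
have Ls n : (L2norm_sq nu (Splus mu K : set (borel S)) (sphericalF mu (s n) : borel S -> R[i]) < +oo)%E.
  have [mF LF] := FL2 _ (CcK_L2K (sC n)).
  rewrite (_ : L2norm_sq _ _ _ = L2norm_sq nu (Splus mu K : set (borel S)) (F (s n)))//.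
  rewrite /L2norm_sq; apply: ge0_ae_eq_integral => //.
  - by apply: measurable_funS (cmeas_enormc2 (ms n)).
  - apply/measurable_EFinP/measurable_funX.
    have mcF : cmeasurable_fun setT (crestrict (Splus mu K : set (borel S)) (F (s n))).
      case: mF => r i; split.
        by rewrite Re_crestrict; apply/(measurable_restrictT _ mS).
      by rewrite Im_crestrict; apply/(measurable_restrictT _ mS).
    apply: (eq_measurable_fun (fun x => normc (crestrict (Splus mu K : set (borel S)) (F (s n)) x))).
      by move=> x xS; rewrite /crestrict xS.
    exact: measurable_funS (cmeas_normc mcF).
  - by move=> x _; rewrite lee_fin sqr_ge0.
  - by move=> x _; rewrite lee_fin sqr_ge0.
  - have H := FE _ (CcK_L1K (sC n)) (CcK_L2K (sC n)).
    by apply: (ae_imp2 H H) => x E _ Sx; rewrite E.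
pose A n k : set (borel S) := [set phi | Splus mu K phi /\
  k.+1%:R^-1 < normc (sphericalF mu (s n) phi) ^+ 2].
have mA n k : measurable (A n k).
  rewrite (_ : A n k = (Splus mu K : set (borel S)) `&`
    (fun phi => normc (sphericalF mu (s n) phi) ^+ 2) @^-1` `]k.+1%:R^-1, +oo[%classic).
    apply: measurableI => //; rewrite -[_ @^-1` _]setTI.
    by apply: (measurable_funX 2 (cmeas_normc (ms n))).
  by apply/seteqP; split=> p [Sp h]; split => //; move: h; rewrite /= in_itv/= andbT.
have fA n k : (nu (A n k) < +oo)%E.
  have k0 : 0 < k.+1%:R^-1 :> R by rewrite invr_gt0.
  rewrite -(@lte_pmul2l _ (k.+1%:R^-1)%:E)// ?lte_fin//.
  rewrite [X in (_ < X)%E]gt0_muley ?lte_fin//.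
  apply: le_lt_trans (Ls n).
  rewrite -[A n k]setIT -integral_indic// -ge0_integralZl_EFin ?(ltW k0)//; last first.
    exact/measurable_EFinP/measurable_indic.
  rewrite L2norm_mkcond; apply: ge0_le_integral => //.
  - by apply/measurable_EFinP/measurable_funM => //; exact: measurable_indic.
  - by apply: cmeas_enormc2; apply: cmeas_crestrict.
  - move=> phi _; rewrite -EFinM lee_fin indicE /crestrict.
    have [[Sphi h]|nA] := pselect (A n k phi).
      by rewrite !mem_set ?mulr1 ?(ltW h).
    by rewrite (memNset nA) mulr0 sqr_ge0.
(* the complement of S^+ is a null set, so it may be joined to every piece *)
exists (fun i => ~` (Splus mu K : set (borel S)) `|`
    (if unpickle i is Some (n, k) then A n k else set0)).
  apply/seteqP; split=> // phi _.
  have [sphi|nsphi] := pselect (Splus mu K phi); last by exists 0%N => //; left.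
  have [n sn] := ss _ sphi.
  have n0 : 0 < normc (sphericalF mu (s n) phi) ^+ 2.
    by rewrite exprn_gt0// lt_neqAle normc_ge0 andbT eq_sym normc_eq0.
  have [k _ /(_ k (leqnn _)) /= hk] := near_infty_natSinv_lt (PosNum n0).
  by exists (pickle (n, k)) => //; right; rewrite pickleK.
move=> i; split.
  apply: measurableU; first exact: measurableC.
  by case: (unpickle i) => [[n k]|].
apply: le_lt_trans (measureU2 _ _ _) _.
- exact: measurableC.
- by case: (unpickle i) => [[n k]|].
- rewrite [X in (X + _)%E](_ : _ = 0%E); last exact: nu0.
  rewrite add0e; case: (unpickle i) => [[n k]|]; first exact: fA.
  by rewrite measure0.
Qed.

End PositiveDefiniteSphericalFunctions.

(** * Measurable versions and superpositions *)

(** A real function read off from countably many of its superlevel sets, those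
    at the levels q i. Any measurable sets A i may be plugged in for these, and
    the function stays measurable. *)
Definition from_levels (T : Type) (R : realType) (q : nat -> R) (A : nat -> set T)
  (x : T) : R := fine (esups (fun i => if x \in A i then (q i)%:E else -oo%E) 0%N).

Lemma measurable_from_levels d (T : measurableType d) (R : realType) (q : nat -> R)
    (A : nat -> set T) : (forall i, measurable (A i)) ->
  measurable_fun setT (from_levels q A).
Proof.
move=> mA; apply: (measurableT_comp (f := fine)) => //.
apply: (measurable_fun_esups (f := fun i x => if x \in A i then (q i)%:E else -oo%E)) => i.
apply: measurable_fun_ifT => //.
apply: (measurable_fun_bool true); rewrite setTI (_ : _ @^-1` _ = A i)//.
by apply/seteqP; split=> x h; [exact: set_mem h|exact: mem_set h].
Qed.

Lemma from_levels_superlevel (T : Type) (R : realType) (q : nat -> R) (r : T -> R)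
    (A : nat -> set T) (x : T) : (forall a b, a < b -> exists i, a < q i < b) ->
  (forall i, A i x <-> q i < r x) -> from_levels q A x = r x.
Proof.
move=> dq Ar; rewrite /from_levels [esups _ _](_ : _ = (r x)%:E)//.
apply/eqP; rewrite eq_le; apply/andP; split.
  apply: ge_ereal_sup => _ [i _ <-]; case: ifP => [|_]; last exact: leNye.
  by rewrite inE => /Ar h; rewrite lee_fin ltW.
rewrite leNgt; apply/negP => h.
have [b brx bsup] : exists2 b : R, b < r x & (esups (fun i => if x \in A i then (q i)%:E else -oo%E) 0%N <= b%:E)%E.
  move: h; case: (esups _ _) => [b||] //= h.
    by exists b.
  by exists (r x - 1); [rewrite ltrBlDr ltrDl|exact: leNye].
have [i /andP[bq qr]] := dq _ _ brx.
have : ((q i)%:E <= esups (fun i => if x \in A i then (q i)%:E else -oo%E) 0%N)%E.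
  apply: ereal_sup_ubound; exists i => //.
  by rewrite mem_set//; exact/Ar.
by move=> /le_trans/(_ bsup); rewrite lee_fin leNgt bq.
Qed.

Lemma rational_levels (R : realType) : exists q : nat -> R,
  forall a b, a < b -> exists i, a < q i < b.
Proof.
exists (fun i => if unpickle i is Some z then ratr (z : rat) else 0) => a b /rat_in_itvoo[z].
by rewrite in_itv/= => h; exists (pickle z); rewrite pickleK.
Qed.

Section QuotientMeasurable.
Context (R : realType) (G : topGroupType) (mu : {measure set (borel G) -> \bar R}).
Hypotheses (hG : hausdorff_space G) (lcG : locally_compact [set: G]).
Hypothesis hmu : left_haar mu.
Variable C : nat -> set G.
Hypothesis eC : exhaustion C.
Hypothesis Csub : forall Q, compact Q -> exists n, Q `<=` C n.

Local Notation quot := (fun p : borel G * borel G => ((p.1 : G)^-1 * (p.2 : G))%g).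

Let good (A : set (borel G)) := exists A' : set (borel G),
  [/\ measurable A', measurable (quot @^-1` A') & {ae mu, forall x, A x <-> A' x}].

Let good_bigcup (A : nat -> set (borel G)) : (forall n, good (A n)) -> good (\bigcup_n A n).
Proof.
move=> /choice[A' hA]; exists (\bigcup_n A' n); split.
- by apply: bigcupT_measurable => n; case: (hA n).
- by rewrite preimage_bigcup; apply: bigcupT_measurable => n; case: (hA n).
- have : {ae mu, forall x, forall n, A n x <-> A' n x}.
    by apply/ae_foralln => n; case: (hA n).
  move=> H; apply: (ae_imp2 H H) => x h _.
  by split=> -[n _ /h]; exists n.
Qed.

Let good_sigma_algebra : sigma_algebra setT good.
Proof.
split.
- by exists set0; split; rewrite ?preimage_set0//; exact: aeW.
- move=> A [A' [mA' mqA' AA']]; exists (~` A'); split.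
  + exact: measurableC.
  + by rewrite preimage_setC; exact: measurableC.
  + apply: (ae_imp2 AA' AA') => x h _; rewrite setTD /=.
    by split=> nA /h.
- exact: good_bigcup.
Qed.

(** By inner regularity there are continuous functions c_n vanishing off U and
    nonzero on all of U up to measure 1/n. The union of the sets where c_n is
    nonzero is the required version of U. *)
Let good_open_finite (U : set G) : open U -> (mu U < +oo)%E -> good U.
Proof.
move=> oU fU; have [[_ _ inner_reg] _ _] := hmu.
have mU := borel_open_measurable oU.
have finU : mu U \is a fin_num by rewrite ge0_fin_numE.
have /choice[c hc] (n : nat) : exists c : G -> R, [/\ continuous c,
    forall x, c x != 0 -> U x & (mu U - (n.+1%:R^-1)%:E < mu [set x | (c x != 0)%R])%E].
  have e0 : 0 < n.+1%:R^-1 :> R by rewrite invr_gt0.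
  have finS : ereal_sup [set mu Q | Q in [set Q : set G | compact Q /\ Q `<=` U]] \is a fin_num.
    by rewrite -inner_reg.
  have [_ [Q [cQ QU] <-]] := ub_ereal_sup_adherent e0 finS; rewrite -inner_reg// => hQ.
  have [c [cc0 c01 c1 cU _]] := compact_urysohn hG lcG R cQ oU QU.
  exists c; split => //.
    by move=> x; apply: contra_neqP => /cU.
  apply: lt_le_trans hQ _; apply: le_measure; rewrite ?inE.
  - by apply: borel_closed_measurable; exact: compact_closed.
  - apply: borel_open_measurable; rewrite (_ : [set x | _] = c @^-1` [set~ 0]).
      by move/continuousP : cc0; apply; rewrite openC; exact: closed_eq.
    by apply/seteqP; split=> x /= /eqP.
  - by move=> x Qx /=; rewrite c1// oner_eq0.
have oc n : open (c n @^-1` [set~ 0]).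
  have [cn _ _] := hc n; move/continuousP : cn; apply.
  by rewrite openC; exact: closed_eq.
pose A' : set (borel G) := \bigcup_n (c n @^-1` [set~ 0]).
have mA' : measurable A'.
  by apply: bigcupT_measurable => n; exact: borel_open_measurable.
have A'U : A' `<=` U.
  by move=> x [n _ /= /eqP cx]; have [_ h _] := hc n; exact: h.
exists A'; split => //.
  rewrite preimage_bigcup; apply: bigcupT_measurable => n.
  have [cn _ _] := hc n.
  have cq : continuous (fun p : G * G => c n (p.1^-1 * p.2)%g).
    move=> p; apply: (cvg_comp (fun p : G * G => (p.1^-1 * p.2)%g) (c n)); last exact: cn.
    apply: (continuousM_g (X := (G * G)%type)); last by move=> q; exact: cvg_snd.
    by apply: (continuousV_g (X := (G * G)%type)) => q; exact: cvg_fst.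
  have mq := continuous_prod_measurable eC eC cq.
  rewrite -[_ @^-1` _]setTI; apply: (mq measurableT [set~ 0]).
  by apply: measurableC; exact: measurable_set1.
have UA0 : mu (U `\` A') = 0%E.
  apply/eqP; rewrite eq_le measure_ge0 andbT; apply/lee_addgt0Pr => e e0.
  have [n _ /(_ n (leqnn _)) /= hn] := near_infty_natSinv_lt (PosNum e0).
  rewrite add0e; have [_ _ hcn] := hc n.
  have mS : measurable ([set x | c n x != 0] : set (borel G)).
    rewrite (_ : [set x | _] = c n @^-1` [set~ 0]); first exact: borel_open_measurable.
    by apply/seteqP; split=> x /= /eqP.
  have SU : [set x | c n x != 0] `<=` U by have [_ h _] := hc n.
  apply: (@le_trans _ _ (mu (U `\` [set x | c n x != 0]))).
    apply: le_measure; rewrite ?inE; [exact: measurableD|exact: measurableD|].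
    by move=> x [Ux nA]; split => // cx; apply: nA; exists n => //=; exact/eqP.
  rewrite measureD//.
  rewrite setIidr// leeBlDl//; last first.
    by rewrite ge0_fin_numE//; apply: le_lt_trans fU; apply: le_measure; rewrite ?inE.
  apply: (@le_trans _ _ (mu [set x | (c n x != 0)%R] + (n.+1%:R^-1)%:E)%E).
    by rewrite -leeBlDr// ltW.
  by rewrite leeD2l// lee_fin ltW.
exists (U `\` A'); split; [exact: measurableD|exact: UA0|].
move=> x /= nUA; apply: contrapT => h; apply: nUA; split=> [Ux|/A'U//].
by apply: contrapT => nA; apply: h.
Qed.

Let good_measurable (A : set (borel G)) : measurable A -> good A.
Proof.
apply: (smallest_sub good_sigma_algebra) => U oU.
rewrite (_ : U = \bigcup_n (U `&` interior (C n))).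
  apply: good_bigcup => n; apply: good_open_finite.
    by apply: openI => //; exact: open_interior.
  have [cC clC _ _] := eC.
  apply: le_lt_trans (haar_compact hmu (cC n)); apply: le_measure; rewrite ?inE.
  - by apply: borel_open_measurable; apply: openI => //; exact: open_interior.
  - exact: borel_closed_measurable.
  - by move=> x [_ /interior_subset].
apply/seteqP; split=> [x Ux|x [n _ []]//].
have [V [oV V1 [Q cQ VQ]]] := unit_compact_nbhs lcG.
have c1 : compact [set (x : G)] by exact: compact_set1.
have [n QC] := Csub (compact_mulset c1 cQ).
exists n => //; split => //; rewrite /interior.
apply: (filterS (P := mulset [set (x : G)] V)).
  by move=> _ [[a v] [/= -> Vv] <-]; apply: QC; apply: mulsetP => //; exact: VQ.
apply: open_nbhs_nbhs; split; first exact: open_mulset.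
by exists (x : G, 1%g) => //=; rewrite mulg1.
Qed.

(** When G is not second countable, the Borel sets of G x G may be more than
    the product measurable ones, and (t, x) |-> r (t^-1 x) need not be product
    measurable for a Borel function r. It is after changing r on a null set. *)
Lemma quotient_measurable_version (r : G -> R) : measurable_fun setT (r : borel G -> R) ->
  exists r' : G -> R, [/\ measurable_fun setT (r' : borel G -> R),
    measurable_fun setT (fun p => r' (quot p)) & {ae mu, forall x : borel G, r x = r' x}].
Proof.
move=> mr; have [q dq] := rational_levels R.
have /choice[A hA] (i : nat) : good ((r : borel G -> R) @^-1` `]q i, +oo[%classic).
  by apply: good_measurable; rewrite -[_ @^-1` _]setTI; apply: mr.
exists (from_levels q A); split.
- by apply: measurable_from_levels => i; case: (hA i).
- rewrite (_ : (fun p => _) = from_levels q (fun i => quot @^-1` (A i)))//.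
  by apply: measurable_from_levels => i; case: (hA i).
- have : {ae mu, forall x, forall i, ((r : borel G -> R) @^-1` `]q i, +oo[%classic) x <-> A i x}.
    by apply/ae_foralln => i; case: (hA i).
  move=> H; apply: (ae_imp2 H H) => x h _; apply/esym/from_levels_superlevel => // i.
  by rewrite -h /= in_itv/= andbT.
Qed.

Lemma quotient_cmeasurable_version (f : G -> R[i]) : cmeasurable_fun setT (f : borel G -> R[i]) ->
  exists f' : G -> R[i], [/\ cmeasurable_fun setT (f' : borel G -> R[i]),
    cmeasurable_fun setT (fun p => f' (quot p)) & {ae mu, forall x : borel G, f x = f' x}].
Proof.
move=> [/quotient_measurable_version[r [mr mrq fr]] /quotient_measurable_version[s [ms msq fs]]].
exists (fun x => r x +i* s x); split => //.
by apply: (ae_imp2 fr fs) => x h1 h2; apply: complex_eqP.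
Qed.

End QuotientMeasurable.

Lemma inL1_mkcond d (T : measurableType d) (R : realType) (m : {measure set T -> \bar R})
    (D : set T) (f : T -> R[i]) : measurable D -> inL1 m D f -> inL1 m setT (crestrict D f).
Proof.
move=> mD [[r i] Lf]; split; last by rewrite -L1norm_mkcond.
split; first by rewrite Re_crestrict; apply/(measurable_restrictT _ mD).
by rewrite Im_crestrict; apply/(measurable_restrictT _ mD).
Qed.

(** Superpositions y x = int a z B(z, x) dz of functions B(z, .) in the unit
    ball of L^2, with a integrable weight. *)
Section Superposition.
Context d1 d2 (Z : measurableType d1) (X : measurableType d2) (R : realType).
Context (P : {measure set Z -> \bar R}) (m : {measure set X -> \bar R}).
Hypotheses (sP : sigma_finite setT P) (sm : sigma_finite setT m).
Variables (a : Z -> R[i]) (B : Z * X -> R[i]).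
Hypotheses (La : inL1 P setT a) (mB : cmeasurable_fun setT B).
Hypothesis B1 : forall z, (L2norm_sq m setT (fun x => B (z, x)) <= 1)%E.

Let y x := cintegral P setT (fun z => a z * B (z, x)).
Let N x := (\int[P]_z (normc (a z) * normc (B (z, x)) ^+ 2)%:E)%E.

Let ma : cmeasurable_fun setT a. Proof. by case: La. Qed.
Let mBz z : cmeasurable_fun setT (fun x => B (z, x)).
Proof. by apply: (cmeas_comp mB); exact: measurable_pair1. Qed.
Let mBx x : cmeasurable_fun setT (fun z => B (z, x)).
Proof. by apply: (cmeas_comp mB); exact: measurable_pair2. Qed.
Let LB z : inL2 m setT (fun x => B (z, x)).
Proof. by split => //; apply: le_lt_trans (B1 z) _; rewrite ltry. Qed.

Let mab (x : X) : measurable_fun setT (fun z => (normc (a z) * normc (B (z, x)) ^+ 2)%:E).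
Proof.
apply/measurable_EFinP/measurable_funM; first exact: cmeas_normc.
by apply: measurable_funX; exact: cmeas_normc.
Qed.

Let mabp : measurable_fun setT (fun p : X * Z => (normc (a p.2) * normc (B (p.2, p.1)) ^+ 2)%:E).
Proof.
apply/measurable_EFinP/measurable_funM.
  by apply: cmeas_normc; apply: (cmeas_comp ma); exact: measurable_snd.
by apply: measurable_funX; apply: cmeas_normc; exact: cmeas_swap.
Qed.

Let mN : measurable_fun setT N.
Proof.
apply: (measurable_fubini_sf sP mabp) => p.
by rewrite lee_fin mulr_ge0 ?sqr_ge0 ?normc_ge0.
Qed.

Let N0 x : (0 <= N x)%E.
Proof. by apply: integral_ge0 => z _; rewrite lee_fin mulr_ge0 ?sqr_ge0 ?normc_ge0. Qed.

Let intN : (\int[m]_x N x < +oo)%E.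
Proof.
have [_ +] := La; apply: le_lt_trans; rewrite /N.
rewrite (tonelli sm sP mabp); last first.
  by move=> p; rewrite lee_fin mulr_ge0 ?sqr_ge0 ?normc_ge0.
apply: ge0_le_integral => //=.
- by move=> z _; apply: integral_ge0 => x _; rewrite lee_fin mulr_ge0 ?sqr_ge0 ?normc_ge0.
- apply: (measurable_fubini_sf sm (f := fun p => (normc (a p.1) * normc (B (p.1, p.2)) ^+ 2)%:E)).
    apply/measurable_EFinP/measurable_funM.
      by apply: cmeas_normc; apply: (cmeas_comp ma); exact: measurable_fst.
    apply: measurable_funX; apply: cmeas_normc; rewrite (_ : (fun p => _) = B)//.
    by apply/funext => -[].
  by move=> p; rewrite lee_fin mulr_ge0 ?sqr_ge0 ?normc_ge0.
- exact: cmeas_enormc.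
- move=> z _; under eq_integral do rewrite EFinM.
  rewrite ge0_integralZl_EFin ?normc_ge0//; last 2 first.
  - by move=> x _; rewrite lee_fin sqr_ge0.
  - exact: cmeas_enormc2.
  by rewrite -[leRHS]mule1 lee_wpmul2l ?lee_fin ?normc_ge0//; exact: B1.
Qed.

Let Nfin : {ae m, forall x, (N x < +oo)%E}.
Proof.
have : m.-integrable setT N.
  apply/integrableP; split => //.
  rewrite (_ : (\int[m]_x _)%E = (\int[m]_x N x)%E)//.
  by apply: eq_integral => x _; rewrite gee0_abs.
move/integrable_ae => /(_ measurableT) H.
by apply: (ae_imp2 H H) => x /(_ I); rewrite ge0_fin_numE.
Qed.

Let L1_of_fin x : (N x < +oo)%E -> inL1 P setT (fun z => a z * B (z, x)).
Proof.
move=> Nx; apply: (inL1_le (g := fun z => (normc (a z))%:E +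
    (normc (a z) * normc (B (z, x)) ^+ 2)%:E)%E).
- exact: cmeasM.
- by apply: emeasurable_funD => //; exact: cmeas_enormc.
- move=> z; rewrite Normc.normcM -EFinD lee_fin.
  rewrite -[X in _ <= X + _]mulr1 -mulrDr ler_wpM2l ?normc_ge0//.
  have := sqr_ge0 (normc (B (z, x)) - 1); have := normc_ge0 (B (z, x)).
  by move: (normc _) => v v0; rewrite !expr2; nra.
- rewrite ge0_integralD//; last 3 first.
  + by move=> z _; rewrite lee_fin normc_ge0.
  + exact: cmeas_enormc.
  + by move=> z _; rewrite lee_fin mulr_ge0 ?sqr_ge0 ?normc_ge0.
  by rewrite lte_add_pinfty//; case: La.
Qed.

Lemma superposition_inL1 : {ae m, forall x, inL1 P setT (fun z => a z * B (z, x))}.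
Proof. by apply: (ae_imp2 Nfin Nfin) => x /L1_of_fin. Qed.

(** Cauchy-Schwarz for the product of |a|^(1/2) and |a|^(1/2) |B(., x)|. *)
Let y_le x : (N x < +oo)%E ->
  ((normc (y x) ^+ 2)%:E <= L1norm P setT a * N x)%E.
Proof.
move=> Nx; have Lx := L1_of_fin Nx.
have ms : measurable_fun setT (fun z => Num.sqrt (normc (a z)) : R).
  rewrite (_ : (fun z => _) = Num.sqrt \o (fun z => normc (a z)))//.
  apply: measurableT_comp; last exact: cmeas_normc.
  by apply: continuous_measurable_fun; exact: sqrt_continuous.
pose f1 z : R[i] := (Num.sqrt (normc (a z)))%:C.
pose f2 z : R[i] := (Num.sqrt (normc (a z)) * normc (B (z, x)))%:C.
have n1 z : normc (f1 z) ^+ 2 = normc (a z).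
  by rewrite normc_real real_normK ?num_real// sqr_sqrtr ?normc_ge0.
have n2 z : normc (f2 z) ^+ 2 = normc (a z) * normc (B (z, x)) ^+ 2.
  by rewrite normc_real real_normK ?num_real// exprMn sqr_sqrtr ?normc_ge0.
have L1E : L2norm_sq P setT f1 = L1norm P setT a.
  by apply: eq_integral => z _; rewrite n1.
have L2E : L2norm_sq P setT f2 = N x.
  by apply: eq_integral => z _; rewrite n2.
have Lf1 : inL2 P setT f1.
  by split; [exact: cmeas_real|rewrite L1E; case: La].
have Lf2 : inL2 P setT f2.
  split; last by rewrite L2E.
  by apply: cmeas_real; apply: measurable_funM => //; exact: cmeas_normc.
have := cauchy_schwarz (sesqui_inner P) Lf1 Lf2.
rewrite -L1E -L2E !L2norm_sqE// -EFinM lee_fin -exprMn => cs.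
rewrite ler_pXn2r ?nnegrE ?normc_ge0 ?mulr_ge0 ?hnorm_ge0//.
apply: le_trans cs; rewrite -lee_fin; apply: le_trans (normc_cintegral_le Lx) _.
have ab := inL1_normc Lx.
rewrite (_ : L1norm _ _ _ = (\int[P]_z normc (a z * B (z, x)))%:E); last first.
  by rewrite /Rintegral fineK//; exact: integrable_fin_num.
rewrite lee_fin; apply: le_trans _ (Re_le_normc _).
rewrite /inner /cintegral /= le_eqVlt; apply/orP; left; apply/eqP/eq_Rintegral => z _.
by rewrite Normc.normcM mul0r subr0 mulrA -expr2 sqr_sqrtr ?normc_ge0.
Qed.

Lemma superposition_cmeas : cmeasurable_fun setT y.
Proof.
apply: (cmeas_cintegral_sf sP (F := fun p : X * Z => a p.2 * B (p.2, p.1))).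
apply: cmeasM; last exact: cmeas_swap.
by apply: (cmeas_comp ma); exact: measurable_snd.
Qed.

Lemma superposition_inL2 : inL2 m setT y.
Proof.
have W0 : (0 <= L1norm P setT a)%E by apply: integral_ge0 => z _; rewrite lee_fin normc_ge0.
have Wf : L1norm P setT a \is a fin_num by rewrite ge0_fin_numE//; case: La.
(* adding 1 keeps the bound true at the points where N is infinite *)
pose A := fine (L1norm P setT a) + 1.
have A0 : 0 < A by rewrite ltr_wpDl ?fine_ge0.
apply: (inL2_le (g := fun x => A%:E * N x)%E).
- exact: superposition_cmeas.
- exact: measurable_funeM.
- move=> x; have [Nx|] := ltP (N x) +oo%E.
    apply: le_trans (y_le Nx) _; apply: lee_wpmul2r => //.
    by rewrite -[leLHS]fineK// lee_fin lerDl.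
  by rewrite leye_eq => /eqP ->; rewrite gt0_muley ?lte_fin// leey.
- by rewrite ge0_integralZl_EFin ?(ltW A0)// lte_mul_pinfty// lee_fin ltW.
Qed.

Lemma superposition_inner g : inL2 m setT g ->
  inner m y g = cintegral P setT (fun z => a z * inner m (fun x => B (z, x)) g).
Proof.
move=> Lg; have [mg gi] := Lg.
have mF : cmeasurable_fun setT (fun p : Z * X => a p.1 * (B p * (g p.2)^*)).
  apply: cmeasM; first by apply: (cmeas_comp ma); exact: measurable_fst.
  by apply: cmeasM => //; apply: cmeas_conj; apply: (cmeas_comp mg); exact: measurable_snd.
have LBg z : inL1 m setT (fun x => B (z, x) * (g x)^*).
  by apply: inL2M => //; exact: inL2_conj.
have mFn : measurable_fun setT (fun p : Z * X => (normc (a p.1 * (B p * (g p.2)^*)))%:E).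
  exact: cmeas_enormc.
have fin : (\int[P]_z \int[m]_x (normc (a z * (B (z, x) * (g x)^*)))%:E < +oo)%E.
  pose M := fine (1 + L2norm_sq m setT g)%E.
  have g0 : (0 <= L2norm_sq m setT g)%E.
    by apply: integral_ge0 => x _; rewrite lee_fin sqr_ge0.
  have ME : (1 + L2norm_sq m setT g)%E = M%:E.
    by rewrite fineK// fin_numD/= ge0_fin_numE.
  have M0 : 0 <= M by rewrite fine_ge0// adde_ge0.
  apply: (@le_lt_trans _ _ (\int[P]_z (M%:E * (normc (a z))%:E))%E); last first.
    rewrite ge0_integralZl_EFin//; last 2 first.
    + by move=> z _; rewrite lee_fin normc_ge0.
    + exact: cmeas_enormc.
    by rewrite lte_mul_pinfty// ?lee_fin//; case: La.
  apply: ge0_le_integral => //.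
  - by move=> z _; apply: integral_ge0 => x _; rewrite lee_fin normc_ge0.
  - apply: (measurable_fubini_sf sm mFn) => p.
    by rewrite lee_fin normc_ge0.
  - by apply: measurable_funeM; exact: cmeas_enormc.
  move=> z _; under eq_integral do rewrite Normc.normcM EFinM.
  rewrite ge0_integralZl_EFin ?normc_ge0//; last 2 first.
  - by move=> x _; rewrite lee_fin normc_ge0.
  - by apply: cmeas_enormc; case: (LBg z).
  rewrite muleC; apply: lee_wpmul2r; first by rewrite lee_fin normc_ge0.
  apply: (@le_trans _ _ (\int[m]_x ((normc (B (z, x)) ^+ 2)%:E + (normc (g x) ^+ 2)%:E))%E).
    apply: ge0_le_integral => //.
    + by move=> x _; rewrite lee_fin normc_ge0.
    + by apply: cmeas_enormc; case: (LBg z).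
    + by apply: emeasurable_funD; exact: cmeas_enormc2.
    + move=> x _; rewrite Normc.normcM normc_conj -EFinD lee_fin.
      have := normc_ge0 (g x); have := normc_ge0 (B (z, x)).
      move: (normc _) (normc _) => u v u0 v0; nra.
  rewrite ge0_integralD//; try exact: cmeas_enormc2; try by move=> x _; rewrite lee_fin sqr_ge0.
  by rewrite -ME leeD2r//; exact: B1.
transitivity (cintegral m setT (fun x => cintegral P setT (fun z => a z * (B (z, x) * (g x)^*)))).
  apply: ae_eq_cintegral.
  - by apply: cmeasM; [exact: superposition_cmeas|exact: cmeas_conj].
  - exact: (cmeas_cintegral_sf sP (F := fun p => a p.2 * (B (p.2, p.1) * (g p.1)^*)) (cmeas_swap mF)).
  - apply: (ae_imp2 superposition_inL1 superposition_inL1) => x Lx _.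
    rewrite mulrC -cintegralZ//; congr cintegral; apply/funext => z; ring.
rewrite -(cfubini_sf sP sm mF fin).
congr cintegral; apply/funext => z.
transitivity (a z * cintegral m setT (fun x => B (z, x) * (g x)^*)) => //.
exact: (cintegralZ (a z) (LBg z)).
Qed.

End Superposition.

(** * The localization operator *)

Lemma product_sigma_finite d1 d2 (T1 : measurableType d1) (T2 : measurableType d2)
    (R : realType) (m1 : {sigma_finite_measure set T1 -> \bar R})
    (m2 : {sigma_finite_measure set T2 -> \bar R}) : sigma_finite setT (m1 \x m2)%E.
Proof.
have [F FT Foo] := sigma_finiteT m1; have [H HT Hoo] := sigma_finiteT m2.
exists (fun i => if unpickle i is Some (k, l) then F k `*` H l else set0).
  apply/seteqP; split=> // -[x y] _.
  have [k _ Fx] : (\bigcup_k F k) x by rewrite -FT.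
  have [l _ Hy] : (\bigcup_l H l) y by rewrite -HT.
  by exists (pickle (k, l)) => //; rewrite pickleK.
move=> i; case: (unpickle i) => [[k l]|]; last by rewrite measure0.
have [mF fF] := Foo k; have [mH fH] := Hoo l.
split; first exact: measurableX.
by rewrite product_measure1E// lte_mul_pinfty// ge0_fin_numE.
Qed.

Section Localization.
Context (R : realType) (G : topGroupType) (mu : {measure set (borel G) -> \bar R}).
Variable K : set G.
Local Notation S := (Splus_space mu K).
Variables (nu : {measure set (borel S) -> \bar R}) (alpha : G -> G) (delta : R).
Variables (theta : G -> R[i]) (u : G * (G -> R[i]^o) -> R[i]).
Hypotheses (hG : hausdorff_space G) (lcG : locally_compact [set: G]).
Hypotheses (hmu : left_haar mu) (hK : compact_subgroup K).
Hypothesis gel : gelfand_pair mu K.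
Hypothesis hnu : plancherel_measure nu.
Hypothesis hsep : hseparable (L2K mu K) (L2inner mu).
Hypothesis halpha : topological_automorphism alpha.
Hypothesis hdelta : modulus_of mu alpha delta.
Hypothesis Ltheta : L2K mu K theta.
Hypothesis theta1 : hnorm (L2inner mu) theta = 1.
Hypothesis Lu : inL1_symbol nu u.
Variable C : nat -> set G.
Hypothesis eC : exhaustion C.
Hypothesis Cbi : forall n, biinvariant_set K (C n).
Hypothesis Csub : forall Q, compact Q -> exists n, Q `<=` C n.

Let sfm : sigma_finite setT mu. Proof. by apply: haar_sigma_finite; eassumption. Qed.
Let snu : sigma_finite setT nu.
Proof. exact: (plancherel_sigma_finite hG lcG hmu hK gel eC Cbi Csub hsep hnu). Qed.
Let mleft := haar_left hmu.
Let mconv := haar_conv hG lcG hmu hK eC gel.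
Let mright := haar_right hG lcG hmu hK eC gel.
Let mS : measurable (Splus mu K : set (borel S)). Proof. exact: Splus_measurable. Qed.

Local Notation Z := (borel G * borel S)%type.

Let P : {measure set Z -> \bar R} := (sfpack sfm \x sfpack snu)%E.
Let sP : sigma_finite setT P. Proof. exact: (product_sigma_finite (sfpack sfm) (sfpack snu)). Qed.

Let w : Z -> R[i] := crestrict (setT `*` (Splus mu K : set (borel S))) u.
Let Lw : inL1 P setT w.
Proof. by apply: inL1_mkcond; [apply: measurableX|exact: Lu]. Qed.
Let mw : cmeasurable_fun setT w. Proof. by case: Lw. Qed.

Let eta (x : G) : R[i] := (Num.sqrt delta)%:C * theta (alpha x).

Let meta : cmeasurable_fun setT (eta : borel G -> R[i]).
Proof.
apply: cmeasZ; apply: (cmeas_comp (f := theta : borel G -> R[i])).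
  by case: Ltheta => -[].
by apply: borel_map_measurable; case: halpha.
Qed.

Let eta1 : L2norm_sq mu setT (eta : borel G -> R[i]) = 1%E.
Proof.
have [d0 dE] := hdelta; have [Lt _] := Ltheta; have [mt _] := Lt.
have mta : cmeasurable_fun setT ((fun x : G => theta (alpha x)) : borel G -> R[i]).
  by apply: (cmeas_comp mt); apply: borel_map_measurable; case: halpha.
rewrite L2normZ// normc_real real_normK ?num_real// sqr_sqrtr ?ltW//.
rewrite /L2norm_sq (dE (fun x => (normc (theta x) ^+ 2)%:E)); last 2 first.
- exact: cmeas_enormc2.
- by move=> x; rewrite lee_fin sqr_ge0.
rewrite muleA -EFinM mulfV ?gt_eqF// mul1e.
by rewrite -[LHS]/(L2norm_sq mu setT theta) L2norm_sqE// -/(L2inner mu) theta1 expr1n.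
Qed.

(** The function xi is a version of eta for which (t, x) |-> xi (t^-1 x) is
    product measurable. B ((t, phi), x) below stands for the value of the atom
    theta_{alpha, phi, t} at x, made to vanish for phi outside S^+. *)
Section Version.
Variable xi : G -> R[i].
Hypothesis mxi : cmeasurable_fun setT (xi : borel G -> R[i]).
Hypothesis mxiq : cmeasurable_fun setT
  (fun p : borel G * borel G => xi ((p.1 : G)^-1 * (p.2 : G))%g).
Hypothesis eta_xi : {ae mu, forall x : borel G, eta x = xi x}.

Let E (x : G) (phi : S) : R[i] :=
  crestrict (Splus mu K : set S) (fun phi : G -> R[i]^o => phi x) phi.
Let B (q : Z * borel G) : R[i] := E q.2 q.1.2 * xi ((q.1.1 : G)^-1 * (q.2 : G))%g.

Let mE : cmeasurable_fun setT (fun p : borel G * borel S => E p.1 p.2).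
Proof. exact: (Splus_eval_cmeas hG lcG hmu hK gel eC Cbi Csub hsep). Qed.

Let mB : cmeasurable_fun setT B.
Proof.
apply: cmeasM.
  apply: (cmeas_comp mE (h := fun q : Z * borel G => (q.2, q.1.2))).
  apply: measurable_fun_pair; first exact: measurable_snd.
  by apply: (measurableT_comp measurable_snd); exact: measurable_fst.
apply: (cmeas_comp mxiq (h := fun q : Z * borel G => (q.1.1, q.2))).
apply: measurable_fun_pair; last exact: measurable_snd.
by apply: (measurableT_comp measurable_fst); exact: measurable_fst.
Qed.

Let E1 x phi : normc (E x phi) <= 1.
Proof.
rewrite /E /crestrict; case: ifPn => [|_]; last by rewrite Normc.normc0.
by rewrite inE => sphi; exact: (Splus_le1 hG lcG hmu hK gel eC sphi).
Qed.

Let B1 z : (L2norm_sq mu setT (fun x => B (z, x)) <= 1)%E.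
Proof.
have mz : cmeasurable_fun setT (fun x => B (z, x)).
  by apply: (cmeas_comp mB); exact: measurable_pair1.
have mx : cmeasurable_fun setT (fun x : borel G => xi ((z.1 : G)^-1 * (x : G))%g).
  by apply: (cmeas_comp mxi); case: (mleft (z.1 : G)^-1%g).
rewrite -eta1 (ae_eq_L2norm meta mxi eta_xi) /L2norm_sq.
rewrite -(mp_ge0_integral (mleft (z.1 : G)^-1%g) (f := fun x => (normc (xi x) ^+ 2)%:E)); last 2 first.
- exact: cmeas_enormc2.
- by move=> x; rewrite lee_fin sqr_ge0.
apply: ge0_le_integral => //.
- by move=> x _; rewrite lee_fin sqr_ge0.
- exact: cmeas_enormc2.
- exact: cmeas_enormc2.
- move=> x _; rewrite lee_fin ler_pXn2r ?nnegrE ?normc_ge0// Normc.normcM.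
  by rewrite ler_piMl ?normc_ge0.
Qed.

Let LB z : inL2 mu setT (fun x => B (z, x)).
Proof.
split; last by apply: le_lt_trans (B1 z) _; rewrite ltry.
by apply: (cmeas_comp mB); exact: measurable_pair1.
Qed.

Let hB1 z : hnorm (L2inner mu) (fun x : G => B (z, x)) <= 1.
Proof.
have := B1 z; rewrite (L2norm_sqE (LB z)) lee_fin => h.
by rewrite -(ler_pXn2r (n := 2)) ?nnegrE ?hnorm_ge0// expr1n.
Qed.

Let SF (f : G -> R[i]) (z : Z) : R[i] := L2inner mu f (fun x => B (z, x)).

Let mSF f : inL2 mu setT (f : borel G -> R[i]) -> cmeasurable_fun setT (SF f).
Proof.
move=> [mf _].
apply: (cmeas_cintegral_sf sfm (F := fun q : Z * borel G => f q.2 * (B q)^*)).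
by apply: cmeasM; [apply: (cmeas_comp mf); exact: measurable_snd|exact: cmeas_conj].
Qed.

Let SF_le f z : inL2 mu setT (f : borel G -> R[i]) ->
  normc (SF f z) <= hnorm (L2inner mu) f.
Proof.
move=> Lf; apply: le_trans (cauchy_schwarz (sesqui_L2 mu) Lf (LB z)) _.
by rewrite ler_piMr ?hnorm_ge0.
Qed.

Let atomE phi t x : atom alpha delta theta phi t x = phi x * eta (t^-1 * x)%g.
Proof. by rewrite /atom /eta; ring. Qed.

Let atom_version phi t x : Splus mu K phi -> eta (t^-1 * x)%g = xi (t^-1 * x)%g ->
  atom alpha delta theta phi t x = B ((t, phi), x).
Proof. by move=> sphi h; rewrite atomE h /B /E /crestrict mem_set. Qed.

Let stockwell_version f t (phi : G -> R[i]^o) : inL2 mu setT (f : borel G -> R[i]) -> Splus mu K phi ->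
  stockwell mu alpha delta theta f t phi = SF f (t, phi).
Proof.
move=> [mf Lf] sphi; have cphi := Splus_continuous sphi.
apply: ae_eq_cintegral.
- apply: cmeasM => //; apply: cmeas_conj.
  rewrite (_ : atom _ _ _ _ _ = fun x => phi x * eta (t^-1 * x)%g); last first.
    by apply/funext => x; exact: atomE.
  apply: cmeasM; first exact: borel_continuous_cmeas.
  by apply: (cmeas_comp meta); case: (mleft t^-1%g).
- by apply: cmeasM => //; apply: cmeas_conj; case: (LB (t, phi)).
- have H := mp_ae (mleft t^-1%g) eta_xi.
  by apply: (ae_imp2 H H) => x h _; rewrite atom_version.
Qed.

Section Operator.
Variable f : G -> R[i].
Hypothesis Lf : inL2 mu setT (f : borel G -> R[i]).

Let a z := w z * SF f z.

Let ma : cmeasurable_fun setT a.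
Proof. by apply: cmeasM => //; exact: mSF. Qed.

Let La : inL1 P setT a.
Proof.
apply: (inL1_le (g := fun z => ((hnorm (L2inner mu) f)%:E * (normc (w z))%:E)%E)) => //.
- by apply: measurable_funeM; exact: cmeas_enormc.
- move=> z; rewrite -EFinM lee_fin Normc.normcM mulrC ler_wpM2r ?normc_ge0//.
  exact: SF_le.
- rewrite ge0_integralZl_EFin ?hnorm_ge0//; last 2 first.
  + by move=> z _; rewrite lee_fin normc_ge0.
  + exact: cmeas_enormc.
  by rewrite lte_mul_pinfty// ?lee_fin ?hnorm_ge0//; case: Lw.
Qed.

Let y x := cintegral P setT (fun z => a z * B (z, x)).

(** The maps t |-> t^-1 x preserve null sets, so xi may replace eta under the
    integral over t for every single x. *)
Let locE x : localization nu alpha delta theta u f x =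
  cintegral nu setT (fun phi => cintegral mu setT (fun t => a (t, phi) * B ((t, phi), x))).
Proof.
rewrite /localization cint_mkcond; congr cintegral; apply/funext => phi.
rewrite /crestrict; case: ifPn => [|nphi]; last first.
  rewrite (_ : (fun t => _) = fun=> 0); last first.
    apply/funext => t; rewrite /a /w /crestrict memNset ?mul0r//=.
    by move=> [_]; move: nphi; rewrite notin_setE.
  by rewrite /cintegral !Rintegral_cst//= !mul0r.
rewrite inE => sphi; have cphi := Splus_continuous sphi.
have mat : cmeasurable_fun setT (fun t : borel G => a (t, phi)).
  by apply: (cmeas_comp ma); exact: measurable_pair2.
have mBt : cmeasurable_fun setT (fun t : borel G => B ((t, phi), x)).
  apply: (cmeas_comp mB (h := fun t : borel G => ((t, phi) : Z, x : borel G))).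
  by apply: measurable_fun_pair => //; exact: measurable_pair2.
have uE t : u (t, phi) * stockwell mu alpha delta theta f t phi = a (t, phi).
  by rewrite /a /w /crestrict mem_set// stockwell_version.
under [X in cintegral mu setT X]eq_fun do rewrite uE.
apply: ae_eq_cintegral.
- apply: cmeasM => //.
  rewrite (_ : (fun t => _) = fun t => phi x * eta (t^-1 * x)%g); last first.
    by apply/funext => t; exact: atomE.
  by apply: cmeasZ; apply: (cmeas_comp meta); case: (mconv x).
- exact: cmeasM.
- have H := mp_ae (mconv x) eta_xi.
  by apply: (ae_imp2 H H) => t h _; rewrite atom_version.
Qed.

Let loc_ae : {ae mu, forall x : borel G, localization nu alpha delta theta u f x = y x}.
Proof.
have H := superposition_inL1 sP sfm La mB B1.
apply: (ae_imp2 H H) => x Lx _; rewrite locE.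
exact: (@cfubini21 _ _ _ _ _ (sfpack sfm) (sfpack snu) (fun z => a z * B (z, x)) Lx).
Qed.

Let loc_cmeas : cmeasurable_fun setT (localization nu alpha delta theta u f : borel G -> R[i]).
Proof.
rewrite (_ : localization _ _ _ _ _ _ = fun x => cintegral nu setT (fun phi =>
  cintegral mu setT (fun t => a (t, phi) * B ((t, phi), x)))); last first.
  by apply/funext => x; exact: locE.
apply: (cmeas_cintegral_sf snu (F := fun p : borel G * borel S =>
  cintegral mu setT (fun t => a (t, p.2) * B ((t, p.2), p.1)))).
apply: (cmeas_cintegral_sf sfm (F := fun q : (borel G * borel S) * borel G =>
  a (q.2, q.1.2) * B ((q.2, q.1.2), q.1.1))).
have m1 : measurable_fun setT (fun q : (borel G * borel S) * borel G => (q.2, q.1.2) : Z).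
  apply: measurable_fun_pair; first exact: measurable_snd.
  by apply: (measurableT_comp measurable_snd); exact: measurable_fst.
apply: cmeasM; first exact: (cmeas_comp ma m1).
apply: (cmeas_comp mB (h := fun q : (borel G * borel S) * borel G => ((q.2, q.1.2), q.1.1))).
apply: measurable_fun_pair => //.
by apply: (measurableT_comp measurable_fst); exact: measurable_fst.
Qed.

Lemma localization_inL2_version :
  inL2 mu setT (localization nu alpha delta theta u f : borel G -> R[i]).
Proof.
have [my Ly] := superposition_inL2 sP sfm La mB B1.
by split; [exact: loc_cmeas|rewrite (ae_eq_L2norm loc_cmeas my loc_ae)].
Qed.

Lemma localization_inner_version g : inL2 mu setT (g : borel G -> R[i]) ->
  L2inner mu (localization nu alpha delta theta u f) g =
  cintegral P setT (fun z => w z * SF f z * (SF g z)^*).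
Proof.
move=> Lg; have Ly := superposition_inL2 sP sfm La mB B1.
rewrite /L2inner (ae_eq_inner localization_inL2_version Ly Lg loc_ae).
rewrite (superposition_inner sP sfm La mB B1 Lg).
by congr cintegral; apply/funext => z; congr (_ * _); exact: (ip_conj (sesqui_L2 mu) Lg (LB z)).
Qed.

End Operator.

Let sf := sesqui_L2K mu K.
Let Kc : hcomplete (L2K mu K) (L2inner mu) := L2K_complete mleft mright.
Let project f (Lf : inL2 mu setT (f : borel G -> R[i])) :=
  hprojection (sesqui_L2 mu) sf (fun f (hf : L2K mu K f) => hf.1) Kc Lf.

(** The operator is the weak integral of the rank one operators of the vectors
    b z, the projections of B (z, .) to L^2(G//K). *)
Lemma localization_trace_class_version :
  [/\ forall f, L2K mu K f ->
        inL2 mu setT (localization nu alpha delta theta u f : borel G -> R[i]),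
      exists T, is_localization_operator nu alpha delta theta u T &
      forall T, is_localization_operator nu alpha delta theta u T ->
        schatten_class (L2K mu K) (L2inner mu) 1 T /\
        (schatten_norm (L2K mu K) (L2inner mu) 1 T <= symbol_norm nu u)%E].
Proof.
split.
- by move=> f [Lf _]; exact: localization_inL2_version.
- have /choice[T hT] (f : G -> R[i]) : exists Tf, L2K mu K f -> L2K mu K Tf /\
      forall g, L2K mu K g -> L2inner mu (localization nu alpha delta theta u f) g = L2inner mu Tf g.
    have [Lf|nf] := pselect (L2K mu K f); last by exists 0.
    have [p Lp pE] := project (localization_inL2_version Lf.1).
    by exists p.
  exists T; split=> [f /hT[]//|f g Lf Lg].
  by have [_ ->] := hT f Lf.
move=> T [TH TE].
have /choice[b hb] (z : Z) : exists p, L2K mu K p /\ forall h, L2K mu K h ->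
    L2inner mu (fun x => B (z, x)) h = L2inner mu p h.
  by have [p Lp pE] := project (LB z); exists p.
have bH z : L2K mu K (b z) by case: (hb z).
have SFb f z : L2K mu K f -> SF f z = L2inner mu f (b z).
  move=> Lf; have [_ bE] := hb z.
  by rewrite /SF (ip_conj (sesqui_L2 mu) (LB z) Lf.1) bE// -(ip_conj sf).
have b1 z : hnorm (L2inner mu) (b z) <= 1.
  have [Lb bE] := hb z.
  have h : normc (L2inner mu (b z) (b z)) <= hnorm (L2inner mu) (b z).
    rewrite -bE//; apply: le_trans (cauchy_schwarz (sesqui_L2 mu) (LB z) Lb.1) _.
    by rewrite ler_piMl ?hnorm_ge0.
  move: h; rewrite (ip_hnorm sf Lb) normc_real ger0_norm ?sqr_ge0//.
  have := hnorm_ge0 (L2inner mu) (b z); move: (hnorm _ _) => r r0 rr.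
  by rewrite leNgt; apply/negP => r1; move: rr; rewrite leNgt expr2 ltr_pMl ?r1//; lra.
have mb f : L2K mu K f -> cmeasurable_fun setT (fun z => L2inner mu f (b z)).
  move=> Lf; rewrite (_ : (fun z => _) = SF f); first exact: mSF Lf.1.
  by apply/funext => z; rewrite SFb.
have TE' f g : L2K mu K f -> L2K mu K g -> L2inner mu (T f) g =
    cintegral P setT (fun z => w z * L2inner mu f (b z) * (L2inner mu g (b z))^*).
  move=> Lf Lg; rewrite TE// (localization_inner_version Lf.1 Lg.1).
  by congr cintegral; apply/funext => z; rewrite !SFb.
have symE : symbol_norm nu u = L1norm P setT w.
  exact: (L1norm_mkcond P (setT `*` (Splus mu K : set (borel S))) u).
have le : (schatten_norm (L2K mu K) (L2inner mu) 1 T <= symbol_norm nu u)%E.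
  by rewrite symE; exact: (schatten_norm_le sf Lw bH b1 mb TH TE').
split => //; split; first exact: (weak_compact sf Kc Lw bH b1 mb TH TE' hsep).
by apply: le_lt_trans le _; case: Lu.
Qed.

End Version.

Lemma localization_trace_class :
  [/\ forall f, L2K mu K f ->
        inL2 mu setT (localization nu alpha delta theta u f : borel G -> R[i]),
      exists T, is_localization_operator nu alpha delta theta u T &
      forall T, is_localization_operator nu alpha delta theta u T ->
        schatten_class (L2K mu K) (L2inner mu) 1 T /\
        (schatten_norm (L2K mu K) (L2inner mu) 1 T <= symbol_norm nu u)%E].
Proof.
have [xi [mxi mxiq eta_xi]] := quotient_cmeasurable_version hG lcG hmu eC Csub meta.
exact: (localization_trace_class_version mxi mxiq eta_xi).
Qed.

End Localization.

Theorem theorem4p9 (R : realType) (G : topGroupType)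
    (mu : {measure set (borel G) -> \bar R}) (K : set G)
    (nu : {measure set (borel (Splus_space mu K)) -> \bar R})
    (alpha : G -> G) (delta : R) (theta : G -> R[i])
    (u : G * (G -> R[i]^o) -> R[i]) :
  hausdorff_space G -> locally_compact [set: G] ->
  left_haar mu -> compact_subgroup K -> gelfand_pair mu K ->
  plancherel_measure nu ->
  hseparable (L2K mu K) (L2inner mu) ->
  topological_automorphism alpha -> modulus_of mu alpha delta ->
  L2K mu K theta -> hnorm (L2inner mu) theta = 1 ->
  inL1_symbol nu u ->
  [/\ forall f, L2K mu K f ->
        inL2 mu setT (localization nu alpha delta theta u f : borel G -> R[i]),
      exists T, is_localization_operator nu alpha delta theta u T &
      forall T, is_localization_operator nu alpha delta theta u T ->
        schatten_class (L2K mu K) (L2inner mu) 1 T /\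
        (schatten_norm (L2K mu K) (L2inner mu) 1 T <= symbol_norm nu u)%E].
Proof.
move=> hG lcG hmu hK gel hnu hsep halpha hdelta Ltheta theta1 Lu.
have [C [eC Cbi Csub]] := biinvariant_exhaustion hG lcG hmu hK hsep.
exact: (localization_trace_class hG lcG hmu hK gel hnu hsep halpha hdelta Ltheta
  theta1 Lu eC Cbi Csub).
Qed.
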